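(* Let $\kappa\in\mathbb{C}^*$, $\epsilon\in\{+,-\}$, $n\in\{1,\ldots,N\}$, and let ${}_{\mathsf n}\langle P,\kappa,\epsilon|$ and $|Q,\kappa,\epsilon\rangle_{\mathsf n}$ be left and right eigenstates of the twisted antiperiodic transfer matrix $\mathcal T_K(\lambda)$, $K=\mathrm{diag}(\kappa,\kappa^{-1})\cdot\sigma^x$, with respective eigenvalues $\epsilon\tau_P$ and $\epsilon\tau_Q$. Let $p_1,\ldots,p_N$ and $q_1,\ldots,q_N$ be the roots of $P$ and $Q$. Then the form factors of the local operators $\sigma_n^+$ and $\sigma_n^-$ in these two eigenstates coincide, and are given by $${}_{\mathsf n}\langle P,\kappa,\epsilon|\,\sigma_n^-\,|Q,\kappa,\epsilon\rangle_{\mathsf n}={}_{\mathsf n}\langle P,\kappa,\epsilon|\,\sigma_n^+\,|Q,\kappa,\epsilon\rangle_{\mathsf n}$$ $$=\epsilon\kappa\,e^{-\sum_j(p_j-\xi_j)}\,\frac{\prod_{k=1}^{n-1}\tau_P(\xi_k)}{\prod_{k=1}^n\tau_Q(\xi_k)}\ \frac{\det_N\left[\mathcal S^{(e^{-\eta})}(\mathbf q\,|\,\mathbf p)-\mathcal P^{(-)}(\mathbf q\,|\,\mathbf p,\xi_n)\right]-\det_N\left[\mathcal S^{(e^{-\eta})}(\mathbf q\,|\,\mathbf p)\right]}{\det_{1\le j,k\le N}\left[\coth\left(\frac{p_k-q_j-\eta}{2}\right)\right]},$$ where for any $\alpha$ and $1\le j,k\le N$ $$[\mathcal S^{(\alpha)}(\mathbf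 q\,|\,\mathbf p)]_{j,k}=\coth\left(\frac{p_k-q_j-\eta}{2}\right)+\alpha\,\mathfrak a_Q(p_k)\coth\left(\frac{p_k-q_j}{2}\right)-2\alpha\,\frac{d(p_k)}{a(q_j)}\frac{Q(q_j+\eta)P(q_j+i\pi)}{Q(p_k-\eta)P(p_k+i\pi)}\frac{1}{\sinh(p_k-q_j)},$$ and $\mathcal P^{(-)}(\mathbf q\,|\,\mathbf p,\xi_n)$ is a matrix of rank $1$ with elements $$\left[\mathcal P^{(-)}(\mathbf q\,|\,\mathbf p,\xi_n)\right]_{j,k}=\frac{e^{-\xi_n+p_k}\,a(\xi_n)\,d(p_k)}{(-2i)^N\,Q(p_k-\eta)\,P(p_k+i\pi)}\left[\frac{Q(\xi_n-\eta)}{P(\xi_n)}\coth\left(\frac{\xi_n-q_j-\eta}{2}\right)-\frac{Q(\xi_n-\eta+i\pi)}{P(\xi_n+i\pi)}\coth\left(\frac{\xi_n-q_j-\eta+i\pi}{2}\right)\right].$$ Alternatively, for arbitrary parameters $z_1,\ldots,z_N$, both form factors can be represented as $${}_{\mathsf n}\langle P,\kappa,\epsilon|\,\sigma_n^\pm\,|Q,\kappa,\epsilon\rangle_{\mathsf n}=\epsilon\kappa\,\frac{e^{-\sum_jp_j}\prod_{i,j=1}^N\left[\sinh(z_i-\xi_j)\sinh(\xi_j-p_i)\right]}{\prod_{j=1}^N\tau_Q(\xi_j)\prod_{i<j}\left[\sinh(z_j-z_i)\sinh(p_i-p_j)\right]}\ \frac{\prod_{k=1}^{n-1}\tau_P(\xi_k)}{\prod_{k=1}^n\tau_Q(\xi_k)}$$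 $$\qquad\times\left(\det_N\left[\mathcal S^{(e^{-\eta})}_{\tau_Q,\tau_P}(\mathbf z\,|\,\mathbf p)+\mathcal P^{(-)}_{\tau_Q}(\mathbf z\,|\,\mathbf p,\xi_n)\right]-\det_N\left[\mathcal S^{(e^{-\eta})}_{\tau_Q,\tau_P}(\mathbf z\,|\,\mathbf p)\right]\right),$$ where, with $\hat\tau_P(\lambda)=e^\lambda\tau_P(\lambda)/d(\lambda)$ and $\hat\tau_Q(\lambda)=e^\lambda\tau_Q(\lambda)/d(\lambda)$, $$[\mathcal S^{(\alpha)}_{\tau_Q,\tau_P}(\mathbf z\,|\,\mathbf p)]_{i,k}=\frac{\hat\tau_Q(z_i)-\hat\tau_Q(p_k)}{\sinh(z_i-p_k)}-\alpha\,\frac{\hat\tau_P(z_i)-\hat\tau_P(p_k+\eta)}{\sinh(z_i-p_k-\eta)},$$ and $\mathcal P^{(-)}_{\tau_Q}(\mathbf z\,|\,\mathbf p,\xi_n)$ is a matrix of rank $1$ with elements $$\left[\mathcal P^{(-)}_{\tau_Q}(\mathbf z\,|\,\mathbf p,\xi_n)\right]_{i,k}=\frac{e^{p_k}\,a(\xi_n)\,\tau_Q(\xi_n)}{\prod_{\ell=1}^N\sinh(\xi_n-p_\ell)\ \sinh(z_i-\xi_n)}.$$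
   Context: $N\ge 1$ is an integer; $\eta\in\mathbb{C}$ is not commensurate with $i\pi$; $\xi_1,\ldots,\xi_N\in\mathbb{C}$ are such that the sets $\Xi_i=\{\xi_i+k\eta+ik'\pi\mid k\in\{0,-1\},\,k'\in\mathbb{Z}\}$ satisfy $\Xi_i\cap\Xi_j=\emptyset$ for $i\ne j$. Set $a(\lambda)=\prod_{n=1}^N\sinh(\lambda-\xi_n+\eta)$, $d(\lambda)=\prod_{n=1}^N\sinh(\lambda-\xi_n)$, $\mathfrak a_Q(\lambda)=\frac{d(\lambda)}{a(\lambda)}\frac{Q(\lambda+\eta)}{Q(\lambda-\eta)}$, $\xi_n^{(h)}=\xi_n-h\eta$ for $h\in\{0,1\}$, $V(x_1,\ldots,x_N)=\prod_{i<j}\sinh(x_j-x_i)$. The sign $\epsilon$ is identified with $\pm1$ in formulas. Model: on $\mathcal H=\otimes_{n=1}^NV_n$, $V_n\simeq\mathbb{C}^2$, with auxiliary space $V_0\simeq\mathbb{C}^2$, the monodromy matrix is $T_0(\lambda)=R_{0,N}(\lambda-\xi_N)\cdots R_{0,1}(\lambda-\xi_1)=\begin{pmatrix}A(\lambda)&B(\lambda)\\C(\lambda)&D(\lambda)\end{pmatrix}_{[0]}$, with $R(\lambda)=\begin{pmatrix}\sinh(\lambda+\eta)&0&0&0\\0&\sinh\lambda&\sinh\eta&0\\0&\sinh\eta&\sinh\lambda&0\\0&0&0&\sinh(\lambda+\eta)\end{pmatrix}$. The transfer matrix is $\mathcal T_K(\lambda)=\mathrm{tr}_0[K_0T_0(\lambda)]=\kappa^{-1}B(\lambda)+\kappa\,C(\lambda)$,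 with $\sigma^x$ the Pauli matrix. $\sigma_n^-$ and $\sigma_n^+$ are the matrices $\begin{pmatrix}0&0\\1&0\end{pmatrix}$ and $\begin{pmatrix}0&1\\0&0\end{pmatrix}$ acting on $V_n$. SoV bases: there exist a basis $\{\langle\mathbf h|\}$ of $\mathcal H^*$ and a basis $\{|\mathbf h\rangle\}$ of $\mathcal H$, $\mathbf h\in\{0,1\}^N$, such that $\langle\mathbf h|\mathbf k\rangle=\delta_{\mathbf h,\mathbf k}/V(\xi_1^{(h_1)},\ldots,\xi_N^{(h_N)})$ and $$\langle\mathbf h|D(\lambda)=\prod_n\sinh(\lambda-\xi_n^{(h_n)})\langle\mathbf h|,\quad \langle\mathbf h|C(\lambda)=\sum_{a=1}^N\prod_{b\ne a}\frac{\sinh(\lambda-\xi_b^{(h_b)})}{\sinh(\xi_a^{(h_a)}-\xi_b^{(h_b)})}\delta_{h_a,0}\,d(\xi_a^{(1)})\langle\mathrm T_a^+\mathbf h|,$$ $$\langle\mathbf h|B(\lambda)=-\sum_{a=1}^N\prod_{b\ne a}\frac{\sinh(\lambda-\xi_b^{(h_b)})}{\sinh(\xi_a^{(h_a)}-\xi_b^{(h_b)})}\delta_{h_a,1}\,a(\xi_a^{(0)})\langle\mathrm T_a^-\mathbf h|,$$ $$D(\lambda)|\mathbf h\rangle=\prod_n\sinh(\lambda-\xi_n^{(h_n)})|\mathbf h\rangle,\quad C(\lambda)|\mathbf h\rangle=\sum_{a=1}^N\prod_{b\ne a}\frac{\sinh(\lambda-\xi_b^{(h_b)})}{\sinh(\xi_a^{(h_a)}-\xi_b^{(h_b)})}\delta_{h_a,1}\,d(\xi_a^{(1)})|\mathrm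 T_a^-\mathbf h\rangle,$$ $$B(\lambda)|\mathbf h\rangle=-\sum_{a=1}^N\prod_{b\ne a}\frac{\sinh(\lambda-\xi_b^{(h_b)})}{\sinh(\xi_a^{(h_a)}-\xi_b^{(h_b)})}\delta_{h_a,0}\,a(\xi_a^{(0)})|\mathrm T_a^+\mathbf h\rangle,$$ where $\mathrm T_a^\pm\mathbf h$ is $\mathbf h$ with $h_a$ replaced by $h_a\pm1$. Separate states: $${}_{\mathsf n}\langle P,\kappa,\epsilon|=\sum_{\mathbf h}\prod_{m=1}^N\left(\frac{\epsilon}{\kappa}\frac{P(\xi_m)}{P(\xi_m-\eta)}\right)^{1-h_m}V(\xi_1^{(h_1)},\ldots,\xi_N^{(h_N)})\langle\mathbf h|,$$ $$|Q,\kappa,\epsilon\rangle_{\mathsf n}=\sum_{\mathbf h}\prod_{m=1}^N\left(\epsilon\kappa\frac{Q(\xi_m)}{Q(\xi_m-\eta)}\right)^{1-h_m}\frac{V(\xi_1^{(1-h_1)},\ldots,\xi_N^{(1-h_N)})}{V(\xi_1,\ldots,\xi_N)}|\mathbf h\rangle.$$ Known characterization of eigenstates: ${}_{\mathsf n}\langle P,\kappa,\epsilon|$ is an eigenstate with eigenvalue $\epsilon\tau_P$ means that $P(\lambda)=\prod_{j=1}^N\sinh(\frac{\lambda-p_j}2)$, $(P(\xi_j),P(\xi_j+i\pi))\neq(0,0)$ for all $j$, $\tau_P$ is entire with $\tau_P(\lambda+i\pi)=(-1)^{N-1}\tau_P(\lambda)$, and $\tau_P(\lambda)P(\lambda)=-a(\lambda)P(\lambda-\eta)+d(\lambda)P(\lambda+\eta)$;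 similarly for $Q(\lambda)=\prod_{j=1}^N\sinh(\frac{\lambda-q_j}2)$ and $\tau_Q$. The identities are understood for parameters such that no denominator (including determinants in denominators) vanishes.
   Formalization: The claimed equality of the σ_n^+ and σ_n^- form factors is false (N=1, P=Q, κ²≠1); it is replaced by: the σ_n^+ form factor equals κ^{-2} e^{Σ_j(p_j−q_j)} times the σ_n^- one. Both determinant formulas hold as printed for σ_n^-, and times this factor for σ_n^+. *)

(* Defs.v *)
From HB Require Import structures.
From mathcomp Require Import all_boot all_order all_algebra.
From mathcomp Require Import all_classical all_reals all_analysis.
From mathcomp Require Import complex.

Set Implicit Arguments.
Unset Strict Implicit.
Unset Printing Implicit Defensive.

Import Order.TTheory GRing.Theory Num.Theory.
Import numFieldNormedType.Exports.

Local Open Scope ring_scope.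
Local Open Scope complex_scope.
Local Open Scope classical_set_scope.

Section ComplexFunctions.
Context {R : realType}.
Local Notation C := R[i].

Definition cexp (z : C) : C :=
  (expR (complex.Re z))%:C * (cos (complex.Im z) +i* sin (complex.Im z)).
Definition csinh (z : C) : C := (cexp z - cexp (- z)) / 2.
Definition ccosh (z : C) : C := (cexp z + cexp (- z)) / 2.
Definition ccoth (z : C) : C := ccosh z / csinh z.

Definition ipi : C := 0 +i* pi.

(* [derivable] over the field C itself is complex differentiability. *)
Definition entire (f : C -> C) : Prop :=
  forall z : C, derivable (f : C^o -> C^o) z 1.

Definition commensurate (x y : C) : Prop := exists r : rat, x = ratr r * y.

End ComplexFunctions.

Section Model.
Context {R : realType} (N : nat).
Local Notation C := R[i].

(* Elements of {0,1}^N.  They label both the canonical basis of the N-fold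
   tensor power of C^2 (0 for the first basis vector of a factor, 1 for the
   second) and the SoV bases. *)
Definition config := {ffun 'I_N -> 'I_2}.

(* The tensor product space: kets are columns, bras (the dual) are rows. *)
Local Notation op := 'M[C]_#|{: config}|.
Local Notation bra := 'rV[C]_#|{: config}|.
Local Notation ket := 'cV[C]_#|{: config}|.
Definition to_config (x : 'I_#|{: config}|) : config := enum_val x.
Definition pairing (u : bra) (v : ket) : C := (u *m v) ord0 ord0.
Definition matrix_element (u : bra) (M : op) (v : ket) : C :=
  pairing u (M *m v).

(* M acting on the n-th factor, identity on the others. *)
Definition site (n : 'I_N) (M : 'M[C]_2) : op :=
  \matrix_(x, y) (M (to_config x n) (to_config y n) *
    [forall m, (m != n) ==> (to_config x m == to_config y m)]%:R).

Definition sigma_minus (n : 'I_N) : op := site n (delta_mx 1 0).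
Definition sigma_plus (n : 'I_N) : op := site n (delta_mx 0 1).

Variables (eta : C) (xi : 'I_N -> C).

Definition a (lam : C) : C := \prod_n csinh (lam - xi n + eta).
Definition d (lam : C) : C := \prod_n csinh (lam - xi n).

(* k ranges over {0,-1}. *)
Definition Xi (i : 'I_N) : set C :=
  [set x | exists2 k : int, k = 0 \/ k = -1 &
           exists k' : int, x = xi i + k%:~R * eta + k'%:~R * ipi].

Definition Rmatrix (lam : C) : 'M[C]_4 :=
  \matrix_(i, j) nth 0 (nth [::]
    [:: [:: csinh (lam + eta); 0; 0; 0];
        [:: 0; csinh lam; csinh eta; 0];
        [:: 0; csinh eta; csinh lam; 0];
        [:: 0; 0; 0; csinh (lam + eta)]] i) j.

(* Operators on V_0 (x) H are 2 x 2 matrices (on the auxiliary space V_0) with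
   entries in [op]; the row and column of R are indexed by 2 * (state of V_0)
   + (state of V_n). *)
Definition R0 (n : 'I_N) (lam : C) : 'M[op]_2 :=
  \matrix_(i, j) site n
    (\matrix_(s, t) Rmatrix lam (inord (2 * i + s)%N) (inord (2 * j + t)%N)).

(* The factor attached to the last site comes first. *)
Definition monodromy (lam : C) : 'M[op]_2 :=
  \big[mulmx/1%:M]_(m < N) R0 (rev_ord m) (lam - xi (rev_ord m)).

Definition opA lam : op := monodromy lam 0 0.
Definition opB lam : op := monodromy lam 0 1.
Definition opC lam : op := monodromy lam 1 0.
Definition opD lam : op := monodromy lam 1 1.

Definition sigma_x : 'M[C]_2 := delta_mx 0 1 + delta_mx 1 0.
Definition twist (kappa : C) : 'M[C]_2 :=
  (kappa *: delta_mx 0 0 + kappa^-1 *: delta_mx 1 1) *m sigma_x.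
Definition transfer (kappa lam : C) : op :=
  \tr (map_mx (fun c : C => c%:M : op) (twist kappa) *m monodromy lam).

Definition xi_shift (n : 'I_N) (h : nat) : C := xi n - h%:R * eta.

Definition V (x : 'I_N -> C) : C :=
  \prod_(i < N) \prod_(j < N | (i < j)%N) csinh (x j - x i).

Definition set_config (h : config) (k : 'I_N) (v : nat) : config :=
  [ffun m => if m == k then inord v else h m].
Definition Tplus (k : 'I_N) (h : config) : config := set_config h k (h k).+1.
Definition Tminus (k : 'I_N) (h : config) : config := set_config h k (h k).-1.

Definition sov_eigenvalue (h : config) (lam : C) : C :=
  \prod_n csinh (lam - xi_shift n (h n)).
Definition sov_coef (h : config) (k : 'I_N) (lam : C) : C :=
  \prod_(b | b != k) (csinh (lam - xi_shift b (h b)) /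
                      csinh (xi_shift k (h k) - xi_shift b (h b))).

Record SoV_bases (br : config -> bra) (kt : config -> ket) : Prop := {
  sov_bra_basis : basis_of fullv [seq br h | h : config];
  sov_ket_basis : basis_of fullv [seq kt h | h : config];
  sov_pairing : forall h k, pairing (br h) (kt k) =
    (h == k)%:R / V (fun n => xi_shift n (h n));
  sov_bra_D : forall h lam,
    br h *m opD lam = sov_eigenvalue h lam *: br h;
  sov_bra_C : forall h lam,
    br h *m opC lam = \sum_k (sov_coef h k lam * (h k == 0)%:R *
                              d (xi_shift k 1)) *: br (Tplus k h);
  sov_bra_B : forall h lam,
    br h *m opB lam = - \sum_k (sov_coef h k lam * (h k == 1)%:R *
                                a (xi_shift k 0)) *: br (Tminus k h);
  sov_ket_D : forall h lam,
    opD lam *m kt h = sov_eigenvalue h lam *: kt h;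
  sov_ket_C : forall h lam,
    opC lam *m kt h = \sum_k (sov_coef h k lam * (h k == 1)%:R *
                              d (xi_shift k 1)) *: kt (Tminus k h);
  sov_ket_B : forall h lam,
    opB lam *m kt h = - \sum_k (sov_coef h k lam * (h k == 0)%:R *
                                a (xi_shift k 0)) *: kt (Tplus k h)
}.

Definition separate_bra (br : config -> bra) (P : C -> C) (kappa eps : C) : bra :=
  \sum_(h : config)
    ((\prod_m (eps / kappa * (P (xi m) / P (xi m - eta))) ^+ (1 - h m)) *
     V (fun n => xi_shift n (h n))) *: br h.

Definition separate_ket (kt : config -> ket) (Q : C -> C) (kappa eps : C) : ket :=
  \sum_(h : config)
    ((\prod_m (eps * kappa * (Q (xi m) / Q (xi m - eta))) ^+ (1 - h m)) *
     (V (fun n => xi_shift n (1 - h n)) / V xi)) *: kt h.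

Definition tpoly (r : 'I_N -> C) (lam : C) : C :=
  \prod_j csinh ((lam - r j) / 2).

(* The data (r, tau) of the SoV characterization of the spectrum, with
   P = tpoly r. *)
Record TQ_data (r : 'I_N -> C) (tau : C -> C) : Prop := {
  TQ_nonzero : forall j,
    (tpoly r (xi j), tpoly r (xi j + ipi)) <> (0, 0);
  TQ_entire : entire tau;
  TQ_quasiperiodic : forall lam, tau (lam + ipi) = (-1) ^+ N.-1 * tau lam;
  TQ_equation : forall lam,
    tau lam * tpoly r lam =
      - a lam * tpoly r (lam - eta) + d lam * tpoly r (lam + eta)
}.

Definition left_eigenstate (br : config -> bra) (kappa eps : C)
    (p : 'I_N -> C) (tau : C -> C) : Prop :=
  [/\ TQ_data p tau,
      separate_bra br (tpoly p) kappa eps != 0 &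
      forall lam, separate_bra br (tpoly p) kappa eps *m transfer kappa lam =
                  (eps * tau lam) *: separate_bra br (tpoly p) kappa eps].

Definition right_eigenstate (kt : config -> ket) (kappa eps : C)
    (q : 'I_N -> C) (tau : C -> C) : Prop :=
  [/\ TQ_data q tau,
      separate_ket kt (tpoly q) kappa eps != 0 &
      forall lam, transfer kappa lam *m separate_ket kt (tpoly q) kappa eps =
                  (eps * tau lam) *: separate_ket kt (tpoly q) kappa eps].

Definition frak_a (Q : C -> C) (lam : C) : C :=
  d lam / a lam * (Q (lam + eta) / Q (lam - eta)).

Definition coth_matrix (q p : 'I_N -> C) : 'M[C]_N :=
  \matrix_(j, k) ccoth ((p k - q j - eta) / 2).

Definition S_matrix (alpha : C) (q p : 'I_N -> C) : 'M[C]_N :=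
  let P := tpoly p in let Q := tpoly q in
  \matrix_(j, k)
    (ccoth ((p k - q j - eta) / 2)
     + alpha * frak_a Q (p k) * ccoth ((p k - q j) / 2)
     - 2 * alpha * (d (p k) / a (q j))
       * ((Q (q j + eta) * P (q j + ipi)) / (Q (p k - eta) * P (p k + ipi)))
       * (csinh (p k - q j))^-1).

Definition P_matrix (q p : 'I_N -> C) (x : C) : 'M[C]_N :=
  let P := tpoly p in let Q := tpoly q in
  \matrix_(j, k)
    ((cexp (- x + p k) * a x * d (p k)) /
       ((- 2 * 'i%C) ^+ N * Q (p k - eta) * P (p k + ipi))
     * (Q (x - eta) / P x * ccoth ((x - q j - eta) / 2)
        - Q (x - eta + ipi) / P (x + ipi)
          * ccoth ((x - q j - eta + ipi) / 2))).

Definition tau_hat (tau : C -> C) (lam : C) : C := cexp lam * tau lam / d lam.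

Definition S_tau_matrix (alpha : C) (tauQ tauP : C -> C) (z p : 'I_N -> C) :
    'M[C]_N :=
  \matrix_(i, k)
    ((tau_hat tauQ (z i) - tau_hat tauQ (p k)) / csinh (z i - p k)
     - alpha * ((tau_hat tauP (z i) - tau_hat tauP (p k + eta)) /
                csinh (z i - p k - eta))).

Definition P_tau_matrix (tauQ : C -> C) (z p : 'I_N -> C) (x : C) : 'M[C]_N :=
  \matrix_(i, k)
    (cexp (p k) * a x * tauQ x /
     ((\prod_l csinh (x - p l)) * csinh (z i - x))).

(* prod_(k < n) tau_P(xi_k) / prod_(k <= n) tau_Q(xi_k) *)
Definition tau_ratio (tauP tauQ : C -> C) (n : 'I_N) : C :=
  (\prod_(k < N | (k < n)%N) tauP (xi k)) /
  (\prod_(k < N | (k <= n)%N) tauQ (xi k)).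

Definition form_factor_roots (kappa eps : C) (p q : 'I_N -> C)
    (tauP tauQ : C -> C) (n : 'I_N) : C :=
  let S := S_matrix (cexp (- eta)) q p in
  eps * kappa * cexp (- \sum_j (p j - xi j)) * tau_ratio tauP tauQ n *
  ((\det (S - P_matrix q p (xi n)) - \det S) / \det (coth_matrix q p)).

Definition form_factor_tau (kappa eps : C) (z p : 'I_N -> C)
    (tauP tauQ : C -> C) (n : 'I_N) : C :=
  let S := S_tau_matrix (cexp (- eta)) tauQ tauP z p in
  eps * kappa *
  ((cexp (- \sum_j p j) *
    \prod_(i < N) \prod_(j < N) (csinh (z i - xi j) * csinh (xi j - p i))) /
   ((\prod_j tauQ (xi j)) *
    \prod_(i < N) \prod_(j < N | (i < j)%N)
       (csinh (z j - z i) * csinh (p i - p j)))) *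
  tau_ratio tauP tauQ n *
  (\det (S + P_tau_matrix tauQ z p (xi n)) - \det S).

(* None of the denominators of [form_factor_roots] vanishes. *)
Record roots_regular (p q : 'I_N -> C) (tauQ : C -> C) (n : 'I_N) : Prop := {
  rr_tauQ : forall k : 'I_N, (k <= n)%N -> tauQ (xi k) != 0;
  rr_det : \det (coth_matrix q p) != 0;
  rr_sinh_eta : forall j k, csinh ((p k - q j - eta) / 2) != 0;
  rr_sinh_half : forall j k, csinh ((p k - q j) / 2) != 0;
  rr_sinh : forall j k, csinh (p k - q j) != 0;
  rr_a_p : forall k, a (p k) != 0;
  rr_a_q : forall j, a (q j) != 0;
  rr_Q : forall k, tpoly q (p k - eta) != 0;
  rr_P : forall k, tpoly p (p k + ipi) != 0;
  rr_P_xi : tpoly p (xi n) != 0;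
  rr_P_xi_ipi : tpoly p (xi n + ipi) != 0;
  rr_sinh_xi : forall j, csinh ((xi n - q j - eta) / 2) != 0;
  rr_sinh_xi_ipi : forall j, csinh ((xi n - q j - eta + ipi) / 2) != 0
}.

(* None of the denominators of [form_factor_tau] vanishes. *)
Record tau_regular (z p : 'I_N -> C) (tauQ : C -> C) (n : 'I_N) : Prop := {
  tr_tauQ : forall j, tauQ (xi j) != 0;
  tr_z : forall i j : 'I_N, (i < j)%N -> csinh (z j - z i) != 0;
  tr_p : forall i j : 'I_N, (i < j)%N -> csinh (p i - p j) != 0;
  tr_d_z : forall i, d (z i) != 0;
  tr_d_p : forall k, d (p k) != 0;
  tr_d_p_eta : forall k, d (p k + eta) != 0;
  tr_zp : forall i k, csinh (z i - p k) != 0;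
  tr_zp_eta : forall i k, csinh (z i - p k - eta) != 0;
  tr_xi_p : forall l, csinh (xi n - p l) != 0;
  tr_z_xi : forall i, csinh (z i - xi n) != 0
}.

End Model.

(* Main.v *)
Require Import Defs.
From mathcomp Require Import all_boot all_order all_algebra.
From mathcomp Require Import all_classical all_reals all_analysis.
From mathcomp Require Import complex.
From mathcomp Require Import ring.

(* By unitarity of [R], the product of the transfer matrices at
   [xi_1, .., xi_(n-1)] times [tr (K T (xi_n))] is turned into the same product
   with [X K] in place of [K] in the last trace by applying [X] to the [n]-th
   site. Hence the form factors of [sigma_n^-] and [sigma_n^+] are, up to
   eigenvalues, the matrix elements of [D (xi_n)] and [A (xi_n)]. The product of
   all the transfer matrices at the [xi_k] is proportional to
   [G = K (x) .. (x) K], with [G^2 = 1] and [A = G D G], so the two matrix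
   elements differ by [prod_k tau_P (xi_k) / tau_Q (xi_k)], which is
   [exp (sum_j (p_j - q_j))].

   In the SoV bases [D (xi_n)] is diagonal, and its matrix element is a sum over
   configurations which is the expansion along rows of a determinant of
   trigonometric polynomials of degree [N-1] evaluated at the [xi_k] and
   [xi_k - eta]. In the basis [prod_(l <> j) sinh (x - p_l)] it becomes
   [det (M + E) - det M], where [M_lk = tau_Q (xi_l) / sinh (xi_l - p_k)
   - e^-eta tau_P (xi_l) / sinh (xi_l - p_k - eta)] and [E] lives on the [n]-th
   row. Both determinant formulas follow from factorizations [S = Y M], [P = Y E]
   up to diagonal matrices, obtained by Lagrange interpolation; [tau_P] is a
   trigonometric polynomial since
   [P (x - eta) P (x + i pi) + P (x - eta + i pi) P (x)] is proportional to [d]. *)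

Import Order.TTheory GRing.Theory Num.Theory.
Import numFieldNormedType.Exports.
Local Open Scope ring_scope.
Local Open Scope complex_scope.
Local Open Scope classical_set_scope.

Section ComplexExponential.
Set Implicit Arguments.
Unset Strict Implicit.
Context {R : realType}.
Local Notation C := R[i].
Implicit Types x y z : C.

Lemma cexpD x y : cexp (x + y) = cexp x * cexp y.
Proof.
case: x y => [u v] [u' v']; rewrite /cexp /= expRD cosD sinD.
by apply/eqP; rewrite eq_complex /=; apply/andP; split; apply/eqP; ring.
Qed.

Lemma cexp0 : cexp (0 : C) = 1.
Proof. by rewrite /cexp /= expR0 cos0 sin0 -complexr0 mulr1. Qed.

Lemma cexp_neq0 z : cexp z != 0.
Proof.
apply/eqP => h; have := cexpD z (- z); rewrite addrN cexp0 h mul0r => /eqP.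
by rewrite oner_eq0.
Qed.

Lemma cexpN z : cexp (- z) = (cexp z)^-1.
Proof.
by apply: (mulfI (cexp_neq0 z)); rewrite -cexpD addrN cexp0 divff ?cexp_neq0.
Qed.

Lemma cexpB x y : cexp (x - y) = cexp x / cexp y.
Proof. by rewrite cexpD cexpN. Qed.

Lemma cexp_half z : cexp (z / 2) ^+ 2 = cexp z.
Proof. by rewrite expr2 -cexpD -splitr. Qed.

Lemma cexp_sum (I : finType) (f : I -> C) :
  cexp (\sum_i f i) = \prod_i cexp (f i).
Proof.
exact: (big_morph _ cexpD cexp0).
Qed.

Lemma cexp_ipi : cexp (ipi : C) = -1.
Proof.
rewrite /cexp /= expR0 cospi sinpi.
by apply/eqP; rewrite eq_complex /= !mul0r !mul1r subr0 addr0 oppr0 !eqxx.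
Qed.

Lemma cexp_ipi_half : cexp (ipi / 2 : C) = 'i.
Proof.
have -> : (ipi / 2 : C) = 0 +i* (pi / 2).
  have e : (ipi : C) = (0 +i* (pi / 2)) + (0 +i* (pi / 2)).
    by apply/eqP; rewrite eq_complex /= addr0 -splitr !eqxx.
  by rewrite {1}e mulrDl -splitr.
rewrite /cexp /= expR0 cos_pihalf sin_pihalf.
by apply/eqP; rewrite eq_complex /= !mul0r !mul1r subr0 addr0 !eqxx.
Qed.

Lemma two_neq0 : (2 : C) != 0. Proof. by rewrite pnatr_eq0. Qed.

Lemma csinhE z : csinh z = (cexp z - (cexp z)^-1) / 2.
Proof. by rewrite /csinh cexpN. Qed.

Lemma ccoshE z : ccosh z = (cexp z + (cexp z)^-1) / 2.
Proof. by rewrite /ccosh cexpN. Qed.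

Lemma csinhN z : csinh (- z) = - csinh z.
Proof. by rewrite !csinhE cexpN; field; rewrite ?cexp_neq0. Qed.

Lemma csinh_ipi z : csinh (z + ipi) = - csinh z.
Proof.
by rewrite !csinhE cexpD cexp_ipi; field; rewrite ?cexp_neq0.
Qed.

Lemma sqr_i : ('i%C : C) ^+ 2 = -1.
Proof. by rewrite -cexp_ipi_half cexp_half cexp_ipi. Qed.

Lemma i_neq0 : ('i%C : C) != 0.
Proof. by rewrite -cexp_ipi_half cexp_neq0. Qed.

Lemma csinh_half_ipi z : csinh ((z + ipi) / 2) = 'i%C * ccosh (z / 2).
Proof.
rewrite csinhE ccoshE (mulrDl z) cexpD cexp_ipi_half.
apply: (mulfI i_neq0); rewrite [RHS]mulrA -expr2 sqr_i.
rewrite invfM.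
have -> : ('i%C : C)^-1 = - 'i%C.
  by apply: (mulfI i_neq0); rewrite divff ?i_neq0 // mulrN -expr2 sqr_i opprK.
by transitivity ('i%C ^+ 2 * (cexp (z / 2) + (cexp (z / 2))^-1) / 2);
   [ring | rewrite sqr_i; ring].
Qed.

Lemma ccosh_half_ipi z : ccosh ((z + ipi) / 2) = 'i%C * csinh (z / 2).
Proof.
rewrite csinhE ccoshE (mulrDl z) cexpD cexp_ipi_half invfM.
have -> : ('i%C : C)^-1 = - 'i%C.
  by apply: (mulfI i_neq0); rewrite divff ?i_neq0 // mulrN -expr2 sqr_i opprK.
by ring.
Qed.

Lemma csinh_double z : csinh z = 2 * csinh (z / 2) * ccosh (z / 2).
Proof.
rewrite !csinhE ccoshE -{1 2}(cexp_half z).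
by field; rewrite ?cexp_neq0.
Qed.

Lemma csinh_eq0 z : csinh z = 0 -> exists k : int, z = k%:~R * ipi.
Proof.
move=> /eqP; rewrite mulf_eq0 invr_eq0 (negbTE two_neq0) orbF subr_eq0 => /eqP.
case: z => [u v]; rewrite /cexp /= cosN sinN => /eqP.
rewrite eq_complex /= !mul0r !subr0 !addr0 => /andP[/eqP hc /eqP hs].
have sv0 : sin v = 0.
  have h : (expR u + expR (- u)) * sin v = 0.
    by rewrite mulrDl hs mulrN addNr.
  move/eqP: h; rewrite mulf_eq0 => /orP[|/eqP //].
  by rewrite gt_eqF // addr_gt0 ?expR_gt0.
have cv0 : cos v != 0.
  by rewrite -normr_eq0 sin0cos1 // oner_eq0.
have u0 : u = 0.
  move/(mulIf cv0): hc => /expR_inj h.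
  by apply/eqP; rewrite -[_ == _](mulrn_eq0 u 2) mulr2n {2}h addrN.
exists (Num.floor (v / pi)).
have pi0 : (0 : R) < pi := pi_gt0 R.
set k := Num.floor _.
have /andP[hk1 hk2] := floor_itv (v / pi).
rewrite -/k in hk1 hk2.
have sinz : forall (w : R) (n : int), sin w = 0 -> sin (w + n%:~R * pi) = 0.
  move=> w n w0; case: n => n.
    by rewrite -pmulrn mulr_natl sinD w0 mul0r add0r; elim: n => [|n /eqP];
      rewrite ?mulr0n ?sin0 ?mulr0 // mulf_eq0 mulrSr sinD sinpi mulr0 addr0
      => /orP[] /eqP -> ; rewrite ?mul0r ?mulr0.
  rewrite NegzE mulrNz mulNr -pmulrn mulr_natl sinB w0 mul0r sub0r.
  apply/eqP; rewrite oppr_eq0; apply/eqP.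
  elim: n.+1 => [|m /eqP]; first by rewrite mulr0n sin0 mulr0.
  by rewrite mulf_eq0 mulrSr sinD sinpi mulr0 addr0
      => /orP[] /eqP -> ; rewrite ?mul0r ?mulr0.
have sr : sin (v - k%:~R * pi) = 0.
  by rewrite -mulNr -mulrNz; exact: sinz.
have r1 : 0 <= v - k%:~R * pi by rewrite subr_ge0 -ler_pdivlMr.
have r2 : v - k%:~R * pi < pi.
  by rewrite ltrBlDl -[X in _ + X]mul1r -mulrDl -ltr_pdivrMr // -intrD1.
have r0 : v - k%:~R * pi = 0.
  apply/eqP; move: r1; rewrite le_eqVlt eq_sym => /orP[//|r1].
  have := @sin_gt0_pi R (v - k%:~R * pi); rewrite r1 r2 sr ltxx => /(_ isT) //.
rewrite u0; move/eqP: r0; rewrite subr_eq0 => /eqP ->.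
have -> : (k%:~R : C) = (k%:~R : R)%:C by rewrite rmorph_int.
by apply/eqP; rewrite eq_complex /= !mul0r !mulr0 subr0 addr0 !eqxx.
Qed.

End ComplexExponential.

Opaque cexp csinh ccosh.

Section TrigPolynomials.
Set Implicit Arguments.
Unset Strict Implicit.
Context {R : realType}.
Local Notation C := R[i].
Implicit Types (f g : C -> C) (x y z lam : C) (m : nat).

(* Combinations of [e^(k lam/2)] with [k = -m, -m+2, .., m]. *)
Definition half_trig m f : Prop :=
  exists2 r : {poly C}, (size r <= m.+1)%N &
    forall lam, f lam = cexp (lam / 2) ^- m * r.[cexp lam].

(* Combinations of [e^(k lam)] with [k = 1-m, 3-m, .., m-1]. *)
Definition trig m f : Prop :=
  exists2 r : {poly C}, (size r <= m)%N &
    forall lam, f lam = cexp lam ^- m * cexp lam * r.[cexp lam ^+ 2].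

Lemma half_trig1 u v :
  half_trig 1 (fun lam => u * cexp (lam / 2) + v * (cexp (lam / 2))^-1).
Proof.
exists (u *: 'X + v%:P) => [|lam].
  by rewrite (leq_trans (size_polyD _ _)) // geq_max
    (leq_trans (size_scale_leq _ _)) ?size_polyX ?(leq_trans (size_polyC_leq1 _)).
rewrite hornerD hornerZ hornerX hornerC -(cexp_half lam).
have := cexp_neq0 (lam / 2); move: (cexp (lam / 2)) => y h.
by field.
Qed.

Lemma half_trig_csinh b : half_trig 1 (fun lam => csinh ((lam - b) / 2)).
Proof.
have [r hr e] := half_trig1 ((cexp (b / 2))^-1 / 2) (- (cexp (b / 2)) / 2).
exists r => // lam; rewrite -e csinhE (mulrBl _ lam) cexpB.
by field; rewrite ?cexp_neq0.
Qed.

Lemma half_trig_ccosh b : half_trig 1 (fun lam => ccosh ((lam - b) / 2)).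
Proof.
have [r hr e] := half_trig1 ((cexp (b / 2))^-1 / 2) (cexp (b / 2) / 2).
exists r => // lam; rewrite -e ccoshE (mulrBl _ lam) cexpB.
by field; rewrite ?cexp_neq0.
Qed.

Lemma half_trigM m n f g : half_trig m f -> half_trig n g ->
  half_trig (m + n) (fun lam => f lam * g lam).
Proof.
move=> [r hr e] [s hs e']; exists (r * s) => [|lam].
  apply: leq_trans (size_polyMleq _ _) _.
  by rewrite -subn1 leq_subLR add1n -addnS -addSn leq_add.
by rewrite e e' hornerM exprD invfM; ring.
Qed.

Lemma half_trig_prod (I : finType) (P : pred I) (F : I -> C -> C) :
  (forall i, P i -> half_trig 1 (F i)) ->
  half_trig #|P| (fun lam => \prod_(i | P i) F i lam).
Proof.
move=> h.
have -> : (fun lam => \prod_(i | P i) F i lam) =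
  (fun lam => \prod_(i <- enum P) F i lam).
  by apply/funext => lam; rewrite big_enum.
rewrite cardE.
have : all P (enum P) by apply/allP => i; rewrite mem_enum.
elim: (enum P) => [_|i s IH /= /andP[Pi /IH {}IH]].
  exists 1 => [|lam]; first by rewrite size_poly1.
  by rewrite big_nil hornerC expr0 invr1 mulr1.
rewrite -add1n.
have [r hr e] := half_trigM (h i Pi) IH.
by exists r => // lam; rewrite big_cons.
Qed.

Lemma half_trig_shift m f b : half_trig m f -> half_trig m (fun lam => f (lam + b)).
Proof.
move=> [r hr e].
exists (cexp (b / 2) ^- m *: (r \Po (cexp b *: 'X))) => [|lam].
  apply: leq_trans (size_scale_leq _ _) _.
  by rewrite size_comp_poly2 // size_scale ?size_polyX ?cexp_neq0.
rewrite e hornerZ horner_comp hornerZ hornerX (mulrDl lam) !cexpD exprMn invfM.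
by rewrite [cexp lam * cexp b]mulrC -mulrA.
Qed.

Lemma half_trig_tpoly n (r : 'I_n -> C) : half_trig n (tpoly r).
Proof.
rewrite -[X in half_trig X]card_ord.
exact: (@half_trig_prod _ xpredT (fun j lam => csinh ((lam - r j) / 2))
  (fun j _ => half_trig_csinh (r j))).
Qed.

Lemma trig_odd n f : half_trig (n + n) f ->
  trig n (fun lam => f lam - (-1) ^+ n * f (lam + ipi)).
Proof.
move=> [r hr e]; exists (2 *: odd_poly r) => [|lam].
  apply: leq_trans (size_scale_leq _ _) _; apply: leq_trans (size_odd_poly _) _.
  by rewrite -(half_bit_double n true) half_leq // -addnn addnC addn1.
rewrite !e (mulrDl lam) !cexpD cexp_ipi cexp_ipi_half -(cexp_half lam).
have := cexp_neq0 (lam / 2); move: (cexp (lam / 2)) => y h.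
have -> : (y * 'i%C) ^+ (n + n) = (-1) ^+ n * (y ^+ 2) ^+ n.
  by rewrite addnn -mul2n exprM [(y * _) ^+ 2]exprMn sqr_i exprMn mulrC.
have -> : y ^+ (n + n) = (y ^+ 2) ^+ n by rewrite -exprM mul2n addnn.
rewrite hornerZ -{1 2}(poly_even_odd r) !(hornerD, hornerM, horner_comp, hornerX, hornerXn).
have hw := negbT (signr_eq0 C n); set w : C := (-1) ^+ n in hw *.
by rewrite !mulrN1 mulrNN -expr2; field; rewrite hw !expf_neq0.
Qed.

Lemma trig_even n f : half_trig (n + n) f ->
  trig n.+1 (fun lam => f lam + (-1) ^+ n * f (lam + ipi)).
Proof.
move=> [r hr e]; exists (2 *: even_poly r) => [|lam].
  apply: leq_trans (size_scale_leq _ _) _; apply: leq_trans (size_even_poly _) _.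
  by rewrite uphalfE -(doubleK n.+1) half_leq // doubleS -addnn !ltnS.
rewrite !e (mulrDl lam) !cexpD cexp_ipi cexp_ipi_half -(cexp_half lam).
have := cexp_neq0 (lam / 2); move: (cexp (lam / 2)) => y h.
have -> : (y * 'i%C) ^+ (n + n) = (-1) ^+ n * (y ^+ 2) ^+ n.
  by rewrite addnn -mul2n exprM [(y * _) ^+ 2]exprMn sqr_i exprMn mulrC.
have -> : y ^+ (n + n) = (y ^+ 2) ^+ n by rewrite -exprM mul2n addnn.
rewrite hornerZ -{1 2}(poly_even_odd r) !(hornerD, hornerM, horner_comp, hornerX, hornerXn).
have hw := negbT (signr_eq0 C n); set w : C := (-1) ^+ n in hw *.
by rewrite !mulrN1 mulrNN -expr2 (exprSr (y ^+ 2) n); field; rewrite hw h !expf_neq0.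
Qed.

Lemma trig_csinh b : trig 2 (fun lam => csinh (lam - b)).
Proof.
exists (((cexp b)^-1 / 2) *: 'X - (cexp b / 2)%:P) => [|lam].
  by rewrite (leq_trans (size_polyD _ _)) // size_polyN geq_max
    (leq_trans (size_scale_leq _ _)) ?size_polyX ?(leq_trans (size_polyC_leq1 _)).
rewrite hornerD hornerZ hornerX hornerN hornerC csinhE cexpB.
have := cexp_neq0 lam; have := cexp_neq0 b.
by move: (cexp lam) (cexp b) => x y hx hy; field; rewrite hx.
Qed.

Lemma trig_const u : trig 1 (fun=> u).
Proof.
exists u%:P => [|lam]; first exact: size_polyC_leq1.
by rewrite hornerC expr1 mulVf ?cexp_neq0 ?mul1r.
Qed.

Lemma trigM m n f g : trig m.+1 f -> trig n.+1 g ->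
  trig (m + n).+1 (fun lam => f lam * g lam).
Proof.
move=> [r hr e] [s hs e']; exists (r * s) => [|lam].
  apply: leq_trans (size_polyMleq _ _) _.
  by rewrite -subn1 leq_subLR add1n -addnS -addSn leq_add.
rewrite e e' hornerM; have := cexp_neq0 lam; move: (cexp lam) => x hx.
by rewrite !exprSr exprD; field; rewrite hx !expf_neq0.
Qed.

Lemma trigD m f g : trig m f -> trig m g -> trig m (fun lam => f lam + g lam).
Proof.
move=> [r hr e] [s hs e']; exists (r + s) => [|lam].
  by rewrite (leq_trans (size_polyD _ _)) // geq_max hr.
by rewrite e e' hornerD mulrDr.
Qed.

Lemma trigZ m u f : trig m f -> trig m (fun lam => u * f lam).
Proof.
move=> [r hr e]; exists (u *: r) => [|lam].
  exact: leq_trans (size_scale_leq _ _) hr.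
by rewrite e hornerZ mulrCA.
Qed.

Lemma trig_sum m (I : finType) (F : I -> C -> C) :
  (forall i, trig m (F i)) -> trig m (fun lam => \sum_i F i lam).
Proof.
move=> h; rewrite (_ : (fun _ => _) = (fun lam => \sum_(i <- enum I) F i lam)); last first.
  by apply/funext => lam; rewrite big_enum.
elim: (enum I) => [|i s IH].
  by exists 0 => [|lam]; rewrite ?size_poly0 // big_nil horner0 mulr0.
have [r hr e] := trigD (h i) IH.
by exists r => // lam; rewrite big_cons.
Qed.

Lemma trig_prod_csinh (I : finType) (P : pred I) (y : I -> C) :
  trig #|P|.+1 (fun lam => \prod_(i | P i) csinh (lam - y i)).
Proof.
have -> : (fun lam => \prod_(i | P i) csinh (lam - y i)) =
  (fun lam => \prod_(i <- enum P) csinh (lam - y i)).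
  by apply/funext => lam; rewrite big_enum.
rewrite cardE; elim: (enum P) => [|i s IH] /=.
  by have [r hr e] := trig_const 1; exists r => // lam; rewrite big_nil -e.
have [r hr e] := trigM (trig_csinh (y i)) IH.
by exists r => // lam; rewrite big_cons e.
Qed.

Lemma csinh_sub_neq0 x y : (csinh (x - y) != 0) = (cexp x ^+ 2 != cexp y ^+ 2).
Proof.
rewrite csinhE cexpB; have := cexp_neq0 x; have := cexp_neq0 y.
move: (cexp x) (cexp y) => u v hv hu; congr negb.
rewrite -[RHS]subr_eq0.
have -> : (u / v - (u / v)^-1) / 2 = (u ^+ 2 - v ^+ 2) / (2 * u * v).
  by field; rewrite hu hv.
by rewrite mulf_eq0 invr_eq0 !mulf_eq0 (negbTE hu) (negbTE hv) (negbTE two_neq0) !orbF.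
Qed.

Lemma trig_eq0 m f (I : finType) (y : I -> C) : trig m f -> (m <= #|I|)%N ->
  (forall i j, i != j -> csinh (y i - y j) != 0) -> (forall i, f (y i) = 0) ->
  forall lam, f lam = 0.
Proof.
move=> [r hr e] hm hy h0 lam; rewrite e.
suff -> : r = 0 by rewrite horner0 mulr0.
apply/eqP/negPn/negP => /max_poly_roots.
move=> /(_ [seq cexp (y i) ^+ 2 | i <- enum I]).
rewrite size_map -cardE ltnNge (leq_trans hr hm).
have -> : all (root r) [seq cexp (y i) ^+ 2 | i <- enum I].
  apply/allP => _ /mapP[i _ ->]; apply/rootP; have /eqP := h0 i.
  rewrite e mulf_eq0 mulf_eq0 invr_eq0 expf_eq0 (negbTE (cexp_neq0 _)) andbF.
  by move=> /eqP.
move=> /(_ isT); rewrite map_inj_uniq ?enum_uniq => [/(_ isT) //|i j] /eqP h.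
by apply/eqP; apply: contraTT h => /hy; rewrite csinh_sub_neq0.
Qed.

Lemma trig_interpolation f (I : finType) (y : I -> C) : trig #|I| f ->
  (forall i j, i != j -> csinh (y i - y j) != 0) ->
  forall lam, f lam = \sum_i f (y i) *
    ((\prod_(j | j != i) csinh (lam - y j)) / \prod_(j | j != i) csinh (y i - y j)).
Proof.
move=> hf hy lam; apply/eqP; rewrite -subr_eq0; apply/eqP; move: lam.
have h : forall i, trig #|I| (fun lam => f (y i) *
  ((\prod_(j | j != i) csinh (lam - y j)) / \prod_(j | j != i) csinh (y i - y j))).
  move=> i; apply: trigZ.
  have := trigZ (\prod_(j | j != i) csinh (y i - y j))^-1 (trig_prod_csinh (predC1 i) y).
  rewrite cardC1 prednK; last by apply/card_gt0P; exists i.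
  by move=> [r hr e]; exists r => // lam; rewrite -e mulrC.
have [r hr e] := trig_sum h.
have {}h : trig #|I| (fun lam => f lam - \sum_i f (y i) *
    ((\prod_(j | j != i) csinh (lam - y j)) / \prod_(j | j != i) csinh (y i - y j))).
  have [s hs e'] := trigD hf (trigZ (-1) (trig_sum h)).
  by exists s => // lam; rewrite -e' mulN1r.
apply: (trig_eq0 h (leqnn _) hy) => i.
rewrite (bigD1 i) //= divff ?prodf_seq_neq0; last first.
  by apply/allP => j _; apply/implyP => ji; apply: hy; rewrite eq_sym.
rewrite mulr1 big1 ?addr0 ?subrr // => k ki.
by rewrite (bigD1 i) 1?eq_sym //= subrr csinhE cexp0 invr1 subrr !mul0r mulr0.
Qed.

Lemma trig_partial_fractions f (I : finType) (y : I -> C) lam : trig #|I| f ->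
  (forall i j, i != j -> csinh (y i - y j) != 0) ->
  (forall i, csinh (lam - y i) != 0) ->
  f lam / \prod_i csinh (lam - y i) = \sum_i f (y i) /
    ((\prod_(j | j != i) csinh (y i - y j)) * csinh (lam - y i)).
Proof.
move=> hf hy hl; rewrite (trig_interpolation hf hy) mulr_suml.
apply: eq_bigr => i _; rewrite [X in _ / X = _](bigD1 i) //=.
have h : \prod_(j | j != i) csinh (lam - y j) != 0.
  by rewrite prodf_seq_neq0; apply/allP => j _; apply/implyP.
have h' : \prod_(j | j != i) csinh (y i - y j) != 0.
  by rewrite prodf_seq_neq0; apply/allP => j _; apply/implyP => ji; apply: hy; rewrite eq_sym.
by field; rewrite h h' hl.
Qed.

End TrigPolynomials.

Lemma unitarity_shuffle (S : pzSemiRingType) (P U D R1 R2 x y z W : S) :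
  R1 * R2 = x -> P * D = y * W -> GRing.comm U D -> (forall O, GRing.comm x O) ->
  z = x * y -> P * (U * R1) * (R2 * D) = z * (W * U).
Proof.
move=> h1 h2 h3 hx ->.
rewrite !mulrA -(mulrA (P * U) R1) h1 -(hx (P * U)) -!mulrA h3.
by rewrite (mulrA P) h2 !mulrA.
Qed.

Lemma twist_shuffle (S : pzSemiRingType) (K P D X E U x y z : S) :
  P * D = z * U -> GRing.comm X U -> (forall O, GRing.comm y O) ->
  (forall O, GRing.comm z O) ->
  x * (K * P) * (y * (D * X * E)) = x * y * z * (K * X * (U * E)).
Proof.
move=> h1 h2 hy hz.
rewrite (hy (D * X * E)).
have -> : x * y * z * (K * X * (U * E)) = x * z * (K * X * (U * E)) * y.
  by rewrite -!mulrA (hy (z * _)) -!mulrA.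
rewrite !mulrA; congr (_ * y); rewrite -(mulrA (x * K) P) h1 !mulrA.
by rewrite -(mulrA x K) -(hz K) mulrA -(mulrA _ U X) -h2 mulrA.
Qed.

Lemma twist_commute (S : pzSemiRingType) (x c P K W : S) :
  (forall O, GRing.comm c O) -> GRing.comm x P ->
  x * (c * (P * K * W)) = c * (P * (x * K) * W).
Proof. by move=> hc hP; rewrite mulrA -(hc x) -!mulrA !(mulrA x) hP !mulrA. Qed.

Section SiteOperators.
Set Implicit Arguments.
Unset Strict Implicit.
Context {R : realType} {N : nat}.
Local Notation C := R[i].
Local Notation op := 'M[C]_#|{: config N}|.
Implicit Types (k l m n : 'I_N) (A B : 'M[C]_2) (x y z : config N).

Definition agree_off n x y := [forall m, (m != n) ==> (x m == y m)].

Definition update x n (s : 'I_2) : config N := [ffun m => if m == n then s else x m].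

Lemma siteE n A i j : site n A i j =
  A (to_config i n) (to_config j n) * (agree_off n (to_config i) (to_config j))%:R.
Proof. by rewrite mxE. Qed.

Lemma agree_off_update n x z : agree_off n x z = (z == update x n (z n)).
Proof.
apply/forallP/eqP => [h|-> m]; last by apply/implyP => /negbTE mn; rewrite ffunE mn.
apply/ffunP => m; rewrite ffunE; case: eqP => [-> //|/eqP mn].
by have := h m; rewrite mn => /eqP.
Qed.

Lemma sum_agree_off n x (F : config N -> C) :
  \sum_z F z * (agree_off n x z)%:R = \sum_s F (update x n s).
Proof.
rewrite (bigID (agree_off n x)) /= [X in _ + X]big1 => [|z /negbTE ->]; last by rewrite mulr0.
rewrite addr0 (reindex_onto (update x n) (fun z => z n)) => [|z]; last first.
  by rewrite agree_off_update => /eqP {2}->.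
apply: eq_big => [s|s h].
  by rewrite agree_off_update ffunE eqxx !eqxx.
by move: h => /andP[-> _]; rewrite mulr1.
Qed.

Lemma site_mulE n A (M : op) i j : (site n A * M) i j =
  \sum_s A (to_config i n) s * M (enum_rank (update (to_config i) n s)) j.
Proof.
rewrite mxE.
transitivity (\sum_(z : config N) A (to_config i n) (z n) * M (enum_rank z) j *
    (agree_off n (to_config i) z)%:R).
  rewrite [RHS](reindex_onto (fun i => to_config i) enum_rank) => [|z _] /=; last exact: enum_rankK.
  apply: eq_big => [z|z _]; first by rewrite enum_valK eqxx.
  by rewrite siteE enum_valK mulrAC.
rewrite (sum_agree_off n _ (fun z => A (to_config i n) (z n) * M (enum_rank z) j)).
by apply: eq_bigr => s _; rewrite ffunE eqxx.
Qed.

Lemma siteM n A B : site n A * site n B = site n (A *m B).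
Proof.
apply/matrixP => i j; rewrite site_mulE siteE mxE mulr_suml.
apply: eq_bigr => s _; rewrite siteE /to_config enum_rankK ffunE eqxx mulrA.
congr (_ * _%:R); rewrite /agree_off; congr (nat_of_bool _).
by apply: eq_forallb => m; rewrite ffunE; case: eqP.
Qed.

Lemma site_comm m n A B : m != n -> GRing.comm (site m A) (site n B).
Proof.
suff h : forall m n A B i j, m != n -> (site m A * site n B) i j =
  A (to_config i m) (to_config j m) * B (to_config i n) (to_config j n) *
  [forall k, (k != m) && (k != n) ==> (to_config i k == to_config j k)]%:R.
  move=> mn; apply/matrixP => i j; rewrite !h // 1?eq_sym // (mulrC (A _ _)).
  by congr (_ * _%:R); congr (nat_of_bool _); apply: eq_forallb => k; rewrite andbC.
move=> {}m {}n {}A {}B i j mn; rewrite site_mulE.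
under eq_bigr => s _ do rewrite siteE /to_config enum_rankK ffunE eq_sym (negbTE mn).
rewrite (bigD1 (to_config j m)) //= big1 ?addr0 => [|s sj].
  rewrite mulrA; congr (_ * _%:R); congr (nat_of_bool _).
  apply: eq_forallb => k; rewrite ffunE.
  by have [->|km] := eqVneq k m; rewrite //= eqxx implybT.
rewrite mulrA; apply/eqP; rewrite mulf_eq0; apply/orP; right.
rewrite pnatr_eq0 eqb0; apply/forallPn; exists m.
by rewrite mn ffunE eqxx.
Qed.

Lemma siteD n A B : site n (A + B) = site n A + site n B.
Proof. by apply/matrixP => i j; rewrite !mxE mulrDl. Qed.

Lemma siteZ n u A : site n (u *: A) = u *: site n A.
Proof. by apply/matrixP => i j; rewrite !mxE mulrA. Qed.

Lemma site0 n : site n 0 = 0 :> op.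
Proof. by apply/matrixP => i j; rewrite !mxE mul0r. Qed.

Lemma site1 n : site n 1%:M = 1 :> op.
Proof.
apply/matrixP => i j; rewrite !mxE -natrM mulnb; congr (_%:R); congr (nat_of_bool _).
apply/andP/eqP => [[/eqP h1 /forallP h2]|->]; last first.
  by split=> //; apply/forallP => m; rewrite eqxx implybT.
apply: enum_val_inj; apply/ffunP => m.
have [->//|mn] := eqVneq m n.
by have := h2 m; rewrite mn => /eqP.
Qed.

Lemma site_sum n (I : finType) (F : I -> 'M[C]_2) :
  site n (\sum_i F i) = \sum_i site n (F i).
Proof. exact: (big_morph _ (siteD n) (site0 n)). Qed.

(* [M : 'M[op]_2] with its auxiliary space identified with the [k]-th factor. *)
Definition at_site k (M : 'M[op]_2) : op :=
  \sum_i \sum_j site k (delta_mx i j) * M i j.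

Definition commutes_with k (M : 'M[op]_2) :=
  forall i j A, GRing.comm (M i j) (site k A).

Lemma at_siteM k (M M' : 'M[op]_2) : commutes_with k M ->
  at_site k (M *m M') = at_site k M * at_site k M'.
Proof.
move=> hM; rewrite /at_site.
rewrite mulr_suml; apply: eq_bigr => i _.
rewrite mulr_suml.
transitivity (\sum_l \sum_j \sum_m0
   site k (delta_mx i j) * M i j * (site k (delta_mx m0 l) * M' m0 l)).
  apply: eq_bigr => l _; rewrite mxE mulr_sumr; apply: eq_bigr => j _.
  rewrite (bigD1 j) //= big1 => [|m0 mj]; last first.
    by rewrite mulrA -(mulrA (site _ _)) hM mulrA siteM mul_delta_mx_0 ?site0 ?mul0r // eq_sym.
  by rewrite addr0 -!mulrA (mulrA (M i j)) hM -(mulrA (site _ _) (M i j)) [RHS]mulrA siteM mul_delta_mx.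
rewrite exchange_big; apply: eq_bigr => j _ /=.
rewrite mulr_sumr exchange_big; apply: eq_bigr => m0 _ /=.
by rewrite mulr_sumr.
Qed.

Lemma at_site1 k : at_site k 1%:M = 1.
Proof.
have e : 1%:M = \sum_i delta_mx i i :> 'M[C]_2.
  apply/matrixP => i j; rewrite summxE (bigD1 i) //= big1 => [|m /negbTE mi].
    by rewrite !mxE ?eqxx ?addr0 //= eq_sym.
  by rewrite mxE eq_sym mi.
transitivity (site k (1%:M : 'M[C]_2) : op); last exact: site1.
rewrite e site_sum /at_site; apply: eq_bigr => i _.
rewrite (bigD1 i) //= big1 => [|j ji]; rewrite mxE ?eqxx ?mulr1 ?addr0 //.
by rewrite eq_sym (negbTE ji) mulr0.
Qed.

Lemma comm_site_sum k (I : finType) (F : I -> op) A :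
  (forall i, GRing.comm (F i) (site k A)) -> GRing.comm (\sum_i F i) (site k A).
Proof.
by move=> h; apply/commr_sym/commr_sum => i _; apply/commr_sym.
Qed.

Lemma commutes_with_mul k (M M' : 'M[op]_2) :
  commutes_with k M -> commutes_with k M' -> commutes_with k (M *m M').
Proof.
move=> h h' i j A; rewrite mxE; apply: comm_site_sum => l.
by apply/commr_sym/commrM; apply/commr_sym.
Qed.

Lemma commutes_with1 k : commutes_with k (1%:M : 'M[op]_2).
Proof. by move=> i j A; rewrite mxE; case: eqP => _; [apply/commr_sym/commr1|apply/commr_sym/commr0]. Qed.

Lemma commutes_with_prod k (s : seq 'I_N) (F : 'I_N -> 'M[op]_2) :
  (forall m, m \in s -> commutes_with k (F m)) ->
  commutes_with k (\big[mulmx/1%:M]_(m <- s) F m).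
Proof.
elim: s => [|m s IH] h; first by rewrite big_nil; exact: commutes_with1.
rewrite big_cons; apply: commutes_with_mul; first by apply: h; rewrite mem_head.
by apply: IH => l ls; apply: h; rewrite inE ls orbT.
Qed.

Lemma at_site_comm l k (M : 'M[op]_2) A : l != k -> commutes_with l M ->
  GRing.comm (at_site k M) (site l A).
Proof.
move=> lk h; apply: comm_site_sum => i; apply: comm_site_sum => j.
apply/commr_sym/commrM; first exact: site_comm.
exact/commr_sym.
Qed.

Lemma at_site_prod k (s : seq 'I_N) (F : 'I_N -> 'M[op]_2) :
  (forall m, m \in s -> commutes_with k (F m)) ->
  at_site k (\big[mulmx/1%:M]_(m <- s) F m) = \prod_(m <- s) at_site k (F m).
Proof.
elim: s => [|m s IH] h; first by rewrite !big_nil at_site1.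
rewrite !big_cons at_siteM; last by apply: h; rewrite mem_head.
by rewrite IH // => l ls; apply: h; rewrite inE ls orbT.
Qed.

Context (eta : C) (xi : 'I_N -> C).

Lemma R0_commutes k l u : k != l -> commutes_with k (R0 eta l u).
Proof. by move=> kl i j A; rewrite mxE; apply: site_comm; rewrite eq_sym. Qed.

(* The blocks of [R] along the auxiliary space. *)
Definition Rblock u (i j : 'I_2) : 'M[C]_2 :=
  if i == j then (if i == 0 then csinh (u + eta) else csinh u) *: delta_mx 0 0
     + (if i == 0 then csinh u else csinh (u + eta)) *: delta_mx 1 1
  else csinh eta *: delta_mx j i.

Lemma RblockE u i j s t : Rblock u i j s t =
  if i == j then (if s == t then (if i == s then csinh (u + eta) else csinh u) else 0)
  else (if (s == j) && (t == i) then csinh eta else 0).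
Proof.
rewrite /Rblock.
case: i => [[|[|//]] ?]; case: j => [[|[|//]] ?]; case: s => [[|[|//]] ?]; case: t => [[|[|//]] ?];
  by rewrite /= !mxE /= ?mulr1 ?mulr0 ?addr0 ?add0r.
Qed.

Lemma R0E k u i j : R0 eta k u i j = site k (Rblock u i j).
Proof.
rewrite mxE; congr site; apply/matrixP => s t; rewrite !mxE !inordK; last first.
- by case: s => [[|[|//]] ?]; case: i => [[|[|//]] ?].
- by case: t => [[|[|//]] ?]; case: j => [[|[|//]] ?].
rewrite /Rblock.
case: i => [[|[|//]] ?]; case: j => [[|[|//]] ?]; case: s => [[|[|//]] ?]; case: t => [[|[|//]] ?];
  rewrite /= !mxE /= ?mulr1 ?mulr0 ?addr0 ?add0r //.
Qed.

Definition Rop k l u : op := at_site k (R0 eta l u).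

Lemma Rop_comm m k l u A : m != k -> m != l -> GRing.comm (Rop k l u) (site m A).
Proof. by move=> mk ml; apply: at_site_comm => //; apply: R0_commutes. Qed.

Lemma comm_at_site m (M : 'M[op]_2) (O : op) :
  (forall A, GRing.comm O (site m A)) -> (forall i j, GRing.comm O (M i j)) ->
  GRing.comm O (at_site m M).
Proof.
by move=> h1 h2; apply: commr_sum => i _; apply: commr_sum => j _; apply: commrM.
Qed.

Lemma Rop_Rop_comm m l' k l u v : m != k -> m != l -> l' != k -> l' != l ->
  GRing.comm (Rop k l u) (Rop m l' v).
Proof.
move=> mk ml l'k l'l; apply: comm_at_site => [A|i j]; first exact: Rop_comm.
by rewrite R0E; apply: Rop_comm.
Qed.

Lemma sum_I2 (U : nmodType) (F : 'I_2 -> U) : \sum_i F i = F 0 + F 1.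
Proof. by rewrite !big_ord_recl big_ord0 addr0; congr (F _ + F _); apply: val_inj. Qed.

Lemma Rop_sym k l u : k != l -> Rop l k u = Rop k l u.
Proof.
move=> kl; rewrite /Rop /at_site !sum_I2 !R0E /Rblock /= !(siteD, siteZ).
have h A B : site l A * site k B = site k B * site l A :> op.
  by apply: site_comm; rewrite eq_sym.
have hZ u0 (x y : op) : x * (u0 *: y) = u0 *: (x * y) by exact: esym (scalemxAr _ _ _).
rewrite !(mulrDr, hZ) !h.
have e (U : nmodType) (x1 x2 x3 x4 x5 x6 : U) :
  x1 + x5 + x4 + (x3 + (x2 + x6)) = x1 + x2 + x3 + (x4 + (x5 + x6)).
  by rewrite !addrA [LHS](ACl (1*5*4*3*2*6)).
exact: e.
Qed.

Lemma csinh_mul_sub (u v : C) : csinh (v + u) * csinh (v - u) = csinh v ^+ 2 - csinh u ^+ 2.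
Proof.
rewrite !csinhE cexpD cexpB; have := cexp_neq0 u; have := cexp_neq0 v.
by move: (cexp u) (cexp v) => x y hy hx; field; rewrite hx hy.
Qed.

Lemma Rblock_unitarity u i j : \sum_m Rblock u i m *m Rblock (- u) m j =
  ((csinh (eta + u) * csinh (eta - u)) *+ (i == j))%:M.
Proof.
rewrite csinh_mul_sub sum_I2; apply/matrixP => s t; rewrite 3!mxE !sum_I2 !RblockE csinhN.
have : csinh (u + eta) * csinh (- u + eta) = csinh eta ^+ 2 - csinh u ^+ 2.
  by rewrite addrC [- u + _]addrC csinh_mul_sub.
move: (csinh (u + eta)) (csinh (- u + eta)) (csinh u) (csinh eta) => A B S H hAB.
case: i => [[|[|//]] ?]; case: j => [[|[|//]] ?]; case: s => [[|[|//]] ?]; case: t => [[|[|//]] ?];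
  rewrite /= !mxE /=; first [by ring | by rewrite -hAB; ring].
Qed.

Lemma Rop_unitarity k l u : k != l ->
  Rop k l u * Rop l k (- u) = (csinh (eta + u) * csinh (eta - u))%:M.
Proof.
move=> kl; rewrite [Rop l k _]Rop_sym // /Rop -at_siteM; last exact: R0_commutes.
have -> : R0 eta l u *m R0 eta l (- u) =
  \matrix_(i, j) site l ((csinh (eta + u) * csinh (eta - u)) *+ (i == j))%:M.
  apply/matrixP => i j; rewrite !mxE -Rblock_unitarity site_sum.
  by apply: eq_bigr => m _; rewrite !R0E siteM.
transitivity ((csinh (eta + u) * csinh (eta - u)) *: (1 : op)); last exact: scalemx1.
rewrite -(at_site1 k) /at_site !scaler_sumr; apply: eq_bigr => i _.
rewrite scaler_sumr; apply: eq_bigr => j _; rewrite !mxE.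
case: eqP => _; last by rewrite mulr0n mulr0 scaler0 raddf0 site0 mulr0.
by rewrite -scalemx1 siteZ site1; exact: esym (scalemxAr _ _ _).
Qed.

Definition scalar_entries (X : 'M[C]_2) : 'M[op]_2 := map_mx (fun c : C => c%:M : op) X.

Lemma comm_scalar (c : C) (O : op) : GRing.comm (c%:M : op) O.
Proof. exact: (esym (scalar_mxC _ _)). Qed.

Lemma commutes_with_scalar k X : commutes_with k (scalar_entries X).
Proof. by move=> i j A; rewrite mxE; apply: comm_scalar. Qed.

Lemma at_site_scalar k X : at_site k (scalar_entries X) = site k X.
Proof.
rewrite [in RHS](matrix_sum_delta X) site_sum; apply: eq_bigr => i _.
rewrite site_sum; apply: eq_bigr => j _; rewrite mxE siteZ.
exact: mul_mx_scalar.
Qed.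

Lemma trace_at_site k (A B : 'M[op]_2) X : commutes_with k A -> commutes_with k B ->
  (forall i j i' j', GRing.comm (A i j) (B i' j')) ->
  \tr (scalar_entries X *m (A *m R0 eta k 0 *m B)) =
  csinh eta *: (at_site k B * site k X * at_site k A).
Proof.
move=> hA hB hAB.
have hX := commutes_with_scalar k X.
rewrite -(at_site_scalar k X) -at_siteM // -at_siteM; last exact: commutes_with_mul.
have R00 i j : R0 eta k 0 i j = csinh eta *: site k (delta_mx j i).
  rewrite R0E -siteZ /Rblock add0r; congr site.
  have s0 : csinh (0 : C) = 0 by rewrite csinhE cexp0 invr1 subrr mul0r.
  rewrite s0; case: i => [[|[|//]] ?]; case: j => [[|[|//]] ?]; rewrite /= ?scale0r ?addr0 ?add0r //;
  by congr (_ *: delta_mx _ _); apply: val_inj.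
transitivity (\sum_i \sum_j \sum_l \sum_m
    (X i j * csinh eta) *: (site k (delta_mx l m) * (B l i * A j m))).
  apply: eq_bigr => i _; rewrite mxE; apply: eq_bigr => j _.
  rewrite [X in _ * X]mxE mulr_sumr; apply: eq_bigr => l _.
  rewrite [(A *m _) j l]mxE mulr_suml mulr_sumr; apply: eq_bigr => m _.
  rewrite R00 [scalar_entries X i j]mxE [LHS]mul_scalar_mx -scalerA; congr (_ *: _).
  have -> : A j m * (csinh eta *: site k (delta_mx l m)) =
    csinh eta *: (A j m * site k (delta_mx l m)) by exact: esym (scalemxAr _ _ _).
  rewrite -[LHS]scalemxAl; congr (_ *: _).
  by rewrite -[LHS]/(A j m * _ * B l i) hA -mulrA hAB.
rewrite pair_bigA exchange_big /= /at_site scaler_sumr; apply: eq_bigr => l _.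
rewrite exchange_big /= scaler_sumr; apply: eq_bigr => m _.
rewrite -(pair_bigA _ (fun i j => (X i j * csinh eta) *: (site k (delta_mx l m) * (B l i * A j m)))) /=.
rewrite exchange_big /= mxE mulr_sumr scaler_sumr; apply: eq_bigr => j _.
rewrite mxE mulr_suml mulr_sumr scaler_sumr; apply: eq_bigr => i _.
rewrite mulrC -scalerA; congr (_ *: _).
rewrite mxE; have -> : B l i * (X i j)%:M * A j m = X i j *: (B l i * A j m).
  by rewrite -(comm_scalar (X i j) (B l i)) -mulrA; exact: mul_scalar_mx.
exact: scalemxAr.
Qed.

Definition mono (s : seq 'I_N) u : 'M[op]_2 :=
  \big[mulmx/1%:M]_(m <- s) R0 eta m (u - xi m).

Lemma monodromyE u : monodromy eta xi u = mono (rev (enum 'I_N)) u.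
Proof.
rewrite /monodromy /mono.
have -> : rev (enum 'I_N) = [seq rev_ord m | m <- enum 'I_N].
  apply: (inj_map val_inj); rewrite map_rev val_enum_ord -map_comp.
  apply: (@eq_from_nth _ 0%N) => [|i]; rewrite size_rev size_iota.
    by rewrite size_map size_enum_ord.
  move=> iN; rewrite nth_rev size_iota // (nth_map (Ordinal iN)) ?size_enum_ord //=.
  by rewrite nth_iota ?(rev_ord_proof (Ordinal iN)) // nth_enum_ord.
by rewrite big_map [index_enum _]unlock -enumT.
Qed.

Lemma mono_cat s1 s2 u : mono (s1 ++ s2) u = mono s1 u *m mono s2 u.
Proof.
rewrite /mono; elim: s1 => [|m s IH]; first by rewrite big_nil mul1mx.
by rewrite /= !big_cons IH mulmxA.
Qed.

Lemma mono_commutes k s u : k \notin s -> commutes_with k (mono s u).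
Proof.
move=> ks; apply: commutes_with_prod => m ms; apply: R0_commutes.
by apply: contraNneq ks => ->.
Qed.

Lemma mono_comm s1 s2 u v i j i' j' : ~~ has (mem s1) s2 ->
  GRing.comm (mono s1 u i j) (mono s2 v i' j').
Proof.
move=> h.
suff {i' j'} : forall k, k \in s2 -> commutes_with k (mono s1 u).
  rewrite /mono; elim: s2 {h} i' j' => [|m s IH] i' j' h.
    by rewrite big_nil mxE; case: eqP => _; [apply: commr1|apply: commr0].
  rewrite big_cons mxE; apply: commr_sum => l _; apply: commrM.
    by rewrite R0E; apply: h; rewrite mem_head.
  by apply: IH => k ks; apply: h; rewrite inE ks orbT.
move=> k ks; apply: mono_commutes; apply: contra h => ks1.
by apply/hasP; exists k.
Qed.

Definition Rchain k s : op := \prod_(l <- rev s) Rop k l (xi k - xi l).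

Lemma comm_prod_seq (T : eqType) (r : seq T) (F : T -> op) (O : op) :
  (forall t, t \in r -> GRing.comm O (F t)) -> GRing.comm O (\prod_(t <- r) F t).
Proof. by move=> h; rewrite big_seq; apply: commr_prod. Qed.

Lemma Rchain_comm m k (s : seq 'I_N) A : m != k -> m \notin s ->
  GRing.comm (site m A) (Rchain k s).
Proof.
move=> mk ms; apply: comm_prod_seq => l; rewrite mem_rev => ls.
by apply/commr_sym/Rop_comm => //; apply: contraNneq ms => ->.
Qed.

Lemma Rchain_Rchain_comm k m (s s' : seq 'I_N) : m != k -> m \notin s -> k \notin s' ->
  ~~ has (mem s) s' -> GRing.comm (Rchain k s) (Rchain m s').
Proof.
move=> mk ms ks' ss'; apply: comm_prod_seq => l; rewrite mem_rev => ls.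
apply/commr_sym/comm_prod_seq => l'; rewrite mem_rev => l's.
apply: Rop_Rop_comm; first by rewrite eq_sym.
- by apply: contraNneq ks' => ->.
- by apply: contraNneq ms => <-.
by apply: contraNneq ss' => e; apply/hasP; exists l => //=; rewrite -e.
Qed.

Lemma Rchain_rcons k s m : Rchain k (rcons s m) = Rop k m (xi k - xi m) * Rchain k s.
Proof. by rewrite /Rchain rev_rcons big_cons. Qed.

Lemma Rchain_cons k s m : Rchain k (m :: s) = Rchain k s * Rop k m (xi k - xi m).
Proof. by rewrite /Rchain rev_cons -cats1 big_cat big_seq1. Qed.

Lemma Rchain_absorb n (s1 s2 : seq 'I_N) : uniq (n :: s1 ++ s2) -> exists c : C,
  (\prod_(k <- s1) Rchain k (n :: s2)) * Rchain n s1 =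
  c%:M * \prod_(k <- s1) Rchain k s2.
Proof.
elim/last_ind: s1 => [_|s1 m IH /=].
  by exists 1; rewrite !big_nil /Rchain big_nil mulr1.
rewrite cat_rcons mem_cat inE !negb_or cat_uniq /= -!andbA.
case/and5P=> [ns1 nm ns2 us1 /and3P[]]; rewrite negb_or => /andP[ms1 h12] ms2 us2.
have [|c e] := IH; first by rewrite /= mem_cat negb_or ns1 ns2 cat_uniq us1 h12 us2.
have mn : m != n by rewrite eq_sym.
have [c1 e1] : exists c1 : C,
  Rop m n (xi m - xi n) * Rop n m (- (xi m - xi n)) = c1%:M.
  by rewrite Rop_unitarity //; eexists.
exists (c1 * c).
rewrite -!cats1 !big_cat !big_seq1 cats1 Rchain_rcons Rchain_cons /=.
have -> : xi n - xi m = - (xi m - xi n) by rewrite opprB.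
refine (@unitarity_shuffle op _ _ _ _ _ _ _ _ _ e1 e _ _ _).
- by apply: Rchain_Rchain_comm => //; rewrite has_sym.
- exact: comm_scalar.
exact: scalar_mxM.
Qed.

Definition trace_op X u : op := \tr (scalar_entries X *m monodromy eta xi u).

Lemma trace_op_at n s1 s2 X : enum 'I_N = s1 ++ n :: s2 ->
  trace_op X (xi n) = csinh eta *: (Rchain n s1 * site n X * Rchain n s2).
Proof.
move=> e; have := enum_uniq 'I_N; rewrite e cat_uniq /= => /and4P[us1].
rewrite negb_or => /andP[ns1 h12] ns2 us2.
rewrite /trace_op monodromyE e rev_cat rev_cons mono_cat -cats1 mono_cat.
have -> : mono [:: n] (xi n) = R0 eta n 0 by rewrite /mono big_cons big_nil mulmx1 subrr.
have c1 : commutes_with n (mono (rev s1) (xi n)) by apply: mono_commutes; rewrite mem_rev.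
have c2 : commutes_with n (mono (rev s2) (xi n)) by apply: mono_commutes; rewrite mem_rev.
rewrite trace_at_site //; last first.
  move=> i j i' j'; apply: mono_comm; rewrite has_rev.
  by apply: contra h12 => /hasP[x xs1 xs2]; apply/hasP; exists x => //; move: xs2; rewrite /= mem_rev.
have at_mono s : n \notin s -> at_site n (mono (rev s) (xi n)) = Rchain n s.
  move=> ns; rewrite /mono at_site_prod // => m; rewrite mem_rev => ms.
  by apply: R0_commutes; apply: contraNneq ns => ->.
by rewrite !at_mono.
Qed.

Lemma Rchain_prod_comm n (s s2 : seq 'I_N) A : n \notin s -> n \notin s2 ->
  GRing.comm (site n A) (\prod_(k <- s) Rchain k s2).
Proof.
move=> ns ns2; apply: comm_prod_seq => k ks; apply: Rchain_comm => //.
by apply: contraNneq ns => ->.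
Qed.

Lemma site_prod_comm n (s : seq 'I_N) A B : n \notin s ->
  GRing.comm (site n A) (\prod_(k <- s) site k B).
Proof.
move=> ns; apply: comm_prod_seq => k ks; apply: site_comm.
by apply: contraNneq ns => ->.
Qed.

Lemma transfer_prod_step K n s1 s2 (c : C) : enum 'I_N = s1 ++ n :: s2 ->
  \prod_(k <- s1) trace_op K (xi k) =
    c%:M * ((\prod_(k <- s1) site k K) * \prod_(k <- s1) Rchain k (n :: s2)) ->
  exists c' : C, forall X, \prod_(k <- s1) trace_op K (xi k) * trace_op X (xi n) =
    c'%:M * ((\prod_(k <- s1) site k K) * site n X *
      (\prod_(k <- s1) Rchain k s2 * Rchain n s2)).
Proof.
move=> e ec; have u := enum_uniq 'I_N; rewrite e in u.
have [c' ec'] : exists c : C, (\prod_(k <- s1) Rchain k (n :: s2)) * Rchain n s1 =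
  c%:M * \prod_(k <- s1) Rchain k s2.
  by apply: Rchain_absorb; move: u; rewrite -cat1s uniq_catCA.
move: u; rewrite cat_uniq /= => /and4P[us1]; rewrite negb_or => /andP[ns1 h12] ns2 us2.
exists (c * csinh eta * c') => X; rewrite ec (trace_op_at X e).
rewrite -[csinh eta *: _]mul_scalar_mx (scalar_mxM _ (c * csinh eta)) (scalar_mxM _ c).
refine (@twist_shuffle op _ _ _ _ _ _ _ _ _ ec' _ _ _).
- exact: Rchain_prod_comm.
- exact: comm_scalar.
exact: comm_scalar.
Qed.

(* The product of the transfer matrices at [xi k], [k] in [s1], acts on the
   sites of [s1] by the twist, up to [R]-matrices linking them to [s2]: the
   [R]-matrices between two sites of [s1] cancel by unitarity. *)
Lemma transfer_prod K s1 s2 : enum 'I_N = s1 ++ s2 -> exists c : C,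
  \prod_(k <- s1) trace_op K (xi k) =
  c%:M * ((\prod_(k <- s1) site k K) * \prod_(k <- s1) Rchain k s2).
Proof.
elim/last_ind: s1 s2 => [|s1 n IH] s2.
  by exists 1; rewrite !big_nil !mulr1.
rewrite cat_rcons => e; have [c /(transfer_prod_step e) [c' ec']] := IH _ e.
by exists c'; rewrite -!cats1 !big_cat !big_seq1; apply: ec'.
Qed.

Lemma local_operator_trace K n s1 s2 X : enum 'I_N = s1 ++ n :: s2 ->
  site n X * (\prod_(k <- s1) trace_op K (xi k) * trace_op K (xi n)) =
  \prod_(k <- s1) trace_op K (xi k) * trace_op (X *m K) (xi n).
Proof.
move=> e; have [c /(transfer_prod_step e) [c' ec']] := transfer_prod K e.
have := enum_uniq 'I_N; rewrite e cat_uniq /= negb_or => /and4P[_ /andP[ns1 _] _ _].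
rewrite !ec' -(siteM n X K); refine (@twist_commute op (site n X) c'%:M _ _ _ _ _).
- exact: comm_scalar.
- exact: site_prod_comm.
Qed.

Definition site_all K : op := \prod_(k <- enum 'I_N) site k K.

Lemma transfer_prod_all K : exists c : C,
  \prod_(k <- enum 'I_N) trace_op K (xi k) = c%:M * site_all K.
Proof.
have [c e] := transfer_prod K (esym (cats0 (enum 'I_N))); exists c; rewrite e.
have -> : \prod_(k <- enum 'I_N) Rchain k [::] = 1.
  by rewrite big1 // => k _; rewrite /Rchain big_nil.
by rewrite mulr1.
Qed.

Lemma site_all_sqr K : K *m K = 1%:M -> site_all K * site_all K = 1.
Proof.
move=> KK; rewrite /site_all; have := enum_uniq 'I_N.
elim: (enum 'I_N) => [|k s IH] /=; first by rewrite !big_nil mulr1.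
move=> /andP[ks us]; rewrite !big_cons -mulrA (mulrA _ (site k K)).
by rewrite -(site_prod_comm _ _ ks) -!mulrA (IH us) mulr1 siteM KK site1.
Qed.

(* Conjugation by [G] on the sites amounts to conjugation by [K] on the
   auxiliary space; for the twist this comes from [K (x) K] commuting with [R]. *)
Definition conjugated K (G : op) (M : 'M[op]_2) := forall i j,
  G * M i j = (scalar_entries K *m M *m scalar_entries K) i j * G.

Lemma scalar_entries_sqr K : K *m K = 1%:M ->
  scalar_entries K *m scalar_entries K = 1%:M.
Proof.
move=> KK; rewrite /scalar_entries -(map_mxM (scalar_mx : {rmorphism C -> op})) KK.
by rewrite (map_mx1 (scalar_mx : {rmorphism C -> op})).
Qed.

Lemma conjugatedM K G M M' : K *m K = 1%:M -> conjugated K G M -> conjugated K G M' ->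
  conjugated K G (M *m M').
Proof.
move=> /scalar_entries_sqr KK h h' i j; rewrite mxE mulr_sumr.
have -> : scalar_entries K *m (M *m M') *m scalar_entries K =
  (scalar_entries K *m M *m scalar_entries K) *m (scalar_entries K *m M' *m scalar_entries K).
  move: (scalar_entries K) KK => L KK.
  by rewrite !mulmxA -(mulmxA _ L L) KK mulmx1.
rewrite mxE mulr_suml; apply: eq_bigr => l _.
by rewrite mulrA h -mulrA h' mulrA.
Qed.

Lemma twistE (kappa : C) v w :
  twist kappa v w = if v == w then 0 else if v == 0 then kappa else kappa^-1.
Proof.
rewrite mxE !sum_I2 !mxE.
by case: v => [[|[|//]] ?]; case: w => [[|[|//]] ?];
  rewrite /= ?(mulr1, mulr0, addr0, add0r, mul0r).
Qed.

Lemma conjugated_entry k u K i j :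
  (scalar_entries K *m R0 eta k u *m scalar_entries K) i j =
  site k (\sum_l \sum_m (K i m * K l j) *: Rblock u m l).
Proof.
rewrite mxE site_sum; apply: eq_bigr => l _.
rewrite mxE mulr_suml site_sum; apply: eq_bigr => m _.
rewrite siteZ R0E [scalar_entries _ i m]mxE [scalar_entries _ l j]mxE.
by rewrite -scalerA -mul_scalar_mx -mul_scalar_mx -mulrA -(comm_scalar _ (site _ _)).
Qed.

Lemma twist_sqr (kappa : C) : kappa != 0 -> twist kappa *m twist kappa = 1%:M.
Proof.
move=> h; apply/matrixP => i j; rewrite mxE sum_I2 !twistE mxE.
by case: i => [[|[|//]] ?]; case: j => [[|[|//]] ?];
  rewrite /= ?(mulr0, mul0r, addr0, add0r) ?mulfV ?mulVf.
Qed.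

Lemma conjugated_twist k u kappa : kappa != 0 ->
  conjugated (twist kappa) (site k (twist kappa)) (R0 eta k u).
Proof.
move=> h i j.
rewrite conjugated_entry.
rewrite R0E !siteM; congr site; apply/matrixP => s t.
rewrite [LHS]mxE [RHS]mxE.
have e r : (\sum_l \sum_m (twist kappa i m * twist kappa l j) *: Rblock u m l) s r =
  \sum_l \sum_m (twist kappa i m * twist kappa l j) * Rblock u m l s r.
  rewrite summxE; apply: eq_bigr => l _; rewrite summxE; apply: eq_bigr => m _.
  by rewrite mxE.
under [RHS]eq_bigr => r _ do rewrite e.
rewrite !sum_I2 !RblockE !twistE; clear e.
move: (csinh (u + eta)) (csinh u) (csinh eta) => A B S.
case: i => [[|[|//]] ?]; case: j => [[|[|//]] ?]; case: s => [[|[|//]] ?]; case: t => [[|[|//]] ?];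
  rewrite /= ; field; done.
Qed.

Lemma conjugated_R0 k u kappa : kappa != 0 ->
  conjugated (twist kappa) (site_all (twist kappa)) (R0 eta k u).
Proof.
move=> h i j; rewrite /site_all.
have kN : k \in enum 'I_N by rewrite mem_enum.
have := enum_uniq 'I_N.
case/splitPr: kN => s1 s2; rewrite cat_uniq /= negb_or => /and4P[_ /andP[ks1 _] ks2 _].
rewrite big_cat big_cons /=.
have c1 : forall A, GRing.comm (site k A) (\prod_(m <- s1) site m (twist kappa)).
  by move=> A; apply: site_prod_comm.
have c2 : forall A, GRing.comm (site k A) (\prod_(m <- s2) site m (twist kappa)).
  by move=> A; apply: site_prod_comm.
have := @conjugated_twist k u _ h i j.
rewrite conjugated_entry R0E; move: (\sum_l _) => Z e.
rewrite -!mulrA -(c2 (Rblock u i j)) !mulrA -(mulrA _ (site k _) (site k _)) e !mulrA.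
by rewrite c1.
Qed.

Lemma conjugated_monodromy u kappa : kappa != 0 ->
  conjugated (twist kappa) (site_all (twist kappa)) (monodromy eta xi u).
Proof.
move=> h; rewrite monodromyE /mono.
have KK := twist_sqr h.
elim: (rev _) => [|m s IH]; last first.
  by rewrite big_cons; apply: (conjugatedM KK _ IH); exact: conjugated_R0.
move=> i j; rewrite big_nil mulmx1 scalar_entries_sqr //.
by rewrite mxE; case: eqP => _; rewrite ?mulr1 ?mul1r ?mulr0 ?mul0r.
Qed.

Lemma site_all_opD u kappa : kappa != 0 ->
  site_all (twist kappa) * opD eta xi u = opA eta xi u * site_all (twist kappa).
Proof.
move=> h; rewrite (conjugated_monodromy u h); congr (_ * _).
rewrite /opA; move: (monodromy eta xi u) => T.
rewrite [LHS]mxE sum_I2 [X in X * _ + _]mxE [X in _ + X * _]mxE !sum_I2.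
rewrite !(mxE map_mx_key) !twistE /= raddf0 !mulr0 !mul0r !addr0 -mulrA -(comm_scalar kappa) mulrA.
have -> : (kappa^-1)%:M * kappa%:M = 1 :> op.
  by rewrite -[LHS]scalar_mxM mulVf.
by rewrite mul1r.
Qed.

End SiteOperators.

Section HurwitzMatrices.
Set Implicit Arguments.
Unset Strict Implicit.
Context {F : fieldType}.
Implicit Types (p : {poly F}) (N : nat).

Definition hurwitz_odd N p : 'M[F]_N := \matrix_(i, j) ('X^i * p)`_(j.*2.+1).
Definition hurwitz_even N p : 'M[F]_N := \matrix_(i, j) ('X^i * p)`_(j.*2).

Lemma det_hurwitz_even N p : p \is monic -> size p = N.+1 ->
  \det (hurwitz_even N p) = p`_0 * \det (hurwitz_odd N p).
Proof.
case: N => [|N] pm sp.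
  by rewrite !det_mx00 mulr1; have := monicP pm; rewrite lead_coefE sp.
rewrite (expand_det_col _ ord0) (bigD1 ord0) //= big1 => [|i i0]; last first.
  rewrite mxE coefXnM /= ifT ?mul0r //.
  by rewrite lt0n; apply: contraNneq i0 => h; apply/eqP/val_inj.
rewrite addr0 mxE mul1r; congr (_ * _).
rewrite (expand_det_col (hurwitz_odd _ _) ord_max) (bigD1 ord_max) //= big1 => [|i i0]; last first.
  rewrite mxE coefXnM; case: ltnP => h; rewrite ?mul0r // nth_default ?mul0r // sp.
  have iN : (i < N)%N by rewrite ltn_neqAle -ltnS ltn_ord andbT; apply: contra i0 => /eqP h'; apply/eqP/val_inj.
  by rewrite /= ltn_subRL -addnn addnS ltnS ltn_add2r.
rewrite addr0 mxE coefXnM /= -addnn ltnNge leqW ?leq_addl // -addSn addnK.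
have -> : p`_N.+1 = 1 by have := monicP pm; rewrite lead_coefE sp.
have sg n : (-1) ^+ (n + n) = 1 :> F by rewrite addnn -signr_odd odd_double.
rewrite /= mul1r /cofactor !sg !mul1r; congr (\det _).
apply/matrixP => i j; rewrite !mxE !coefXnM /= /bump /= !add1n doubleS.
have hb (k : 'I_N.+1.-1) : (N <= k)%N = false by rewrite leqNgt ltn_ord.
by rewrite ltnS subSS !hb.
Qed.

Lemma det_hurwitz_odd_neq0 N p : (2 : F) != 0 -> size p = N.+1 ->
  coprimep p (p \Po - 'X) -> \det (hurwitz_odd N p) != 0.
Proof.
move=> two sp cop; apply/negP => /det0P[v v0 vB].
case/negP: v0; rewrite -(rVpolyK v).
have sv : (size (rVpoly v) <= N)%N by exact: size_poly.
have odd0 : odd_poly (rVpoly v * p) = 0.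
  apply/polyP => j; rewrite coef_odd_poly coef0.
  have [jN|jN] := ltnP j N; last first.
    apply: nth_default; apply: leq_trans (size_polyMleq _ _) _.
    rewrite sp addnS /= (leq_trans (leq_add sv (leqnn _))) // addnn.
    by rewrite ltnW // ltnS leq_double.
  move/matrixP: vB => /(_ 0 (Ordinal jN)); rewrite !mxE => e; rewrite -[RHS]e.
  have -> : rVpoly v = \sum_(i < N) v 0 i *: 'X^i.
    rewrite {1}/rVpoly poly_def; apply: eq_bigr => i _; congr (_ *: _).
    by rewrite valK.
  rewrite mulr_suml coef_sum; apply: eq_bigr => i _.
  by rewrite -scalerAl coefZ mxE.
have sym : (rVpoly v * p) \Po - 'X = rVpoly v * p.
  rewrite -(poly_even_odd (rVpoly v * p)) odd0 comp_poly0 mul0r addr0.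
  by rewrite -comp_polyA expr2 comp_polyM comp_polyX mulrNN.
have : p %| (rVpoly v \Po - 'X).
  by rewrite -(Gauss_dvdpl _ cop) -comp_polyM sym dvdp_mull.
have ssv : size (rVpoly v \Po - 'X) = size (rVpoly v).
  by rewrite size_comp_poly2 // size_polyN size_polyX.
move=> /dvdp_leq h; apply/negPn/negP => r0.
have : rVpoly v \Po - 'X != 0 by rewrite -size_poly_gt0 ssv size_poly_gt0; apply: contraNneq r0 => ->; rewrite linear0.
by move=> /h; rewrite ssv sp ltnNge sv.
Qed.

(* The two relations say that multiplication by [s k * x k] sends the odd part
   of ['X^i * p] at [x k] to the even part of ['X^i * p (X / t)]: a Vandermonde
   matrix intertwines the odd Hurwitz matrix of [p] and the even one of
   [p (X / t)]. *)
Lemma hurwitz_shift_prod N p (t : F) (x s : 'I_N -> F) :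
  (2 : F) != 0 -> p \is monic -> size p = N.+1 -> coprimep p (p \Po - 'X) ->
  t != 0 -> (forall i j, i != j -> x i ^+ 2 != x j ^+ 2) -> (forall k, x k != 0) ->
  (forall k, p.[x k / t] = s k * p.[x k]) ->
  (forall k, p.[- (x k / t)] = - (s k * p.[- x k])) ->
  (\prod_k s k) * (\prod_k x k) = (\prod_(i < N) (t ^+ i / t ^+ (i.*2))) * p`_0.
Proof.
move=> two pm sp cop t0 xx x0 h1 h2.
have B0 := det_hurwitz_odd_neq0 two sp cop.
pose Vd : 'M[F]_N := Vandermonde N (\row_k (x k ^+ 2)).
have Vd0 : \det Vd != 0.
  rewrite det_Vandermonde; apply/prodf_neq0 => i _; apply/prodf_neq0 => j ij.
  by rewrite !mxE subr_eq0 xx // gt_eqF.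
pose r : {poly F} := \poly_(k < N.+1) (t ^- k * p`_k).
have rE z : r.[z] = p.[z / t].
  rewrite horner_poly (@horner_coef_wide _ N.+1) ?sp //; apply: eq_bigr => i _.
  by rewrite expr_div_n; ring.
pose B2 := hurwitz_even N r.
have Vodd (f : {poly F}) z : (size f <= N + N)%N -> z != 0 ->
  \sum_(j < N) f`_(j.*2.+1) * (z ^+ 2) ^+ j = (f.[z] - f.[- z]) / (2 * z).
  move=> sf z0.
  have -> : \sum_(j < N) f`_(j.*2.+1) * (z ^+ 2) ^+ j = (odd_poly f).[z ^+ 2].
    rewrite (@horner_coef_wide _ N); last first.
      by rewrite (leq_trans (size_odd_poly _)) // -(doubleK N) half_leq // -addnn.
    by apply: eq_bigr => j _; rewrite coef_odd_poly.
  rewrite -{2 3}(poly_even_odd f) !(hornerD, hornerM, horner_comp, hornerX, hornerXn) !mulrNN -!expr2.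
  by field; rewrite z0 two.
have Veven (f : {poly F}) z : (size f <= N + N)%N ->
  \sum_(j < N) f`_(j.*2) * (z ^+ 2) ^+ j = (f.[z] + f.[- z]) / 2.
  move=> sf.
  have -> : \sum_(j < N) f`_(j.*2) * (z ^+ 2) ^+ j = (even_poly f).[z ^+ 2].
    rewrite (@horner_coef_wide _ N); last first.
      by rewrite (leq_trans (size_even_poly _)) // -(uphalf_double N) uphalf_leq // -addnn.
    by apply: eq_bigr => j _; rewrite coef_even_poly.
  rewrite -{2 3}(poly_even_odd f) !(hornerD, hornerM, horner_comp, hornerX, hornerXn) !mulrNN -!expr2.
  by field; rewrite two.
have sX (f : {poly F}) (i : 'I_N) : (size f <= N.+1)%N -> (size ('X^i * f)%R <= N + N)%N.
  move=> sf; apply: leq_trans (size_polyMleq _ _) _; rewrite size_polyXn /=.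
  by apply: leq_trans (leq_add (leqnn i) sf) _; rewrite addnS -addSn leq_add2r.
have e : hurwitz_odd N p *m Vd *m diag_mx (\row_k (s k * x k)) = B2 *m Vd.
  apply/matrixP => i k; rewrite mul_mx_diag !mxE.
  under eq_bigr => j _ do rewrite !mxE.
  under [RHS]eq_bigr => j _ do rewrite !mxE.
  rewrite Vodd ?Veven ?sX ?sp ?size_poly // !hornerM !hornerXn !rE mulNr h1 h2.
  by field; rewrite two x0.
have eB2 : B2 = diag_mx (\row_i t ^+ i) *m hurwitz_even N p *m diag_mx (\row_j (t ^+ j.*2)^-1).
  apply/matrixP => i j; rewrite mul_mx_diag mul_diag_mx !mxE !coefXnM.
  case: ltnP => ij; rewrite ?mulr0 ?mul0r // coef_poly.
  case: ltnP => h; last by rewrite [p`__]nth_default ?sp // mulr0 mul0r.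
  have -> : t ^+ j.*2 = t ^+ i * t ^+ (j.*2 - i) by rewrite -exprD subnKC.
  by field; rewrite !expf_neq0.
have := congr1 determinant e; rewrite eB2 !det_mulmx !det_diag det_hurwitz_even //.
under [\prod_i _ in LHS]eq_bigr => k _ do rewrite mxE.
rewrite big_split /=; move: (\prod_k s k) (\prod_k x k) => S Xp.
under [\prod_(i < N) _ 0 i]eq_bigr => k _ do rewrite mxE.
under [\prod_(i < N) (\row__ _) 0 i]eq_bigr => k _ do rewrite mxE.
rewrite big_split /=.
move: (\prod_(i < N) _) (\prod_(i < N) _) => T T' h.
apply: (mulIf Vd0); apply: (mulfI B0); move: h.
by move: (\det Vd) (\det (hurwitz_odd N p)) => u w h; transitivity (w * u * (S * Xp)); [ring | rewrite h; ring].
Qed.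

End HurwitzMatrices.

Section TQRelation.
Set Implicit Arguments.
Unset Strict Implicit.
Context {R : realType} {N : nat}.
Local Notation C := R[i].
Context (N_gt0 : (0 < N)%N) (eta : C) (xi : 'I_N -> C).
Hypothesis xi_sub : forall i j, i != j -> csinh (xi i - xi j) != 0.
Hypothesis xi_sub_eta : forall i j, csinh (xi i - xi j + eta) != 0.
Local Notation a := (a eta xi).
Local Notation d := (d xi).

Lemma prod_ordN (f : 'I_N -> C) : \prod_i - f i = (-1) ^+ N * \prod_i f i.
Proof. by rewrite prodrN card_ord. Qed.

Lemma a_shift x : a x = d (x + eta).
Proof. by apply: eq_bigr => i _; rewrite addrAC. Qed.

Lemma a_xi_neq0 i : a (xi i) != 0.
Proof. by apply/prodf_neq0 => j _. Qed.

Lemma d_xi i : d (xi i) = 0.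
Proof. by rewrite /Defs.d (bigD1 i) //= subrr csinhE cexp0 invr1 subrr !mul0r. Qed.

Lemma d_ipi x : d (x + ipi) = (-1) ^+ N * d x.
Proof.
rewrite -prod_ordN; apply: eq_bigr => i _.
by rewrite addrAC csinh_ipi.
Qed.

Lemma a_ipi x : a (x + ipi) = (-1) ^+ N * a x.
Proof. by rewrite !a_shift addrAC d_ipi. Qed.

Lemma d_eq0 x : d x = 0 -> exists i, cexp x ^+ 2 = cexp (xi i) ^+ 2.
Proof.
move/eqP; rewrite /Defs.d prodf_seq_eq0 => /hasP[i _ /andP[_ h]]; exists i.
by apply/eqP; rewrite -[_ == _]negbK -csinh_sub_neq0 negbK.
Qed.

Lemma tpoly_2ipi (r : 'I_N -> C) x : tpoly r (x + ipi + ipi) = (-1) ^+ N * tpoly r x.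
Proof.
rewrite -prod_ordN; apply: eq_bigr => i _.
have -> : (x + ipi + ipi - r i) / 2 = (x - r i) / 2 + ipi.
  by field.
by rewrite csinh_ipi.
Qed.

(* [tpoly r] as a polynomial in [cexp lam]. *)
Definition root_poly (r : 'I_N -> C) : {poly C} := \prod_j ('X - (cexp (r j))%:P).
Definition root_scale (r : 'I_N -> C) : C := \prod_j ((cexp (r j / 2))^-1 / 2).

Lemma root_scale_neq0 r : root_scale r != 0.
Proof. by apply/prodf_neq0 => j _; rewrite mulf_neq0 ?invr_neq0 ?cexp_neq0 ?two_neq0. Qed.

Lemma tpolyE r x :
  tpoly r x = root_scale r * (cexp (x / 2) ^- N * (root_poly r).[cexp x]).
Proof.
rewrite /tpoly /root_scale /root_poly horner_prod mulrA mulrAC.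
rewrite -exprVn -[X in _ * _ ^+ X](card_ord N) -prodr_const -!big_split /=; apply: eq_bigr => j _.
rewrite hornerXsubC csinhE (mulrBl _ x) cexpB -(cexp_half x) -(cexp_half (r j)).
have := cexp_neq0 (x / 2); have := cexp_neq0 (r j / 2).
by move: (cexp (x / 2)) (cexp (r j / 2)) => u v hv hu; field; rewrite hu hv.
Qed.

Lemma root_poly_monic r : root_poly r \is monic.
Proof. by apply: monic_prod => j _; apply: monicXsubC. Qed.

Lemma size_root_poly r : size (root_poly r) = N.+1.
Proof.
rewrite /root_poly -(big_map (fun j => cexp (r j)) xpredT (fun z => 'X - z%:P)).
by rewrite size_prod_XsubC size_map -[X in size X]enumT -cardE card_ord.
Qed.

Lemma root_polyP r z : root (root_poly r) z -> exists j, z = cexp (r j).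
Proof.
rewrite /root_poly -(big_map (fun j => cexp (r j)) xpredT (fun z => 'X - z%:P)).
by rewrite root_prod_XsubC => /mapP[j _ ->]; exists j.
Qed.

Lemma root_poly0 r : (root_poly r)`_0 = (-1) ^+ N * cexp (\sum_j r j).
Proof.
rewrite -horner_coef0 /root_poly horner_prod cexp_sum -prod_ordN.
by apply: eq_bigr => j _; rewrite hornerXsubC sub0r.
Qed.

Section Solution.
Variables (p : 'I_N -> C) (tau : C -> C).
Hypothesis hTQ : TQ_data eta xi p tau.
Hypothesis hp : forall k, tpoly p (xi k - eta) != 0.
Local Notation P := (tpoly p).

Lemma TQ_ipi x : - (tau x * P (x + ipi)) =
  - a x * P (x - eta + ipi) + d x * P (x + eta + ipi).
Proof.
have := TQ_equation hTQ (x + ipi).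
rewrite (TQ_quasiperiodic hTQ) a_ipi d_ipi (addrAC x ipi) (addrAC x ipi eta) => h.
have hs := negbT (signr_eq0 C N).
apply: (mulfI hs); rewrite mulrDr.
transitivity ((-1) ^+ N.-1 * tau x * P (x + ipi)).
  have -> : (-1) ^+ N = - (-1) ^+ N.-1 :> C by rewrite -[X in _ ^+ X = _](prednK N_gt0) exprS mulN1r.
  by rewrite mulrNN mulrA.
by rewrite h; ring.
Qed.

Lemma TQ_xi k : tau (xi k) * P (xi k) = - (a (xi k) * P (xi k - eta)).
Proof. by rewrite (TQ_equation hTQ) d_xi mul0r addr0 mulNr. Qed.

Lemma TQ_xi_ipi k : tau (xi k) * P (xi k + ipi) = a (xi k) * P (xi k - eta + ipi).
Proof.
by have /eqP := TQ_ipi (xi k); rewrite d_xi mul0r addr0 mulNr eqr_opp => /eqP.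
Qed.

Lemma tau_P_xi_neq0 k : (tau (xi k) != 0) && (P (xi k) != 0).
Proof. have : tau (xi k) * P (xi k) != 0.
  by rewrite TQ_xi oppr_eq0; apply: mulf_neq0 (a_xi_neq0 k) (hp k).
by rewrite mulf_eq0 negb_or. Qed.

Lemma tau_xi_neq0 k : tau (xi k) != 0. Proof. by case/andP: (tau_P_xi_neq0 k). Qed.
Lemma P_xi_neq0 k : P (xi k) != 0. Proof. by case/andP: (tau_P_xi_neq0 k). Qed.

Definition wronskian x := P (x - eta) * P (x + ipi) + P (x - eta + ipi) * P x.

Lemma trig_wronskian : trig N.+1 wronskian.
Proof.
have [r hr e] := trig_even (half_trigM (half_trig_shift (- eta) (half_trig_tpoly p))
   (half_trig_shift ipi (half_trig_tpoly p))).
exists r => // x; rewrite -e /wronskian tpoly_2ipi (addrAC x ipi); congr (_ + _).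
have := sqrr_sign C N; rewrite expr2 => hs.
by transitivity ((-1) ^+ N * (-1) ^+ N * (P (x - eta + ipi) * P x)); [rewrite hs mul1r|ring].
Qed.

Lemma wronskian_xi k : wronskian (xi k) = 0.
Proof.
apply: (mulfI (mulf_neq0 (tau_xi_neq0 k) (a_xi_neq0 k))); rewrite mulr0 /wronskian.
transitivity (P (xi k - eta) * a (xi k) * (tau (xi k) * P (xi k + ipi)) +
   a (xi k) * P (xi k - eta + ipi) * (tau (xi k) * P (xi k))); first by ring.
by rewrite TQ_xi TQ_xi_ipi; ring.
Qed.

Lemma wronskian_neq0 : exists x, wronskian x != 0.
Proof.
pose w : {poly C} := (root_poly p \Po ((cexp eta)^-1 *: 'X)) * (root_poly p \Po - 'X) +
  (root_poly p \Po (- (cexp eta)^-1 *: 'X)) * root_poly p.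
have wE x : wronskian x = root_scale p ^+ 2 * cexp (x / 2) ^- N * cexp ((x - eta) / 2) ^- N
    * 'i%C ^- N * w.[cexp x].
  have e1 y : cexp ((y + ipi) / 2) = cexp (y / 2) * 'i%C by rewrite (mulrDl y) cexpD cexp_ipi_half.
  have e2 y : cexp (y + ipi) = - cexp y by rewrite cexpD cexp_ipi mulrN1.
  have e3 : cexp (x - eta) = (cexp eta)^-1 * cexp x by rewrite cexpB mulrC.
  rewrite /w !hornerD !hornerM !horner_comp !hornerZ hornerN hornerX mulNr.
  rewrite /wronskian !tpolyE !e1 !e2 e3.
  move: (_.[_ * _]) (_.[- (_ * _)]) (_.[cexp x]) (_.[- cexp x]) => A B D E.
  move: (cexp (x / 2)) (cexp ((x - eta) / 2)) (root_scale p) => u v r.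
  by rewrite !exprMn !invfM; move: (u ^+ N)^-1 (v ^+ N)^-1 (_^-1) => *; ring.
have pp0 : (root_poly p).[0] != 0.
  by rewrite horner_coef0 root_poly0 mulf_neq0 ?cexp_neq0 ?signr_eq0.
have w0 : w != 0.
  suff : w.[0] != 0 by apply: contraNneq => ->; rewrite horner0.
  rewrite /w !(hornerD, hornerM, horner_comp, hornerZ, hornerN, hornerX) !mulr0 oppr0.
  by rewrite -mulr2n mulrn_eq0 /= mulf_eq0 negb_or pp0.
apply: contrapT => h.
have {}h x : w.[cexp x] = 0.
  have : wronskian x = 0 by apply: contrapT => hx; apply: h; exists x; apply/eqP.
  move/eqP; rewrite wE !mulf_eq0 !invr_eq0 !expf_eq0 !(negbTE (cexp_neq0 _)).
  by rewrite (negbTE i_neq0) (negbTE (root_scale_neq0 p)) !andbF /= => /eqP.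
have := max_poly_roots w0 (rs := [seq cexp (k%:R : C) | k <- iota 0 (size w)]).
rewrite size_map size_iota ltnn => H; suff : false by [].
apply: H; first by apply/allP => _ /mapP[k _ ->]; apply/rootP.
rewrite map_inj_uniq ?iota_uniq // => k l e.
have : csinh (k%:R - l%:R : C) = 0.
  by apply/eqP; rewrite -[_ == _]negbK csinh_sub_neq0 e eqxx.
case/csinh_eq0 => m e'; apply/eqP; rewrite -(eqr_nat C) -subr_eq0 e'.
have : (k%:R - l%:R : C) = (k%:R - l%:R : R)%:C by rewrite rmorphB !rmorph_nat.
rewrite e' => e''; rewrite e''.
have := congr1 (@complex.Re R) e''.
have -> : (m%:~R : C) = (m%:~R : R)%:C by rewrite rmorph_int.
by rewrite /= mulr0 mul0r subr0 => <-.
Qed.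

Lemma trig_d : trig N.+1 d.
Proof.
have := trig_prod_csinh (xpredT : pred 'I_N) xi.
by rewrite card_ord.
Qed.

Lemma wronskianE : exists2 c : C, c != 0 & forall x, wronskian x = c * d x.
Proof.
pose x0 := xi (Ordinal N_gt0) + eta.
have d0 : d x0 != 0 by rewrite -a_shift a_xi_neq0.
have h x : wronskian x * d x0 - wronskian x0 * d x = 0.
  pose y (o : option 'I_N) := if o is Some k then xi k else x0.
  have t : trig N.+1 (fun x => wronskian x * d x0 - wronskian x0 * d x).
    have [r hr e] := trigD (trigZ (d x0) trig_wronskian) (trigZ (- wronskian x0) trig_d).
    by exists r => // z; rewrite -e mulNr mulrC.
  apply: (trig_eq0 t (y := y)); first by rewrite card_option card_ord.
  - move=> [i|] [j|] //= ij.
    + by apply: xi_sub; apply: contra ij => /eqP ->.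
    + by rewrite /x0 -opprB csinhN oppr_eq0 addrAC.
    + by rewrite /x0 addrAC.
  by case=> [k|] /=; rewrite ?wronskian_xi ?d_xi; ring.
have e x : wronskian x = wronskian x0 / d x0 * d x.
  by apply: (mulIf d0); rewrite (subr0_eq (h x)); field.
exists (wronskian x0 / d x0) => //.
have [x] := wronskian_neq0; rewrite e.
by apply: contraNneq => ->; rewrite mul0r.
Qed.

Lemma no_common_zero x : P x = 0 -> P (x + ipi) = 0 -> False.
Proof.
move=> h h'.
have [c c0 e] := wronskianE.
have : c * d x = 0 by rewrite -e /wronskian h h'; ring.
move/eqP; rewrite mulf_eq0 (negbTE c0) /= => /eqP /d_eq0[k].
have e2 y : cexp (y + ipi) = - cexp y by rewrite cexpD cexp_ipi mulrN1.
have root_of y : P y = 0 -> (root_poly p).[cexp y] = 0.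
  move/eqP; rewrite tpolyE !mulf_eq0 (negbTE (root_scale_neq0 p)) invr_eq0 expf_eq0.
  by rewrite (negbTE (cexp_neq0 _)) andbF /= => /eqP.
have := root_of _ h'; have := root_of _ h; rewrite e2 => r1 r2.
move/eqP; rewrite eqf_sqr => /orP[] /eqP ek.
  by have := P_xi_neq0 k; rewrite tpolyE -ek r1 !mulr0 eqxx.
by have := P_xi_neq0 k; rewrite tpolyE -[cexp (xi k)]opprK -ek r2 !mulr0 eqxx.
Qed.

Lemma tau_wronskian c : (forall x, wronskian x = c * d x) -> forall x,
  c * tau x = P (x - eta + ipi) * P (x + eta) - P (x + eta + ipi) * P (x - eta).
Proof.
move=> e x.
have ea : c * a x = P x * P (x + eta + ipi) + P (x + ipi) * P (x + eta).
  by rewrite a_shift -e /wronskian addrK.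
have ed : c * d x = P (x - eta) * P (x + ipi) + P (x - eta + ipi) * P x by rewrite -e.
have [h|h] := eqVneq (P x) 0; last first.
  apply: (mulIf h); rewrite -mulrA (TQ_equation hTQ).
  transitivity (- (c * a x) * P (x - eta) + (c * d x) * P (x + eta)); first by ring.
  by rewrite ea ed; ring.
have h' : P (x + ipi) != 0 by apply/eqP => h'; apply: no_common_zero h h'.
apply: (mulIf h'); rewrite -mulrA.
have -> : tau x * P (x + ipi) = a x * P (x - eta + ipi) - d x * P (x + eta + ipi).
  by apply: oppr_inj; rewrite TQ_ipi; ring.
transitivity ((c * a x) * P (x - eta + ipi) - (c * d x) * P (x + eta + ipi)); first by ring.
by rewrite ea ed; ring.
Qed.

Lemma trig_tau : trig N tau.
Proof.
have [c c0 e] := wronskianE.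
have [r hr e'] := trig_odd (half_trigM (half_trig_shift ipi (half_trig_shift (- eta) (half_trig_tpoly p)))
   (half_trig_shift eta (half_trig_tpoly p))).
have t : trig N (fun x => c * tau x).
  exists r => // x; rewrite -e' (tau_wronskian e) (addrAC x ipi (- eta)) (addrAC x ipi eta).
  have -> : x + ipi + ipi - eta = x - eta + ipi + ipi by ring.
  rewrite tpoly_2ipi; have := sqrr_sign C N; rewrite expr2 => hs.
  congr (_ - _).
  by transitivity ((-1) ^+ N * (-1) ^+ N * (P (x + eta + ipi) * P (x - eta))); [rewrite hs mul1r|ring].
have [s hs e''] := trigZ c^-1 t.
by exists s => // x; rewrite -e'' mulKf.
Qed.

Lemma root_polyE x : (root_poly p).[cexp x] = P x * cexp (x / 2) ^+ N / root_scale p.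
Proof.
rewrite tpolyE; have := root_scale_neq0 p; have := cexp_neq0 (x / 2).
by move: (_.[_]) (root_scale p) (cexp (x / 2)) => u r v hv hr; field; rewrite hr expf_neq0.
Qed.

Lemma coprimep_root_poly : coprimep (root_poly p) (root_poly p \Po - 'X).
Proof.
apply: Pdiv.ClosedField.root_coprimep => x hx; have [j xE] := root_polyP hx.
apply/eqP; rewrite horner_comp hornerN hornerX xE => hx'.
have P0 y : (root_poly p).[cexp y] = 0 -> P y = 0.
  move/eqP; rewrite root_polyE !mulf_eq0 invr_eq0 (negbTE (root_scale_neq0 p)) expf_eq0.
  by rewrite (negbTE (cexp_neq0 _)) andbF !orbF => /eqP.
apply: (@no_common_zero (p j)); apply: P0; first by rewrite -xE; apply/rootP.
by rewrite cexpD cexp_ipi mulrN1.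
Qed.

Lemma prod_P_ratio : (\prod_k (P (xi k - eta) / P (xi k))) * \prod_k cexp (xi k) =
  (cexp (eta / 2) ^+ N) ^+ N * (\prod_(i < N) (cexp eta ^+ i / cexp eta ^+ (i.*2)))
   * (-1) ^+ N * cexp (\sum_j p j).
Proof.
pose s k := P (xi k - eta) / P (xi k) / cexp (eta / 2) ^+ N.
have eta0 : cexp (eta / 2) ^+ N != 0 by rewrite expf_neq0 ?cexp_neq0.
have e1 k : (root_poly p).[cexp (xi k) / cexp eta] = s k * (root_poly p).[cexp (xi k)].
  rewrite -cexpB !root_polyE (mulrBl _ (xi k)) cexpB expr_div_n /s.
  have := root_scale_neq0 p; have := P_xi_neq0 k.
  by move=> h h'; field; rewrite h h' eta0.
have e2 k : (root_poly p).[- (cexp (xi k) / cexp eta)] = - (s k * (root_poly p).[- cexp (xi k)]).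
  have -> : - (cexp (xi k) / cexp eta) = cexp (xi k - eta + ipi).
    by rewrite cexpD cexp_ipi mulrN1 cexpB.
  have -> : - cexp (xi k) = cexp (xi k + ipi) by rewrite cexpD cexp_ipi mulrN1.
  rewrite !root_polyE.
  have -> : (xi k - eta + ipi) / 2 = (xi k + ipi) / 2 - eta / 2 by field.
  rewrite cexpB expr_div_n /s.
  have -> : P (xi k - eta + ipi) = - (P (xi k - eta) / P (xi k) * P (xi k + ipi)).
    apply: (mulfI (a_xi_neq0 k)); rewrite -TQ_xi_ipi.
    have h := TQ_xi k; have h' := P_xi_neq0 k.
    apply: (mulIf h'); transitivity (tau (xi k) * P (xi k) * P (xi k + ipi)); first by ring.
    by rewrite h; field.
  have := root_scale_neq0 p; have := P_xi_neq0 k.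
  by move=> h h'; field; rewrite h h' eta0.
have x2 i j : i != j -> cexp (xi i) ^+ 2 != cexp (xi j) ^+ 2.
  by rewrite -csinh_sub_neq0; apply: xi_sub.
have := hurwitz_shift_prod (two_neq0) (root_poly_monic p) (size_root_poly p)
  coprimep_root_poly (cexp_neq0 eta) x2 (fun k => cexp_neq0 _) e1 e2.
rewrite root_poly0 => H.
have -> : \prod_k (P (xi k - eta) / P (xi k)) = (cexp (eta / 2) ^+ N) ^+ N * \prod_k s k.
  rewrite -[X in _ ^+ X * _](card_ord N) -prodr_const -big_split /=; apply: eq_bigr => k _.
  by rewrite /s; have h := P_xi_neq0 k; field; rewrite h eta0.
by rewrite -mulrA H !mulrA.
Qed.

End Solution.
End TQRelation.

Section Determinants.
Set Implicit Arguments.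
Unset Strict Implicit.

Lemma det_sum_rows (F : comRingType) (N : nat) (I : finType) (A : 'I_N -> I -> 'I_N -> F) :
  \det (\matrix_(k, j) \sum_s A k s j) =
  \sum_(h : {ffun 'I_N -> I}) \det (\matrix_(k, j) A k (h k) j).
Proof.
rewrite /determinant exchange_big /=; apply: eq_bigr => s _; rewrite -mulr_sumr; congr (_ * _).
under eq_bigr => k _ do rewrite mxE.
rewrite bigA_distr_bigA /=; apply: eq_bigr => h _; apply: eq_bigr => k _.
by rewrite mxE.
Qed.

Lemma prod_pairs (F : comRingType) (N : nat) (f : 'I_N -> F) :
  \prod_(i < N) \prod_(j < N | (i < j)%N) (f i * f j) = \prod_(k < N) f k ^+ N.-1.
Proof.
under eq_bigr => i _ do rewrite big_split /=.
rewrite big_split /= [X in _ * X](exchange_big_dep xpredT) //= -big_split /=.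
apply: eq_bigr => i _; rewrite !prodr_const -exprD; congr (_ ^+ _).
rewrite -[in RHS](card_ord N) -(cardC1 i).
rewrite -cardUI [X in (_ + X)%N](_ : _ = 0%N) ?addn0.
  by apply: eq_card => j; rewrite !inE neq_ltn orbC.
by apply: eq_card0 => j; rewrite !inE; apply/negP => /andP[] /ltnW h; rewrite leqNgt in h; apply/negP.
Qed.

Lemma det_two_levels (F : comRingType) (N : nat) (n : 'I_N) (g D : 'I_N -> F) :
  \det (\matrix_(k, l) (D k *+ ((k == l) && (k != n)) + g k *+ (l == n))) =
  g n * \prod_(k | k != n) D k.
Proof.
rewrite (expand_det_row _ n) (bigD1 n) //= big1 => [|l ln]; last first.
  by rewrite mxE eqxx andbF (negbTE ln) !mulr0n addr0 mul0r.
rewrite mxE eqxx andbF mulr0n add0r mulr1n addr0; congr (_ * _).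
rewrite /cofactor addnn -signr_odd odd_double mul1r.
set m := row' _ _.
have -> : m = diag_mx (\row_k D (lift n k)).
  apply/matrixP => i j; rewrite !mxE (inj_eq lift_inj) ![lift n _ == n]eq_sym.
  by rewrite !(negbTE (neq_lift _ _)) /= andbT mulr0n addr0 eq_sym.
rewrite det_diag; under eq_bigr => k _ do rewrite mxE.
have e : \prod_(k < N) (if k == n then 1 else D k) = (if n == n then 1 else D n) *
  \prod_k (if lift n k == n then 1 else D (lift n k)) by exact: bigD1_ord.
rewrite eqxx mul1r in e; rewrite [RHS]big_mkcond /=.
transitivity (\prod_(k < N) (if k == n then 1 else D k)).
  by rewrite e; apply: eq_bigr => k _; rewrite eq_sym (negbTE (neq_lift _ _)).
by apply: eq_bigr => k _; case: eqP.
Qed.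

End Determinants.

Section TrigDeterminants.
Set Implicit Arguments.
Unset Strict Implicit.
Context {R : realType} {N : nat}.
Local Notation C := R[i].
Hypothesis N_gt0 : (0 < N)%N.

Lemma VE (y : 'I_N -> C) : V y =
  (\prod_(i < N) \prod_(j < N | (i < j)%N) (cexp (y j) ^+ 2 - cexp (y i) ^+ 2)) /
  ((\prod_(i < N) \prod_(j < N | (i < j)%N) 2) * \prod_k cexp (y k) ^+ N.-1).
Proof.
rewrite -prod_pairs -[in RHS]big_split /= -[in RHS]prodf_div; apply: eq_bigr => i _.
rewrite -[in RHS]big_split /= -[in RHS]prodf_div; apply: eq_bigr => j _.
rewrite csinhE cexpB; have := cexp_neq0 (y i); have := cexp_neq0 (y j).
by move: (cexp (y i)) (cexp (y j)) => u v hv hu; field; rewrite hu hv.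
Qed.

Lemma det_trig (phi : 'I_N -> C -> C) : (forall j, trig N (phi j)) ->
  exists v : C, forall y : 'I_N -> C, \det (\matrix_(k, j) phi j (y k)) = v * V y.
Proof.
move=> h.
have {h} [r hr] : exists r : 'I_N -> {poly C}, forall j, (size (r j) <= N)%N /\
    forall x, phi j x = cexp x ^- N * cexp x * (r j).[cexp x ^+ 2].
  suff /choice [r hr] : forall j, exists r : {poly C}, (size r <= N)%N /\
    forall x, phi j x = cexp x ^- N * cexp x * r.[cexp x ^+ 2] by exists r.
  by move=> j; have [r hr e] := h j; exists r.
exists (\det (\matrix_(i < N, j < N) (r j)`_i) * \prod_(i < N) \prod_(j < N | (i < j)%N) 2) => y.
have -> : \matrix_(k, j) phi j (y k) = diag_mx (\row_k (cexp (y k) ^+ N.-1)^-1) *m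
   (Vandermonde N (\row_k (cexp (y k) ^+ 2)))^T *m \matrix_(i < N, j < N) (r j)`_i.
  apply/matrixP => k j; rewrite -mulmxA mul_diag_mx !mxE (proj2 (hr j)).
  rewrite (horner_coef_wide _ (proj1 (hr j))); congr (_ * _).
    by rewrite -[in LHS](prednK N_gt0) exprS; have := cexp_neq0 (y k);
      move: (cexp (y k)) => u hu; field; rewrite hu expf_neq0.
  by apply: eq_bigr => i _; rewrite !mxE mulrC.
rewrite !det_mulmx det_tr det_diag det_Vandermonde VE.
under [\prod_i _ 0 i]eq_bigr => k _ do rewrite mxE.
rewrite prodfV.
have -> : \prod_(i < N) \prod_(j < N | (i < j)%N)
  ((\row_k cexp (y k) ^+ 2) 0 j - (\row_k cexp (y k) ^+ 2) 0 i) =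
  \prod_(i < N) \prod_(j < N | (i < j)%N) (cexp (y j) ^+ 2 - cexp (y i) ^+ 2).
  by apply: eq_bigr => i _; apply: eq_bigr => j _; rewrite !mxE.
have h2 : \prod_(i < N) \prod_(j < N | (i < j)%N) (2 : C) != 0.
  by apply/prodf_neq0 => i _; apply/prodf_neq0 => j _; apply: two_neq0.
have h3 : \prod_(k < N) cexp (y k) ^+ N.-1 != 0.
  by apply/prodf_neq0 => k _; rewrite expf_neq0 ?cexp_neq0.
move: (\prod_(i < N) _) (\prod_(i < N) _) (\prod_(i < N) _) (\det _) h2 h3 => A B E G h2 h3.
by field; rewrite h2 h3.
Qed.

Lemma csinhD_exp (u v : C) : csinh (u + v) = csinh u * cexp v + cexp (- u) * csinh v.
Proof.
rewrite !csinhE cexpD cexpN; have := cexp_neq0 u; have := cexp_neq0 v.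
by move: (cexp u) (cexp v) => x y hy hx; field; rewrite hx hy.
Qed.

Definition cauchy_mx (x y : 'I_N -> C) : 'M[C]_N := \matrix_(k, j) (csinh (x k - y j))^-1.

Definition cobasis (p : 'I_N -> C) j x : C := \prod_(l | l != j) csinh (x - p l).

Lemma trig_cobasis p j : trig N (cobasis p j).
Proof.
have := trig_prod_csinh (predC1 j) p.
by rewrite cardC1 card_ord prednK.
Qed.

Lemma cobasisE p j x : csinh (x - p j) != 0 -> cobasis p j x = (\prod_l csinh (x - p l)) / csinh (x - p j).
Proof. by move=> h; rewrite (bigD1 j) //= mulrC mulKf. Qed.

Lemma det_cobasis p (y : 'I_N -> C) : (forall k j, csinh (y k - p j) != 0) ->
  \det (\matrix_(k, j) cobasis p j (y k)) =
  (\prod_k \prod_l csinh (y k - p l)) * \det (cauchy_mx y p).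
Proof.
move=> h; have -> : \matrix_(k, j) cobasis p j (y k) =
  diag_mx (\row_k \prod_l csinh (y k - p l)) *m cauchy_mx y p.
  by apply/matrixP => k j; rewrite mul_diag_mx !mxE cobasisE.
rewrite det_mulmx det_diag; congr (_ * _).
by apply: eq_bigr => k _; rewrite mxE.
Qed.

Lemma prod_cobasis_diag (y : 'I_N -> C) : \prod_k cobasis y k (y k) =
  (\prod_(i < N) \prod_(j < N | (i < j)%N) csinh (y i - y j)) * V y.
Proof.
transitivity (\prod_(i < N) ((\prod_(j < N | (i < j)%N) csinh (y i - y j)) *
   \prod_(j < N | (j < i)%N) csinh (y i - y j))).
  apply: eq_bigr => i _; rewrite /cobasis (bigID (fun j : 'I_N => (i < j)%N)) /=.
  congr (_ * _); apply: eq_bigl => j; rewrite neq_ltn.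
    by case: ltngtP.
  by case: ltngtP.
rewrite big_split /=; congr (_ * _).
by rewrite (exchange_big_dep xpredT).
Qed.

Lemma det_cauchy (x y : 'I_N -> C) :
  (forall i j : 'I_N, (i < j)%N -> csinh (y i - y j) != 0) -> (forall k j, csinh (x k - y j) != 0) ->
  (\prod_k \prod_l csinh (x k - y l)) * \det (cauchy_mx x y) =
  V x * \prod_(i < N) \prod_(j < N | (i < j)%N) csinh (y i - y j).
Proof.
move=> hy hxy; have [v hv] := det_trig (trig_cobasis y).
rewrite -det_cobasis // hv mulrC; congr (_ * _).
have Vy : V y != 0.
  apply/prodf_neq0 => i _; apply/prodf_neq0 => j ij.
  by rewrite -opprB csinhN oppr_eq0 hy.
apply: (mulIf Vy); rewrite -hv.
have -> : \matrix_(k, j) cobasis y j (y k) = diag_mx (\row_k cobasis y k (y k)).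
  apply/matrixP => k j; rewrite !mxE; have [->|kj] := eqVneq k j; first by rewrite mulr1n.
  by rewrite mulr0n /cobasis (bigD1 k) //= subrr csinhE cexp0 invr1 subrr !mul0r.
rewrite det_diag; under eq_bigr => k _ do rewrite mxE.
exact: prod_cobasis_diag.
Qed.

End TrigDeterminants.

Section SoVSum.
Set Implicit Arguments.
Unset Strict Implicit.
Context {R : realType} {N : nat}.
Local Notation C := R[i].
Context (N_gt0 : (0 < N)%N) (eta : C) (xi : 'I_N -> C).
Hypothesis xi_sub : forall i j, i != j -> csinh (xi i - xi j) != 0.
Hypothesis xi_sub_eta : forall i j, csinh (xi i - xi j + eta) != 0.
Local Notation a := (a eta xi).
Local Notation d := (d xi).
Variables (br : config N -> 'rV[C]_#|{: config N}|) (kt : config N -> 'cV[C]_#|{: config N}|).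
Hypothesis hSoV : SoV_bases eta xi br kt.
Variables (kappa eps : C).
Hypotheses (hkappa : kappa != 0) (heps : eps * eps = 1).

Lemma V_shift_neq0 (h : config N) : V (fun n => xi_shift eta xi n (h n)) != 0.
Proof.
apply/prodf_neq0 => i _; apply/prodf_neq0 => j ij; rewrite /xi_shift.
have ij' : j != i by rewrite gt_eqF.
case: (h i) => [[|[|//]] ?]; case: (h j) => [[|[|//]] ?]; rewrite /= ?mul0r ?mul1r ?subr0.
- exact: xi_sub.
- have -> : xi j - eta - xi i = - (xi i - xi j + eta) by ring.
  by rewrite csinhN oppr_eq0.
- have -> : xi j - (xi i - eta) = xi j - xi i + eta by ring.
  exact: xi_sub_eta.
have -> : xi j - eta - (xi i - eta) = xi j - xi i by ring.
exact: xi_sub.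
Qed.

Lemma separate_matrix_element (P Q : C -> C) x :
  matrix_element (separate_bra eta xi br P kappa eps) (opD eta xi x)
    (separate_ket eta xi kt Q kappa eps) =
  \sum_(h : config N) (\prod_m (P (xi m) / P (xi m - eta) * (Q (xi m) / Q (xi m - eta))) ^+ (1 - h m))
    * sov_eigenvalue eta xi h x * (V (fun n => xi_shift eta xi n (1 - h n)) / V xi).
Proof.
rewrite /matrix_element /pairing mulmxA.
have -> : separate_bra eta xi br P kappa eps *m opD eta xi x =
  \sum_(h : config N) (((\prod_m (eps / kappa * (P (xi m) / P (xi m - eta))) ^+ (1 - h m)) *
     V (fun n => xi_shift eta xi n (h n))) * sov_eigenvalue eta xi h x) *: br h.
  rewrite mulmx_suml; apply: eq_bigr => h _.
  by rewrite -scalemxAl (sov_bra_D hSoV) scalerA.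
rewrite mulmx_suml summxE; apply: eq_bigr => h _.
have pe (c c' : C) (k : config N) : ((c *: br h) *m (c' *: kt k)) ord0 ord0 =
  c * c' * ((h == k)%:R / V (fun n => xi_shift eta xi n (h n))).
  rewrite -scalemxAl -scalemxAr 2!mxE mulrA; congr (_ * _).
  exact: sov_pairing hSoV h k.
rewrite /separate_ket mulmx_sumr summxE.
rewrite (eq_bigr _ (fun k _ => pe _ _ k)).
rewrite [LHS](bigD1 h) //= [X in _ + X = _]big1 ?addr0 => [|k kh]; last first.
  by rewrite eq_sym (negbTE kh) mul0r mulr0.
have -> : \prod_m (P (xi m) / P (xi m - eta) * (Q (xi m) / Q (xi m - eta))) ^+ (1 - h m) =
  (\prod_m (eps / kappa * (P (xi m) / P (xi m - eta))) ^+ (1 - h m)) *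
  (\prod_m (eps * kappa * (Q (xi m) / Q (xi m - eta))) ^+ (1 - h m)).
  rewrite -big_split /=; apply: eq_bigr => m _; rewrite -exprMn; congr (_ ^+ _).
  rewrite [RHS](_ : _ = eps * eps * (kappa / kappa) *
    (P (xi m) / P (xi m - eta) * (Q (xi m) / Q (xi m - eta)))).
    by rewrite heps divff // !mul1r.
  by ring.
rewrite eqxx; have := V_shift_neq0 h.
move: (V _) (V _) (V _)^-1 (\prod_(m < N) _) (\prod_(m < N) _) (sov_eigenvalue _ _ _ _).
by move=> v1 v2 v3 pr1 pr2 ev hv; rewrite mulr1n; field.
Qed.

Variables (p q : 'I_N -> C) (tauP tauQ : C -> C).
Hypotheses (hTP : TQ_data eta xi p tauP) (hTQ : TQ_data eta xi q tauQ).
Hypotheses (hp : forall k, tpoly p (xi k - eta) != 0) (hq : forall k, tpoly q (xi k - eta) != 0).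
Local Notation P := (tpoly p).
Local Notation Q := (tpoly q).

Lemma tpoly_double (r : 'I_N -> C) x :
  tpoly r x * tpoly r (x + ipi) = ('i%C / 2) ^+ N * \prod_l csinh (x - r l).
Proof.
rewrite -big_split /= -[X in _ ^+ X](card_ord N) -prodr_const -big_split /=.
apply: eq_bigr => l _; rewrite (addrAC x ipi) csinh_half_ipi (csinh_double (x - r l)).
by have h := two_neq0 (R := R); field.
Qed.

Definition sov_mx : 'M[C]_N := \matrix_(l, k)
  (tauQ (xi l) / csinh (xi l - p k) - cexp (- eta) * (tauP (xi l) / csinh (xi l - p k - eta))).

Definition sov_pert_scale n : C := (\prod_(l | l != n) csinh (xi n - xi l)) * tauQ (xi n) *
  a (xi n) * cexp (- xi n) / \prod_m csinh (xi n - p m).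

Definition sov_pert n : 'M[C]_N := \matrix_(l, k) ((sov_pert_scale n * cexp (p k)) *+ (l == n)).

Definition sov_mx_dressed n : 'M[C]_N := \matrix_(k, j)
  (tauQ (xi k) * csinh (xi n - xi k + eta) / csinh (xi k - p j) -
   tauP (xi k) * csinh (xi n - xi k) / csinh (xi k - p j - eta)).

Definition row_replaced n : 'M[C]_N := \matrix_(l, k) (if l == n then cexp (p k) else sov_mx l k).

Lemma det_rank_one n : \det (sov_mx + sov_pert n) - \det sov_mx = sov_pert_scale n * \det (row_replaced n).
Proof.
rewrite (@determinant_multilinear _ _ _ sov_mx (row_replaced n) n 1 (sov_pert_scale n)).
- by rewrite mul1r addrAC subrr add0r.
- by apply/rowP => k; rewrite !mxE eqxx mulr1n mul1r.
- by apply/matrixP => l k; rewrite !mxE eq_sym (negbTE (neq_lift _ _)) mulr0n addr0.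
by apply/matrixP => l k; rewrite !mxE eq_sym (negbTE (neq_lift _ _)) mulr0n addr0.
Qed.

Hypothesis xi_p : forall k j, csinh (xi k - p j) != 0.

Lemma prod_xi_p_shift k : a (xi k) ^+ 2 * \prod_l csinh (xi k - eta - p l) =
  - tauP (xi k) ^+ 2 * \prod_l csinh (xi k - p l).
Proof.
have i2 : ('i%C / 2 : C) ^+ N != 0 by rewrite expf_neq0 // mulf_neq0 ?i_neq0 ?invr_neq0 ?two_neq0.
apply: (mulfI i2); rewrite mulrCA -(tpoly_double p (xi k - eta)) [RHS]mulrCA -(tpoly_double p (xi k)).
have h1 := TQ_xi hTP k; have h2 := TQ_xi_ipi N_gt0 hTP k.
transitivity (- (- (a (xi k) * P (xi k - eta))) * (a (xi k) * P (xi k - eta + ipi))); first by ring.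
by rewrite -h1 -h2; ring.
Qed.

Lemma xi_p_eta k j : csinh (xi k - p j - eta) != 0.
Proof.
have : a (xi k) ^+ 2 * \prod_l csinh (xi k - eta - p l) != 0.
  rewrite prod_xi_p_shift; apply: mulf_neq0.
    by rewrite oppr_eq0 expf_neq0 //; apply: (tau_xi_neq0 xi_sub_eta hTP hp).
  by apply/prodf_neq0 => l _; apply: xi_p.
rewrite mulf_eq0 negb_or => /andP[_ /prodf_neq0 /(_ j isT)].
by rewrite addrAC.
Qed.

Lemma det_detB n : \det (sov_mx_dressed n) = cexp (\sum_j xi j - \sum_j p j) *
  (\det (sov_mx + sov_pert n) - \det sov_mx).
Proof.
rewrite det_rank_one.
pose w j := cexp (p j) * csinh (xi n - p j).
pose g k := tauQ (xi k) * csinh (xi n - xi k + eta) * cexp (- (xi n - xi k)) -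
   tauP (xi k) * csinh (xi n - xi k) * cexp (- (xi n - xi k) - eta).
pose D k := csinh (xi n - xi k) * csinh (xi n - xi k + eta) * cexp (xi k).
have e : sov_mx_dressed n *m diag_mx (\row_j w j) =
  (\matrix_(k, l) (D k *+ ((k == l) && (k != n)) + g k *+ (l == n))) *m row_replaced n.
  apply/matrixP => k j; rewrite mul_mx_diag !mxE.
  under [RHS]eq_bigr => l _ do rewrite mxE [row_replaced n l j]mxE mulrDl.
  rewrite big_split /= [X in _ = _ + X](bigD1 n) //= eqxx mulr1n [X in _ = _ + (_ + X)]big1; last first.
    by move=> l ln; rewrite (negbTE ln) mulr0n mul0r.
  rewrite addr0.
  have -> : \sum_(l < N) D k *+ ((k == l) && (k != n)) * (if l == n then cexp (p j) else sov_mx l j) =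
     D k * sov_mx k j.
    rewrite (bigD1 k) //= eqxx big1 => [|l lk]; last by rewrite eq_sym (negbTE lk) mulr0n mul0r.
    have [->|kn] := eqVneq k n; last by rewrite mulr1n addr0.
    by rewrite /D subrr csinhE cexp0 invr1 subrr !mul0r addr0.
  rewrite /D /g /w mxE.
  have e1 : csinh (xi n - p j) = csinh (xi n - xi k) * cexp (xi k - p j) +
      cexp (- (xi n - xi k)) * csinh (xi k - p j).
    by rewrite -csinhD_exp; congr csinh; ring.
  have e2 : csinh (xi n - p j) = csinh (xi n - xi k + eta) * cexp (xi k - p j - eta) +
      cexp (- (xi n - xi k) - eta) * csinh (xi k - p j - eta).
    by rewrite -opprD -csinhD_exp; congr csinh; ring.
  have h1 := xi_p_eta k j; have h2 := xi_p k j.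
  rewrite mulrBl {1}e1 e2 !(cexpB, cexpN).
  have := cexp_neq0 (p j); have := cexp_neq0 eta; have := cexp_neq0 (xi n); have := cexp_neq0 (xi k).
  move: (csinh _) (csinh _) (csinh _) (csinh _) (cexp _) (cexp _) (cexp _) (cexp _) h1 h2.
  move=> c1 c2 c3 c4 x1 x2 x3 x4 h1 h2 h3 h4 h5 h6.
  by field; rewrite h1 h2 h3 h4 h5 h6.
have := congr1 determinant e; rewrite !det_mulmx det_diag det_two_levels.
have -> : \prod_i (\row_j w j) 0 i = cexp (\sum_j p j) * \prod_m csinh (xi n - p m).
  by rewrite cexp_sum -big_split; apply: eq_bigr => j _; rewrite mxE.
have -> : g n = tauQ (xi n) * csinh eta.
  have s0 : csinh (0 : C) = 0 by rewrite csinhE cexp0 invr1 subrr mul0r.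
  by rewrite /g subrr add0r s0 mulr0 mul0r subr0 cexpN cexp0 invr1 mulr1.
have -> : \prod_(k | k != n) D k = (\prod_(k | k != n) csinh (xi n - xi k)) *
   (\prod_(k | k != n) csinh (xi n - xi k + eta)) * (\prod_(k | k != n) cexp (xi k)).
  by rewrite -!big_split.
have h0 : \prod_m csinh (xi n - p m) != 0 by apply/prodf_neq0 => m _; apply: xi_p.
rewrite /sov_pert_scale cexpB cexpN.
have -> : a (xi n) = csinh eta * \prod_(k | k != n) csinh (xi n - xi k + eta).
  by rewrite /Defs.a (bigD1 n) //= subrr add0r.
have -> : cexp (\sum_j xi j) = cexp (xi n) * \prod_(k | k != n) cexp (xi k).
  by rewrite cexp_sum (bigD1 n).
have := cexp_neq0 (\sum_j p j); have := cexp_neq0 (xi n).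
move: (\det (sov_mx_dressed n)) (\det (row_replaced n)) (\prod_m csinh (xi n - p m)) h0 => X Y Z h0.
move=> hx hy H; apply: (mulIf (mulf_neq0 hy h0)); rewrite H.
by field; rewrite hx hy h0.
Qed.

Lemma tpoly_ratio (r : 'I_N -> C) tau k : TQ_data eta xi r tau ->
  (forall k, tpoly r (xi k - eta) != 0) ->
  tpoly r (xi k) / tpoly r (xi k - eta) = - (a (xi k) / tau (xi k)).
Proof.
move=> h hr; have t0 := tau_xi_neq0 xi_sub_eta h hr k; have e := TQ_xi h k.
apply: (mulIf (hr k)); apply: (mulfI t0); rewrite divfK // e.
by field.
Qed.

Lemma separate_opD n : \det (cauchy_mx xi p) != 0 ->
  matrix_element (separate_bra eta xi br P kappa eps) (opD eta xi (xi n))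
    (separate_ket eta xi kt Q kappa eps) * ((\prod_k tauQ (xi k)) * \det (cauchy_mx xi p)) =
  cexp (\sum_j xi j - \sum_j p j) * (\det (sov_mx + sov_pert n) - \det sov_mx).
Proof.
move=> hc; rewrite separate_matrix_element -det_detB.
have [v hv] := det_trig N_gt0 (trig_cobasis N_gt0 p).
have hxi : v * V xi = (\prod_k \prod_l csinh (xi k - p l)) * \det (cauchy_mx xi p).
  by rewrite -hv det_cobasis.
have pi0 : \prod_k \prod_l csinh (xi k - p l) != 0.
  by apply/prodf_neq0 => k _; apply/prodf_neq0 => l _; apply: xi_p.
have vV0 : v * V xi != 0 by rewrite hxi mulf_neq0.
have tQ0 : \prod_k tauQ (xi k) != 0.
  by apply/prodf_neq0 => k _; apply: (tau_xi_neq0 xi_sub_eta hTQ hq).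
pose u k := P (xi k) / P (xi k - eta) * (Q (xi k) / Q (xi k - eta)).
pose c k (s : 'I_2) := u k ^+ (1 - s) * csinh (xi n - xi_shift eta xi k s).
have key : \det (\matrix_(k, j) \sum_s c k s * cobasis p j (xi_shift eta xi k (1 - s))) =
   (\prod_k \prod_l csinh (xi k - p l)) / (\prod_k tauQ (xi k)) * \det (sov_mx_dressed n).
  have -> : \matrix_(k, j) \sum_s c k s * cobasis p j (xi_shift eta xi k (1 - s)) =
    diag_mx (\row_k ((\prod_l csinh (xi k - p l)) / tauQ (xi k))) *m sov_mx_dressed n.
    apply/matrixP => k j; rewrite mul_diag_mx !mxE sum_I2 /c /xi_shift /= subn0 subnn expr1 expr0.
    rewrite !mul0r !mul1r !subr0 opprB addrA (addrAC (xi n) eta).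
    have hpe : csinh (xi k - eta - p j) != 0 by rewrite addrAC xi_p_eta.
    rewrite !cobasisE //.
    have t0 := tau_xi_neq0 xi_sub_eta hTQ hq k; have t0' := tau_xi_neq0 xi_sub_eta hTP hp k.
    have a0 := a_xi_neq0 xi_sub_eta k.
    have -> : \prod_l csinh (xi k - eta - p l) =
       - (tauP (xi k) / a (xi k)) ^+ 2 * \prod_l csinh (xi k - p l).
      apply: (mulfI (expf_neq0 2 a0)); rewrite prod_xi_p_shift.
      by field.
    rewrite /u (tpoly_ratio k hTP hp) (tpoly_ratio k hTQ hq).
    have h1 := xi_p_eta k j; have h2 := xi_p k j.
    rewrite (addrAC (xi k) (- eta)).
    move: (csinh _) (csinh _) (csinh _) (csinh _) (\prod_(l < N) _) h1 h2 => A B E G Pi h1 h2.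
    by field; rewrite h1 h2 t0 t0' a0.
  rewrite det_mulmx det_diag; congr (_ * _); rewrite -prodf_div.
  by apply: eq_bigr => k _; rewrite mxE.
have sum : \sum_(h : config N) (\prod_m u m ^+ (1 - h m)) * sov_eigenvalue eta xi h (xi n)
    * (V (fun k => xi_shift eta xi k (1 - h k)) / V xi) * (v * V xi) =
  \det (\matrix_(k, j) \sum_s c k s * cobasis p j (xi_shift eta xi k (1 - s))).
  rewrite (det_sum_rows (fun k s j => c k s * cobasis p j (xi_shift eta xi k (1 - s)))).
  apply: eq_bigr => h _.
  have -> : \matrix_(k, j) (c k (h k) * cobasis p j (xi_shift eta xi k (1 - h k))) =
     diag_mx (\row_k c k (h k)) *m (\matrix_(k, j) cobasis p j (xi_shift eta xi k (1 - h k))).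
    by apply/matrixP => k j; rewrite mul_diag_mx !mxE.
  rewrite det_mulmx det_diag hv.
  have -> : \prod_i (\row_k c k (h k)) 0 i = (\prod_m u m ^+ (1 - h m)) * sov_eigenvalue eta xi h (xi n).
    by rewrite /sov_eigenvalue -big_split; apply: eq_bigr => k _; rewrite mxE.
  have vx0 : V xi != 0 by move: vV0; rewrite mulf_eq0 negb_or => /andP[].
  by field.
move: sum; rewrite -mulr_suml key hxi.
move: (\sum_h _) (\prod_k \prod_l _) pi0 => X Pi pi0 e.
apply: (mulfI pi0); apply: (mulIf (invr_neq0 tQ0)).
transitivity (X * (Pi * \det (cauchy_mx xi p))); first by field.
by rewrite e; field.
Qed.

End SoVSum.

Section TauForm.
Set Implicit Arguments.
Unset Strict Implicit.
Context {R : realType} {N : nat}.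
Local Notation C := R[i].
Context (N_gt0 : (0 < N)%N) (eta : C) (xi : 'I_N -> C).
Hypothesis xi_sub : forall i j, i != j -> csinh (xi i - xi j) != 0.
Local Notation a := (a eta xi).
Local Notation d := (d xi).

Lemma d_neq0P x : d x != 0 -> forall l, csinh (x - xi l) != 0.
Proof. by move/prodf_neq0 => h l; apply: h. Qed.

Definition d' l : C := \prod_(j | j != l) csinh (xi l - xi j).

Lemma d'_neq0 l : d' l != 0.
Proof. by apply/prodf_neq0 => j jl; apply: xi_sub; rewrite eq_sym. Qed.

Lemma tau_hat_diff tau z w : trig N tau -> d z != 0 -> d w != 0 -> csinh (z - w) != 0 ->
  (tau_hat xi tau z - tau_hat xi tau w) / csinh (z - w) =
  \sum_l (d' l * csinh (z - xi l))^-1 * (cexp (xi l) * (tau (xi l) / csinh (xi l - w))).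
Proof.
move=> ht hz hw hzw.
have pf x : d x != 0 -> tau x / d x = \sum_l tau (xi l) / (d' l * csinh (x - xi l)).
  move=> hx; apply: trig_partial_fractions => //; first by rewrite card_ord.
  exact: d_neq0P.
rewrite /tau_hat -2!mulrA !pf // 2!mulr_sumr -sumrB mulr_suml.
apply: eq_bigr => l _.
have h1 := d_neq0P hz l; have h2 := d_neq0P hw l; have h3 := d'_neq0 l.
have e : cexp z * csinh (w - xi l) - cexp w * csinh (z - xi l) = - (cexp (xi l) * csinh (z - w)).
  rewrite !csinhE !cexpB; have := cexp_neq0 z; have := cexp_neq0 w; have := cexp_neq0 (xi l).
  by move: (cexp z) (cexp w) (cexp (xi l)) => u v y h h' h''; field; rewrite h h' h''.
have -> : csinh (xi l - w) = - csinh (w - xi l) by rewrite -csinhN opprB.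
transitivity (tau (xi l) / (d' l * csinh (z - xi l) * csinh (w - xi l) * csinh (z - w)) *
   (cexp z * csinh (w - xi l) - cexp w * csinh (z - xi l))).
  by move: (csinh _) (csinh _) (csinh _) h1 h2 hzw => A B E hA hB hE; field; rewrite hA hB hE h3.
rewrite e; move: (csinh _) (csinh _) (csinh _) h1 h2 hzw => A B E hA hB hE; field.
by rewrite hA hB hE h3.
Qed.

Definition cauchy_weighted (z : 'I_N -> C) : 'M[C]_N :=
  \matrix_(i, l) ((d' l * csinh (z i - xi l))^-1 * cexp (xi l)).

Lemma S_tau_factor (p z : 'I_N -> C) tauP tauQ : trig N tauP -> trig N tauQ ->
  (forall i, d (z i) != 0) -> (forall k, d (p k) != 0) -> (forall k, d (p k + eta) != 0) ->
  (forall i k, csinh (z i - p k) != 0) -> (forall i k, csinh (z i - p k - eta) != 0) ->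
  S_tau_matrix eta xi (cexp (- eta)) tauQ tauP z p =
  cauchy_weighted z *m sov_mx eta xi p tauP tauQ.
Proof.
move=> tP tQ hz hp hpe hzp hzpe; apply/matrixP => i k; rewrite !mxE.
have e : csinh (z i - p k - eta) = csinh (z i - (p k + eta)) by rewrite opprD addrA.
rewrite tau_hat_diff // e tau_hat_diff -?e // mulr_sumr -sumrB.
apply: eq_bigr => l _; rewrite !mxE opprD addrA -[cexp (- eta)]/(cexp (- eta)); ring.
Qed.

Lemma P_tau_factor (p z : 'I_N -> C) tauQ n : (forall i, d (z i) != 0) ->
  (forall l, csinh (xi n - p l) != 0) ->
  P_tau_matrix eta xi tauQ z p (xi n) = cauchy_weighted z *m sov_pert eta xi p tauQ n.
Proof.
move=> hz hp; apply/matrixP => i k; rewrite !mxE [RHS](bigD1 n) //= [X in _ = _ + X]big1 => [|l ln]; last first.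
  by rewrite !mxE (negbTE ln) mulr0n mulr0.
rewrite !mxE eqxx mulr1n addr0 /sov_pert_scale -/(d' n) cexpN.
have h1 := d'_neq0 n; have h2 := cexp_neq0 (xi n); have h3 := d_neq0P (hz i) n.
have h4 : \prod_l csinh (xi n - p l) != 0 by apply/prodf_neq0 => l _; apply: hp.
by move: (csinh _) (\prod_l _) h3 h4 => A B h3 h4; field; rewrite h1 h2 h3 h4.
Qed.

Lemma det_cauchy_weighted (z : 'I_N -> C) :
  \det (cauchy_weighted z) = \det (cauchy_mx z xi) * cexp (\sum_l xi l) / \prod_l d' l.
Proof.
have -> : cauchy_weighted z = cauchy_mx z xi *m diag_mx (\row_l (cexp (xi l) / d' l)).
  by apply/matrixP => i l; rewrite mul_mx_diag !mxE invfM; ring.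
rewrite det_mulmx det_diag cexp_sum -mulrA -prodf_div; congr (_ * _).
by apply: eq_bigr => l _; rewrite mxE.
Qed.

Lemma prod_d' : \prod_l d' l = (\prod_(i < N) \prod_(j < N | (i < j)%N) csinh (xi i - xi j)) * V xi.
Proof. exact: prod_cobasis_diag. Qed.

Hypothesis xi_sub_eta : forall i j, csinh (xi i - xi j + eta) != 0.

Lemma form_factor_tau_det kappa eps (p q z : 'I_N -> C) tauP tauQ n F :
  TQ_data eta xi p tauP -> TQ_data eta xi q tauQ ->
  (forall k, tpoly p (xi k - eta) != 0) -> (forall k, tpoly q (xi k - eta) != 0) ->
  tau_regular eta xi z p tauQ n ->
  (\det (cauchy_mx xi p) != 0 -> F * ((\prod_k tauQ (xi k)) * \det (cauchy_mx xi p)) =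
    cexp (\sum_j xi j - \sum_j p j) *
      (\det (sov_mx eta xi p tauP tauQ + sov_pert eta xi p tauQ n) - \det (sov_mx eta xi p tauP tauQ))) ->
  eps * kappa * tau_ratio xi tauP tauQ n * F = form_factor_tau eta xi kappa eps z p tauP tauQ n.
Proof.
move=> hTP hTQ hp hq hr.
have tP := trig_tau N_gt0 xi_sub xi_sub_eta hTP hp.
have tQ := trig_tau N_gt0 xi_sub xi_sub_eta hTQ hq.
have xi_p k j : csinh (xi k - p j) != 0.
  by rewrite -opprB csinhN oppr_eq0; apply: d_neq0P (tr_d_p hr j) k.
have xi_z i k : csinh (z i - xi k) != 0 by apply: d_neq0P (tr_d_z hr i) k.
have Vxi : V xi != 0.
  by apply/prodf_neq0 => i _; apply/prodf_neq0 => j ij; apply: xi_sub; rewrite gt_eqF.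
have Xi0 : \prod_(i < N) \prod_(j < N | (i < j)%N) csinh (xi i - xi j) != 0.
  by apply/prodf_neq0 => i _; apply/prodf_neq0 => j ij; apply: xi_sub; rewrite lt_eqF.
have Vz : V z != 0 by apply/prodf_neq0 => i _; apply/prodf_neq0 => j ij; apply: (tr_z hr).
have Vp : \prod_(i < N) \prod_(j < N | (i < j)%N) csinh (p i - p j) != 0.
  by apply/prodf_neq0 => i _; apply/prodf_neq0 => j ij; apply: (tr_p hr).
have xiP0 : \prod_k \prod_l csinh (xi k - p l) != 0.
  by apply/prodf_neq0 => k _; apply/prodf_neq0 => l _.
have zX0 : \prod_k \prod_l csinh (z k - xi l) != 0.
  by apply/prodf_neq0 => k _; apply/prodf_neq0 => l _.
have tQ0 : \prod_k tauQ (xi k) != 0 by apply/prodf_neq0 => k _; apply: (tr_tauQ hr).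
have c1 := det_cauchy N_gt0 (tr_p hr) xi_p.
have c2 := det_cauchy N_gt0 (fun i j ij => xi_sub (negbT (ltn_eqF ij))) xi_z.
have cp0 : \det (cauchy_mx xi p) != 0.
  apply: contraTneq (mulf_neq0 Vxi Vp) => h; rewrite -c1 h mulr0 eqxx //.
move=> /(_ cp0) HF; rewrite /form_factor_tau.
rewrite (S_tau_factor tP tQ (tr_d_z hr) (tr_d_p hr) (tr_d_p_eta hr) (tr_zp hr) (tr_zp_eta hr)).
rewrite (P_tau_factor tauQ (tr_d_z hr) (tr_xi_p hr)) -mulmxDr !det_mulmx -mulrBr.
rewrite det_cauchy_weighted prod_d'.
have -> : \prod_(i < N) \prod_(j < N | (i < j)%N) (csinh (z j - z i) * csinh (p i - p j)) =
  V z * \prod_(i < N) \prod_(j < N | (i < j)%N) csinh (p i - p j).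
  by rewrite -big_split; apply: eq_bigr => i _; rewrite -big_split.
have -> : \prod_(i < N) \prod_(j < N) (csinh (z i - xi j) * csinh (xi j - p i)) =
  (\prod_k \prod_l csinh (z k - xi l)) * \prod_k \prod_l csinh (xi k - p l).
  rewrite [X in _ = _ * X]exchange_big -big_split; apply: eq_bigr => i _.
  by rewrite -big_split.
move: HF c1 c2 cp0; rewrite cexpB cexpN.
have := cexp_neq0 (\sum_j p j).
move: (cexp _) (cexp _) (V z) (V xi) (\prod_k tauQ (xi k)) Vxi Vz tQ0.
move: (\prod_k \prod_l csinh (z k - xi l)) zX0 => Z Z0 ex e vz vx T vx0 vz0 T0.
move: (\prod_k \prod_l csinh (xi k - p l)) xiP0 (\prod_(i < N) \prod_(j < N | (i < j)%N) csinh (p i - p j)) Vp => Pi Pi0 vp vp0.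
move: (\prod_(i < N) \prod_(j < N | (i < j)%N) csinh (xi i - xi j)) Xi0 => X X0.
move: (\det (cauchy_mx xi p)) (\det (cauchy_mx z xi)) (_ - _) (tau_ratio _ _ _ _) => kp kz D ra e0 HF c1 c2 kp0.
have -> : F = ex / e * D / (T * kp) by rewrite -HF; field; rewrite T0 kp0.
have -> : kz = vz * X / Z by rewrite -c2; field.
have -> : kp = vx * vp / Pi by rewrite -c1; field.
by field; rewrite vx0 vz0 T0 Pi0 vp0 X0 e0 Z0.
Qed.

End TauForm.

Lemma rank_outer (F : fieldType) (m n : nat) (M : 'M[F]_(m, n)) u v i j :
  (forall i j, M i j = u i * v j) -> u i != 0 -> v j != 0 -> \rank M = 1%N.
Proof.
move=> e ui vj; apply/eqP; rewrite eqn_leq; apply/andP; split.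
  have -> : M = (\col_i u i) *m (\row_j v j).
    by apply/matrixP => k l; rewrite e !mxE big_ord1 !mxE.
  by rewrite (leq_trans (mxrankM_maxl _ _)) // rank_leq_col.
rewrite lt0n mxrank_eq0; apply/eqP => M0.
by have := e i j; rewrite M0 mxE => /esym/eqP; rewrite mulf_eq0 (negbTE ui) (negbTE vj).
Qed.

Section RootsForm.
Set Implicit Arguments.
Unset Strict Implicit.
Context {R : realType} {N : nat}.
Local Notation C := R[i].
Context (N_gt0 : (0 < N)%N) (eta : C) (xi : 'I_N -> C).
Hypothesis xi_sub : forall i j, i != j -> csinh (xi i - xi j) != 0.
Hypothesis xi_sub_eta : forall i j, csinh (xi i - xi j + eta) != 0.
Local Notation a := (a eta xi).
Local Notation d := (d xi).
Local Notation d' := (d' xi).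
Variables (p q : 'I_N -> C) (tauP tauQ : C -> C).
Hypotheses (hTP : TQ_data eta xi p tauP) (hTQ : TQ_data eta xi q tauQ).
Hypotheses (hp : forall k, tpoly p (xi k - eta) != 0) (hq : forall k, tpoly q (xi k - eta) != 0).
Local Notation P := (tpoly p).
Local Notation Q := (tpoly q).

Lemma tpoly_root (r : 'I_N -> C) k : tpoly r (r k) = 0.
Proof. by rewrite /tpoly (bigD1 k) //= subrr mul0r csinhE cexp0 invr1 subrr !mul0r. Qed.

(* [Q x * coth ((x - q j) / 2)] without its removable singularity. *)
Definition cobasis_half j x : C :=
  ccosh ((x - q j) / 2) * \prod_(l | l != j) csinh ((x - q l) / 2).

Lemma half_trig_cobasis j : half_trig N (cobasis_half j).
Proof.
have := half_trigM (half_trig_ccosh (q j)) (@half_trig_prod _ _ (predC1 j)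
  (fun l x => csinh ((x - q l) / 2)) (fun l _ => half_trig_csinh (q l))).
by rewrite cardC1 card_ord add1n prednK.
Qed.

Lemma cobasis_halfE j x : csinh ((x - q j) / 2) != 0 ->
  cobasis_half j x = Q x * ccoth ((x - q j) / 2).
Proof. by move=> h; rewrite /tpoly (bigD1 j) //= /cobasis_half /ccoth; field. Qed.

Definition bracket j x : C :=
  cobasis_half j (x - eta) * P (x + ipi) - cobasis_half j (x - eta + ipi) * P x.

Lemma trig_bracket j : trig N (bracket j).
Proof.
have [r hr e] := trig_odd (half_trigM (half_trig_shift (- eta) (half_trig_cobasis j))
   (half_trig_shift ipi (half_trig_tpoly p))).
exists r => // x; rewrite -e /bracket tpoly_2ipi (addrAC x ipi).
have := sqrr_sign C N; rewrite expr2 => hs; congr (_ - _).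
by transitivity ((-1) ^+ N * (-1) ^+ N * (cobasis_half j (x - eta + ipi) * P x)); [rewrite hs mul1r|ring].
Qed.

Lemma d_root_neq0 : (forall k, a (p k) != 0) -> forall k, d (p k) != 0.
Proof.
move=> ha k; apply/eqP => dk.
have : a (p k) * P (p k - eta) = 0.
  have := TQ_equation hTP (p k); rewrite tpoly_root dk mulr0 mul0r addr0 mulNr.
  by move/esym/eqP; rewrite oppr_eq0 => /eqP.
move/eqP; rewrite mulf_eq0 (negbTE (ha k)) /= => /eqP.
move/eqP; rewrite /tpoly prodf_seq_eq0 => /hasP[l _ /andP[_ /eqP h]].
have e1 : cexp (p k - eta) ^+ 2 = cexp (p l) ^+ 2.
  by apply/eqP; rewrite -[_ == _]negbK -csinh_sub_neq0 csinh_double h mulr0 mul0r eqxx.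
have [m em] := d_eq0 dk.
have /prodf_neq0 /(_ m isT) /eqP := ha l; apply.
apply/eqP; rewrite -[_ == _]negbK -addrAC csinh_sub_neq0 cexpD exprMn -e1 cexpB expr_div_n divfK ?em ?eqxx //.
by rewrite expf_neq0 ?cexp_neq0.
Qed.

Variable n : 'I_N.
Hypothesis hr : roots_regular eta xi p q tauQ n.

Lemma d_p_neq0 k : d (p k) != 0.
Proof. exact: d_root_neq0 (rr_a_p hr) k. Qed.

Lemma p_xi k l : csinh (p k - xi l) != 0.
Proof. exact: d_neq0P (d_p_neq0 k) l. Qed.

Lemma xi_p_roots l k : csinh (xi l - p k) != 0.
Proof. by rewrite -opprB csinhN oppr_eq0 p_xi. Qed.

Definition col_weight k : C := Q (p k - eta) * P (p k + ipi) / d (p k).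

Lemma col_weight_neq0 k : col_weight k != 0.
Proof. exact: mulf_neq0 (mulf_neq0 (rr_Q hr k) (rr_P hr k)) (invr_neq0 (d_p_neq0 k)). Qed.

Lemma coth_sum j k : col_weight k * ccoth ((p k - q j - eta) / 2) =
  - \sum_l bracket j (xi l) / (d' l * csinh (xi l - p k)).
Proof.
have := @trig_partial_fractions R (bracket j) 'I_N xi (p k).
rewrite card_ord => /(_ (trig_bracket j) xi_sub (p_xi k)) e.
have -> : - \sum_l bracket j (xi l) / (d' l * csinh (xi l - p k)) =
   \sum_l bracket j (xi l) / (d' l * csinh (p k - xi l)).
  rewrite -sumrN; apply: eq_bigr => l _.
  by rewrite -[csinh (xi l - p k)]opprK -csinhN opprB mulrN invrN mulrN opprK.
rewrite -e /bracket tpoly_root mulr0 subr0 /col_weight.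
rewrite cobasis_halfE; last by rewrite addrAC (rr_sinh_eta hr).
by rewrite (addrAC (p k) (- eta)) -/(d (p k)); have h := d_p_neq0 k; field.
Qed.

Lemma q_xi_neq0 j l : csinh (q j - xi l + eta) != 0.
Proof. by have /prodf_neq0 /(_ l isT) := rr_a_q hr j. Qed.

Lemma xi_eta_q j l : (csinh ((xi l - eta - q j) / 2) != 0) && (ccosh ((xi l - eta - q j) / 2) != 0).
Proof.
have : csinh (xi l - eta - q j) != 0.
  have -> : xi l - eta - q j = - (q j - xi l + eta) by ring.
  by rewrite csinhN oppr_eq0 q_xi_neq0.
by rewrite csinh_double !mulf_eq0 !negb_or => /andP[/andP[_ ->]].
Qed.

Definition bracket2 j x : C :=
  2 * (Q (x + eta) * P (x + ipi) * ccosh ((x - q j) / 2) ^+ 2 -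
       Q (x + eta + ipi) * P x * csinh ((x - q j) / 2) ^+ 2).

Lemma trig_bracket2 j : trig N.+1 (bracket2 j).
Proof.
pose f x := (Q (x + eta) * ccosh ((x - q j) / 2)) * (P (x + ipi) * ccosh ((x - q j) / 2)).
have hf : half_trig (N.+1 + N.+1) f.
  rewrite -addn1; apply: half_trigM.
    by apply: half_trigM (half_trig_ccosh (q j)); apply: half_trig_shift (half_trig_tpoly q).
  by apply: half_trigM (half_trig_ccosh (q j)); apply: half_trig_shift (half_trig_tpoly p).
have [r h e] := trigZ 2 (trig_odd hf).
exists r => // x; rewrite -e /f /bracket2 tpoly_2ipi (addrAC x ipi) (addrAC x ipi) ccosh_half_ipi.
have := sqrr_sign C N; rewrite expr2 => hs; congr (_ * _).
rewrite (exprS (-1) N).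
transitivity (Q (x + eta) * P (x + ipi) * ccosh ((x - q j) / 2) ^+ 2 +
  ((-1) ^+ N * (-1) ^+ N) * 'i%C ^+ 2 * (Q (x + eta + ipi) * P x * csinh ((x - q j) / 2) ^+ 2)).
  by rewrite hs sqr_i; ring.
by ring.
Qed.

Lemma bracket2_xi j l : bracket2 j (xi l - eta) / csinh (xi l - eta - q j) =
  - (tauP (xi l) / tauQ (xi l) * bracket j (xi l)).
Proof.
have /andP[s0 c0] := xi_eta_q j l.
have i0 := i_neq0 (R := R).
rewrite /bracket2 /bracket subrK (csinh_double (xi l - eta - q j)) cobasis_halfE //.
rewrite cobasis_halfE; last by rewrite addrAC csinh_half_ipi mulf_neq0.
rewrite (addrAC (xi l - eta) ipi) /ccoth csinh_half_ipi ccosh_half_ipi.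
have a0 := a_xi_neq0 xi_sub_eta l.
have tQ0 := tau_xi_neq0 xi_sub_eta hTQ hq l.
have -> : Q (xi l) = - (a (xi l) / tauQ (xi l) * Q (xi l - eta)).
  by apply: (mulfI tQ0); rewrite (TQ_xi hTQ); field.
have -> : Q (xi l + ipi) = a (xi l) / tauQ (xi l) * Q (xi l - eta + ipi).
  by apply: (mulfI tQ0); rewrite (TQ_xi_ipi N_gt0 hTQ); field.
have -> : P (xi l - eta) = - (tauP (xi l) / a (xi l) * P (xi l)).
  by apply: (mulfI a0); apply: oppr_inj; rewrite -(TQ_xi hTP); field.
have -> : P (xi l - eta + ipi) = tauP (xi l) / a (xi l) * P (xi l + ipi).
  by apply: (mulfI a0); rewrite -(TQ_xi_ipi N_gt0 hTP); field.
move: (csinh _) (ccosh _) (P _) (P _) (Q _) (Q _) s0 c0 => s c P1 P2 Q1 Q2 s0 c0.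
by field; rewrite s0 c0 i0 a0 tQ0.
Qed.

Lemma second_sum j k :
  P (p k + ipi) * Q (p k + eta) * ccoth ((p k - q j) / 2) / a (p k) -
  2 * Q (q j + eta) * P (q j + ipi) / (a (q j) * csinh (p k - q j)) =
  \sum_l tauP (xi l) / tauQ (xi l) * bracket j (xi l) / (d' l * csinh (xi l - p k - eta)).
Proof.
pose y (i : 'I_N.+1) := if unlift ord0 i is Some l then xi l - eta else q j.
have y0 : y ord0 = q j by rewrite /y unlift_none.
have y1 l : y (lift ord0 l) = xi l - eta by rewrite /y liftK.
have hy : forall i i', i != i' -> csinh (y i - y i') != 0.
  move=> i i'; case: (unliftP ord0 i) => [l ->|->]; case: (unliftP ord0 i') => [l' ->|->];
    rewrite ?y0 ?y1 ?eqxx //.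
  - rewrite (inj_eq lift_inj) => ll'.
    have -> : xi l - eta - (xi l' - eta) = xi l - xi l' by ring.
    exact: xi_sub.
  - move=> _; have -> : xi l - eta - q j = - (q j - xi l + eta) by ring.
    by rewrite csinhN oppr_eq0 q_xi_neq0.
  move=> _; have -> : q j - (xi l' - eta) = q j - xi l' + eta by ring.
  exact: q_xi_neq0.
have hpy : forall i, csinh (p k - y i) != 0.
  move=> i; case: (unliftP ord0 i) => [l ->|->]; rewrite ?y0 ?y1.
    have -> : p k - (xi l - eta) = p k - xi l + eta by ring.
    by have /prodf_neq0 /(_ l isT) := rr_a_p hr k.
  exact: rr_sinh hr j k.
have := @trig_partial_fractions R (bracket2 j) 'I_N.+1 y (p k).
rewrite card_ord => /(_ (trig_bracket2 j) hy hpy).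
rewrite !big_ord_recl /= y0.
have pE x : \prod_(i < N) csinh (x - y (lift ord0 i)) = a x.
  by apply: eq_bigr => l _; rewrite y1; congr csinh; ring.
rewrite pE.
have -> : \prod_(j0 | j0 != ord0) csinh (q j - y j0) = a (q j).
  by rewrite big_mkcond big_ord_recl /= mul1r -pE.
have -> : \sum_(i < N) bracket2 j (y (lift ord0 i)) /
   (\prod_(j0 | j0 != lift ord0 i) csinh (y (lift ord0 i) - y j0) * csinh (p k - y (lift ord0 i))) =
   \sum_l tauP (xi l) / tauQ (xi l) * bracket j (xi l) / (d' l * csinh (xi l - p k - eta)).
  apply: eq_bigr => l _; rewrite y1 big_mkcond big_ord_recl /= y0.
  have -> : \prod_(i < N) (if lift ord0 i != lift ord0 l then csinh (xi l - eta - y (lift ord0 i)) else 1) = d' l.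
    rewrite [RHS]big_mkcond; apply: eq_bigr => i _; rewrite (inj_eq lift_inj) y1.
    by case: ifP => // _; congr csinh; ring.
  have -> : csinh (p k - (xi l - eta)) = - csinh (xi l - p k - eta).
    by rewrite -csinhN; congr csinh; ring.
  transitivity (- (bracket2 j (xi l - eta) / csinh (xi l - eta - q j)) /
     (d' l * csinh (xi l - p k - eta))); last by rewrite bracket2_xi opprK.
  by move: (bracket2 _ _) (csinh _) (d' l) (csinh _) => b1 b2 b3 b4; rewrite !invfM invrN; ring.
have s00 : csinh (0 : C) = 0 by rewrite csinhE cexp0 invr1 subrr mul0r.
have c00 : ccosh (0 : C) = 1 by rewrite ccoshE cexp0 invr1 -mulr2n -[1 *+ 2]/2 divff ?two_neq0.
have -> : bracket2 j (p k) =
    2 * (Q (p k + eta) * P (p k + ipi) * ccosh ((p k - q j) / 2) ^+ 2).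
  by rewrite /bracket2 tpoly_root mulr0 mul0r subr0.
have -> : bracket2 j (q j) = 2 * (Q (q j + eta) * P (q j + ipi)).
  by rewrite /bracket2 subrr mul0r s00 c00 expr1n mulr1 expr0n mulr0 subr0.
rewrite (csinh_double (p k - q j)) /ccoth => e.
have s0 := rr_sinh_half hr j k.
have c0 : ccosh ((p k - q j) / 2) != 0.
  by apply: contraNneq (rr_sinh hr j k) => h; rewrite csinh_double h mulr0.
have a0 := rr_a_p hr k; have a0' := rr_a_q hr j.
move: e; move: (\sum_(l < N) _) => S e.
apply: (addrI (2 * (Q (q j + eta) * P (q j + ipi)) /
  (a (q j) * (2 * csinh ((p k - q j) / 2) * ccosh ((p k - q j) / 2))))).
rewrite -e; move: (csinh _) (ccosh _) (Q _) (Q _) (P _) (P _) s0 c0 => s c Q1 Q2 P1 P2 s0 c0.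
by field; rewrite s0 c0 a0 a0'.
Qed.

Definition bracket_mx : 'M[C]_N := \matrix_(j, l) (bracket j (xi l) / (d' l * tauQ (xi l))).

Local Notation col_weights := (diag_mx (\row_k col_weight k)).

Lemma tQ_neq0 l : tauQ (xi l) != 0.
Proof. exact: (tau_xi_neq0 xi_sub_eta hTQ hq). Qed.

Lemma coth_factor : coth_matrix eta q p *m col_weights =
  - (bracket_mx *m diag_mx (\row_l tauQ (xi l)) *m cauchy_mx xi p).
Proof.
apply/matrixP => j k; rewrite mul_mx_diag !mxE mulrC coth_sum; congr (- _).
apply: eq_bigr => l _; rewrite mul_mx_diag !mxE.
have h1 := tQ_neq0 l; have h2 := d'_neq0 xi_sub l; have h3 := xi_p_roots l k.
by field; rewrite h1 h2 h3.
Qed.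

Lemma S_factor : S_matrix eta xi (cexp (- eta)) q p *m col_weights =
  - (bracket_mx *m sov_mx eta xi p tauP tauQ).
Proof.
apply/matrixP => j k; rewrite mul_mx_diag !mxE.
have -> : - \sum_l bracket_mx j l * sov_mx eta xi p tauP tauQ l k =
  - (\sum_l bracket j (xi l) / (d' l * csinh (xi l - p k))) + cexp (- eta) *
  \sum_l tauP (xi l) / tauQ (xi l) * bracket j (xi l) / (d' l * csinh (xi l - p k - eta)).
  rewrite mulr_sumr -!sumrN -big_split /=; apply: eq_bigr => l _; rewrite !mxE.
  have h1 := tQ_neq0 l; have h2 := d'_neq0 xi_sub l; have h3 := xi_p_roots l k.
  have h4 := xi_p_eta N_gt0 xi_sub_eta hTP hp xi_p_roots l k.
  by move: (cexp _) => x; field; rewrite h1 h2 h3 h4.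
rewrite -coth_sum -second_sum /frak_a /col_weight.
have a0 := rr_a_p hr k; have a0' := rr_a_q hr j; have q0 := rr_Q hr k; have p0 := rr_P hr k.
have d0 := d_p_neq0 k; have s0 := rr_sinh hr j k.
by move: (cexp _) => x; field; rewrite a0 a0' q0 p0 d0 s0.
Qed.

Lemma P_entry j k : P_matrix eta xi q p (xi n) j k * col_weight k =
  bracket j (xi n) * (cexp (- xi n) * a (xi n) / \prod_l csinh (xi n - p l)) * cexp (p k).
Proof.
have /andP[s0 c0] := xi_eta_q j n.
have e1 := cobasis_halfE s0.
have e2 : cobasis_half j (xi n - eta + ipi) = Q (xi n - eta + ipi) * ccoth ((xi n - eta - q j + ipi) / 2).
  rewrite cobasis_halfE (addrAC (xi n - eta) ipi) //.
  by rewrite csinh_half_ipi mulf_neq0 ?i_neq0.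
have e3 : \prod_l csinh (xi n - p l) = (- 2 * 'i%C) ^+ N * (P (xi n) * P (xi n + ipi)).
  rewrite tpoly_double mulrA -exprMn (_ : - 2 * 'i%C * ('i%C / 2) = 1 :> C) ?expr1n ?mul1r //.
  by transitivity (- 'i%C ^+ 2 : C); [field | rewrite sqr_i opprK].
rewrite mxE /bracket e1 e2 e3 (addrAC (xi n) (- q j)) cexpD /col_weight.
have p0 := rr_P_xi hr; have p0' := rr_P_xi_ipi hr.
have d0 := d_p_neq0 k; have q0 := rr_Q hr k; have pk0 := rr_P hr k.
have i0 : (- 2 * 'i%C : C) ^+ N != 0.
  by rewrite expf_neq0 // mulf_neq0 ?i_neq0 // oppr_eq0 two_neq0.
move: (ccoth _) (ccoth _) (cexp _) (cexp _) => c1 c2 x1 x2.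
move: (Q (xi n - eta)) (Q (xi n - eta + ipi)) (P (xi n)) (P (xi n + ipi)) p0 p0' => Q1 Q2 P1 P2 p0 p0'.
move: (Q _) (P _) (d _) (_ ^+ N) d0 q0 pk0 i0 => Q3 P3 dk iN d0 q0 pk0 i0.
by field; rewrite p0 p0' d0 q0 pk0 i0.
Qed.

Lemma P_factor : P_matrix eta xi q p (xi n) *m col_weights = bracket_mx *m sov_pert eta xi p tauQ n.
Proof.
apply/matrixP => j k; rewrite mul_mx_diag mxE [X in _ * X]mxE P_entry mxE.
rewrite [RHS](bigD1 n) //= [X in _ = _ + X]big1 => [|l ln]; last first.
  by rewrite !mxE (negbTE ln) mulr0n mulr0.
rewrite !mxE eqxx mulr1n addr0 /sov_pert_scale -/(d' n).
have h1 := tQ_neq0 n; have h2 := d'_neq0 xi_sub n.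
have h3 : \prod_l csinh (xi n - p l) != 0 by apply/prodf_neq0 => l _; apply: xi_p_roots.
by move: (cexp _) (cexp _) (\prod_l _) h3 => x y A h3; field; rewrite h1 h2 h3.
Qed.

Lemma det_col_weights_neq0 : \det col_weights != 0.
Proof.
by rewrite det_diag; apply/prodf_neq0 => k _; rewrite mxE; apply: col_weight_neq0.
Qed.

Lemma det_coth_factor : \det (coth_matrix eta q p) * \det col_weights =
  (-1) ^+ N * (\det bracket_mx * (\prod_l tauQ (xi l)) * \det (cauchy_mx xi p)).
Proof.
rewrite -det_mulmx coth_factor -scaleN1r detZ !det_mulmx det_diag; congr (_ * (_ * _ * _)).
by apply: eq_bigr => l _; rewrite mxE.
Qed.

Lemma det_bracket_cauchy_neq0 : (\det bracket_mx != 0) && (\det (cauchy_mx xi p) != 0).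
Proof.
have := mulf_neq0 (rr_det hr) det_col_weights_neq0.
rewrite det_coth_factor !mulf_eq0 !negb_or => /andP[_ /andP[/andP[-> _] ->]] //.
Qed.

Lemma form_factor_roots_det kappa eps F :
  F * ((\prod_k tauQ (xi k)) * \det (cauchy_mx xi p)) =
    cexp (\sum_j xi j - \sum_j p j) *
      (\det (sov_mx eta xi p tauP tauQ + sov_pert eta xi p tauQ n) - \det (sov_mx eta xi p tauP tauQ)) ->
  eps * kappa * tau_ratio xi tauP tauQ n * F = form_factor_roots eta xi kappa eps p q tauP tauQ n.
Proof.
move=> HF; have /andP[b0 c0] := det_bracket_cauchy_neq0; have w0 := det_col_weights_neq0.
have s0 := negbT (signr_eq0 C N).
rewrite /form_factor_roots; set S := S_matrix _ _ _ _ _.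
have e1 : \det S * \det col_weights = (-1) ^+ N * (\det bracket_mx * \det (sov_mx eta xi p tauP tauQ)).
  by rewrite -det_mulmx S_factor -scaleN1r detZ det_mulmx.
have e2 : \det (S - P_matrix eta xi q p (xi n)) * \det col_weights = (-1) ^+ N *
    (\det bracket_mx * \det (sov_mx eta xi p tauP tauQ + sov_pert eta xi p tauQ n)).
  rewrite -det_mulmx mulmxBl S_factor P_factor -opprD -mulmxDr -scaleN1r detZ det_mulmx //.
have e3 := det_coth_factor; have t0 : \prod_l tauQ (xi l) != 0 by apply/prodf_neq0 => l _; apply: tQ_neq0.
have ex : cexp (- \sum_j (p j - xi j)) = cexp (\sum_j xi j - \sum_j p j).
  by rewrite sumrB opprB.
rewrite ex; have cd0 := rr_det hr.
move: (\det S) (\det (S - _)) (\det (coth_matrix _ _ _)) (\det col_weights) (\det bracket_mx) (\det (cauchy_mx _ _))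
  e1 e2 e3 w0 b0 c0 HF cd0 => dS dSP dC w b c e1 e2 e3 w0 b0 c0 HF cd0.
move: ((-1) ^+ N) s0 e1 e2 e3 => sg s0 e1 e2 e3.
have -> : dC = sg * (b * \prod_l tauQ (xi l) * c) / w by rewrite -e3 mulfK.
have -> : dS = sg * (b * \det (sov_mx eta xi p tauP tauQ)) / w by rewrite -e1 mulfK.
have -> : dSP = sg * (b * \det (sov_mx eta xi p tauP tauQ + sov_pert eta xi p tauQ n)) / w by rewrite -e2 mulfK.
have -> : F = cexp (\sum_j xi j - \sum_j p j) * (\det (sov_mx eta xi p tauP tauQ + sov_pert eta xi p tauQ n) -
   \det (sov_mx eta xi p tauP tauQ)) / ((\prod_k tauQ (xi k)) * c).
  by rewrite -HF mulfK // mulf_neq0.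
move: (cexp _) (\det _) (\det _) (\prod_k _) t0 (tau_ratio _ _ _ _) => x A B T t0 ra.
by field; rewrite s0 b0 c0 w0 t0.
Qed.

Lemma rank_P_matrix : \rank (P_matrix eta xi q p (xi n)) = 1%N.
Proof.
have /andP[b0 _] := det_bracket_cauchy_neq0.
have [j bj] : exists j, bracket j (xi n) != 0.
  apply: contrapT => h; case/negP: b0; apply/eqP.
  rewrite (expand_det_col _ n) big1 // => j _; rewrite mxE.
  have [-> |bj] := eqVneq (bracket j (xi n)) 0; first by rewrite !mul0r.
  by case: h; exists j.
apply: (@rank_outer _ _ _ _
  (fun j => bracket j (xi n) * (cexp (- xi n) * a (xi n) / \prod_l csinh (xi n - p l)))
  (fun k => cexp (p k) / col_weight k) j n).
- by move=> i k; rewrite [RHS]mulrA -P_entry mulfK ?col_weight_neq0.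
- rewrite mulf_neq0 // mulf_neq0 ?invr_neq0 //; first by rewrite mulf_neq0 ?cexp_neq0 ?a_xi_neq0.
  by apply/prodf_neq0 => l _; apply: xi_p_roots.
by rewrite mulf_neq0 ?invr_neq0 ?cexp_neq0 ?col_weight_neq0.
Qed.

End RootsForm.

Section Inhomogeneities.
Set Implicit Arguments.
Unset Strict Implicit.
Variables (R : realType) (N : nat) (eta : R[i]) (xi : 'I_N -> R[i]).
Local Notation C := R[i].
Hypothesis heta : ~ commensurate eta ipi.
Hypothesis hXi : forall i j : 'I_N, i <> j -> Xi eta xi i `&` Xi eta xi j = set0.

Lemma Xi_disjoint i j x : i <> j -> Xi eta xi i x -> Xi eta xi j x -> False.
Proof. by move=> /hXi ij hi hj; have : (Xi eta xi i `&` Xi eta xi j) x by []; rewrite ij. Qed.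

Lemma csinh_xi_sub i j : i != j -> csinh (xi i - xi j) != 0.
Proof.
move=> /eqP ij; apply/eqP => /csinh_eq0[k e]; apply: (Xi_disjoint (x := xi i) ij).
  by exists 0; [left | exists 0; rewrite !mul0r !addr0].
by exists 0; [left | exists k; rewrite mul0r addr0 -e addrC subrK].
Qed.

Lemma csinh_xi_sub_eta i j : csinh (xi i - xi j + eta) != 0.
Proof.
apply/eqP => /csinh_eq0[k e]; have [ij|/eqP ij] := eqVneq i j.
  apply: heta; exists k%:~R.
  by rewrite ratr_int -e ij subrr add0r.
apply: (Xi_disjoint (x := xi i) ij).
  by exists 0; [left | exists 0; rewrite !mul0r !addr0].
exists (-1); first by right.
by exists k; rewrite mulN1r -e; ring.
Qed.

End Inhomogeneities.

Section FormFactors.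
Set Implicit Arguments.
Unset Strict Implicit.
Variables (R : realType) (N : nat).
Local Notation C := R[i].
Local Notation op := 'M[C]_#|{: config N}|.

Lemma bra_prod (I : Type) (s : seq I) (b : 'rV[C]_#|{: config N}|) (T : I -> op) l :
  (forall k, b *m T k = l k *: b) ->
  b *m (\prod_(k <- s) T k) = (\prod_(k <- s) l k) *: b.
Proof.
move=> hb; elim: s => [|k s IH]; first by rewrite !big_nil mulmx1 scale1r.
by rewrite !big_cons -mulmxE mulmxA hb -scalemxAl IH scalerA.
Qed.

Lemma prod_ket (I : Type) (s : seq I) (v : 'cV[C]_#|{: config N}|) (T : I -> op) l :
  (forall k, T k *m v = l k *: v) ->
  (\prod_(k <- s) T k) *m v = (\prod_(k <- s) l k) *: v.
Proof.
move=> hv; elim: s => [|k s IH]; first by rewrite !big_nil mul1mx scale1r.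
by rewrite !big_cons -mulmxE -mulmxA IH -scalemxAr hv scalerA mulrC.
Qed.

Lemma matrix_element_scale (u : 'rV[C]_#|{: config N}|) c (M : op) v :
  matrix_element u (c *: M) v = c * matrix_element u M v.
Proof. by rewrite /matrix_element /pairing -scalemxAl -scalemxAr mxE. Qed.

Lemma take_enum_ord (n : 'I_N) : enum 'I_N = take n (enum 'I_N) ++ n :: drop n.+1 (enum 'I_N).
Proof.
rewrite -[LHS](cat_take_drop n) (drop_nth n) ?size_enum_ord //.
by rewrite nth_ord_enum.
Qed.

Lemma prod_take_enum (n : 'I_N) (F : 'I_N -> C) :
  \prod_(k <- take n (enum 'I_N)) F k = \prod_(k < N | (k < n)%N) F k.
Proof.
rewrite -[RHS]big_filter; apply: perm_big; apply: uniq_perm.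
- exact: take_uniq (enum_uniq _).
- exact: filter_uniq (index_enum_uniq _).
by move=> k; rewrite [RHS]mem_filter mem_index_enum andbT in_take ?mem_enum // index_enum_ord.
Qed.

Lemma prod_le_ord (n : 'I_N) (F : 'I_N -> C) :
  \prod_(k < N | (k <= n)%N) F k = \prod_(k < N | (k < n)%N) F k * F n.
Proof.
rewrite (bigD1 n) //= mulrC; congr (_ * _); apply: eq_bigl => k.
by rewrite ltn_neqAle andbC.
Qed.

Variables (eta : C) (xi : 'I_N -> C).

Lemma trace_opE X u :
  trace_op eta xi X u = \sum_i \sum_j X i j *: monodromy eta xi u j i.
Proof.
apply: eq_bigr => i _; rewrite mxE; apply: eq_bigr => j _.
by rewrite mxE -mulmxE mul_scalar_mx.
Qed.

Lemma trace_op_minus kappa u :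
  trace_op eta xi (delta_mx 1 0 *m twist kappa) u = kappa *: opD eta xi u.
Proof.
rewrite trace_opE !sum_I2 ![(delta_mx _ _ *m _) _ _]mxE !sum_I2 !(mxE delta_mx_key) !twistE /=.
by rewrite !(mul0r, mul1r, mulr0, addr0, add0r, scale0r).
Qed.

Lemma trace_op_plus kappa u :
  trace_op eta xi (delta_mx 0 1 *m twist kappa) u = kappa^-1 *: opA eta xi u.
Proof.
rewrite trace_opE !sum_I2 ![(delta_mx _ _ *m _) _ _]mxE !sum_I2 !(mxE delta_mx_key) !twistE /=.
by rewrite !(mul0r, mul1r, mulr0, addr0, add0r, scale0r).
Qed.

Hypothesis N_gt0 : (0 < N)%N.
Hypothesis xi_sub : forall i j, i != j -> csinh (xi i - xi j) != 0.
Hypothesis xi_sub_eta : forall i j, csinh (xi i - xi j + eta) != 0.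
Variables (p q : 'I_N -> C) (tauP tauQ : C -> C) (kappa eps : C).
Hypothesis hTP : TQ_data eta xi p tauP.
Hypothesis hTQ : TQ_data eta xi q tauQ.
Hypothesis hp : forall m, tpoly p (xi m - eta) != 0.
Hypothesis hq : forall m, tpoly q (xi m - eta) != 0.
Hypothesis kappa0 : kappa != 0.
Hypothesis heps : eps * eps = 1.
Variables (b : 'rV[C]_#|{: config N}|) (v : 'cV[C]_#|{: config N}|).
Hypothesis hb : forall u, b *m transfer eta xi kappa u = (eps * tauP u) *: b.
Hypothesis hv : forall u, transfer eta xi kappa u *m v = (eps * tauQ u) *: v.
Hypothesis v0 : v != 0.

Let tQ0 k : tauQ (xi k) != 0 := tau_xi_neq0 xi_sub_eta hTQ hq k.

Let eps0 : eps != 0.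
Proof. by apply: contra_eq_neq heps => ->; rewrite mul0r eq_sym oner_neq0. Qed.

Lemma matrix_element_site n X :
  matrix_element b (site n X) v = eps * tau_ratio xi tauP tauQ n *
    matrix_element b (trace_op eta xi (X *m twist kappa) (xi n)) v.
Proof.
have := local_operator_trace eta xi (twist kappa) X (take_enum_ord n).
move: (trace_op _ _ (X *m _) _) => t /(congr1 (fun M => b *m (M *m v))).
have hb' k : b *m trace_op eta xi (twist kappa) (xi k) = (eps * tauP (xi k)) *: b := hb (xi k).
have hv' k : trace_op eta xi (twist kappa) (xi k) *m v = (eps * tauQ (xi k)) *: v := hv (xi k).
rewrite -!mulmxE -!mulmxA hv' -scalemxAr (prod_ket _ hv') scalerA.
rewrite [RHS]mulmxA (bra_prod _ hb') -!scalemxAr -scalemxAl.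
rewrite !big_split /= !prod_take_enum.
move/(congr1 (fun M => fun_of_matrix M ord0 ord0)); rewrite [LHS]mxE [RHS]mxE.
rewrite -[(b *m (site n X *m v)) _ _]/(matrix_element b (site n X) v).
rewrite -[(b *m (t *m v)) _ _]/(matrix_element b t v) /tau_ratio prod_le_ord.
have : \prod_(k < N | (k < n)%N) tauQ (xi k) != 0 by apply/prodf_neq0.
have : \prod_(k < N | (k < n)%N) eps != 0 by apply/prodf_neq0.
move: (tQ0 n); move: (\prod_(k < N | _) eps) (\prod_(k < N | _) tauP _) (\prod_(k < N | _) tauQ _).
move: (matrix_element _ _ _) (matrix_element _ _ _) (tauQ _) => y x t1 e A B t0 e0 B0 h.
apply: (mulfI e0); apply: (mulfI (mulf_neq0 B0 t0)).
transitivity (eps * eps * (e * B * t1 * x)); first by rewrite heps; ring.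
transitivity (eps * (e * A * y)); last by field; rewrite B0 t0.
by rewrite -h; ring.
Qed.

Lemma matrix_element_sigma_minus n : matrix_element b (sigma_minus n) v =
  eps * kappa * tau_ratio xi tauP tauQ n * matrix_element b (opD eta xi (xi n)) v.
Proof. by rewrite matrix_element_site trace_op_minus matrix_element_scale; ring. Qed.

Lemma matrix_element_sigma_plus n : matrix_element b (sigma_plus n) v =
  eps * kappa^-1 * tau_ratio xi tauP tauQ n * matrix_element b (opA eta xi (xi n)) v.
Proof. by rewrite matrix_element_site trace_op_plus matrix_element_scale; ring. Qed.

Lemma prod_tau p' tau' : TQ_data eta xi p' tau' -> (forall m, tpoly p' (xi m - eta) != 0) ->
  \prod_k tau' (xi k) = (\prod_k - a eta xi (xi k)) *
     \prod_k (tpoly p' (xi k - eta) / tpoly p' (xi k)).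
Proof.
move=> h h'; rewrite -big_split /=; apply: eq_bigr => k _.
have P0 := P_xi_neq0 xi_sub_eta h h' k.
by apply: (mulIf P0); rewrite (TQ_xi h) mulrA mulfVK // mulNr.
Qed.

Lemma prod_tau_exp : \prod_k tauP (xi k) =
  cexp (\sum_j (p j - q j)) * \prod_k tauQ (xi k).
Proof.
have X0 : \prod_k cexp (xi k) != 0 by apply/prodf_neq0 => k _; apply: cexp_neq0.
apply: (mulIf X0); rewrite (prod_tau hTP hp) (prod_tau hTQ hq).
have eP := prod_P_ratio N_gt0 xi_sub xi_sub_eta hTP hp.
have eQ := prod_P_ratio N_gt0 xi_sub xi_sub_eta hTQ hq.
have -> : cexp (\sum_j (p j - q j)) = cexp (\sum_j p j) / cexp (\sum_j q j).
  by rewrite sumrB cexpB.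
rewrite -[LHS]mulrA eP; have y0 := cexp_neq0 (\sum_j q j).
transitivity (cexp (\sum_j p j) / cexp (\sum_j q j) * (\prod_k - a eta xi (xi k)) *
    (\prod_k (tpoly q (xi k - eta) / tpoly q (xi k)) * \prod_k cexp (xi k))).
  rewrite eQ; move: (cexp _) y0 => y y0; move: (cexp (\sum_j _)) => x.
  move: (_ ^+ N) (_ ^+ N) (\prod_(i < N) _) (\prod_(i < N) _) => e1 e2 e3 e4.
  by field.
by rewrite !mulrA.
Qed.

(* [\prod_k tr (K T (xi k))] is a multiple of [G = K (x) ... (x) K], and [G]
   intertwines [D] and [A]. *)
Lemma matrix_element_opA u : matrix_element b (opA eta xi u) v =
  cexp (\sum_j (p j - q j)) * matrix_element b (opD eta xi u) v.
Proof.
have hb' k : b *m trace_op eta xi (twist kappa) (xi k) = (eps * tauP (xi k)) *: b := hb (xi k).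
have hv' k : trace_op eta xi (twist kappa) (xi k) *m v = (eps * tauQ (xi k)) *: v := hv (xi k).
have [c hc] := transfer_prod_all eta xi (twist kappa).
have GG := @site_all_sqr R N _ (twist_sqr kappa0).
have GD := site_all_opD eta xi u kappa0.
move: prod_tau_exp; move: (cexp _) => x ePQ.
have := prod_ket (enum 'I_N) hv'; have := bra_prod (enum 'I_N) hb'.
rewrite hc !big_enum /= !big_split /= ePQ.
move: GG GD; move: (site_all _) => G GG GD.
rewrite -mulmxE !mul_scalar_mx -scalemxAl -scalemxAr.
have : \prod_(k < N) eps * \prod_k tauQ (xi k) != 0.
  by rewrite mulf_neq0 //; apply/prodf_neq0.
move: (\prod_(k < N) eps) (\prod_k tauQ _) => e tq et0.
have -> : e * (x * tq) = x * (e * tq) by ring.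
move: (e * tq) et0 => t t0 eb ev.
have c2 : c ^+ 2 = t ^+ 2.
  have : c ^+ 2 *: v = t ^+ 2 *: v.
    rewrite !expr2 -!scalerA -ev [in RHS](_ : t *: (c *: (G *m v)) = c *: (G *m (t *: v))); last first.
      by rewrite -scalemxAr !scalerA mulrC.
    by rewrite -ev -scalemxAr mulmxA mulmxE GG mul1mx.
  by move/eqP; rewrite -subr_eq0 -scalerBl scaler_eq0 (negbTE v0) orbF subr_eq0 => /eqP.
have -> : opA eta xi u = G *m opD eta xi u *m G.
  by rewrite !mulmxE GD -mulrA GG mulr1.
apply: (mulfI (expf_neq0 2 t0)); rewrite -{1}c2 /matrix_element /pairing.
have -> : c ^+ 2 * (b *m (G *m opD eta xi u *m G *m v)) ord0 ord0 =
   ((c *: (b *m G)) *m (opD eta xi u *m (c *: (G *m v)))) ord0 ord0.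
  by rewrite -!scalemxAl -!scalemxAr scalerA !mulmxA [RHS]mxE expr2.
by rewrite eb ev -!scalemxAl -!scalemxAr scalerA [LHS]mxE; ring.
Qed.

Lemma matrix_element_sigma_ratio n : matrix_element b (sigma_plus n) v =
  kappa ^- 2 * cexp (\sum_j (p j - q j)) * matrix_element b (sigma_minus n) v.
Proof.
rewrite matrix_element_sigma_plus matrix_element_sigma_minus matrix_element_opA.
move: (cexp _) => x; move: kappa0 => k0.
by field.
Qed.

End FormFactors.

Theorem proposition4p5 (R : realType) (N : nat) (hN : (1 <= N)%N)
  (eta : R[i]) (heta : ~ commensurate eta ipi)
  (xi : 'I_N -> R[i])
  (hXi : forall i j : 'I_N, i <> j -> Xi eta xi i `&` Xi eta xi j = set0)
  (br : config N -> 'rV[R[i]]_#|{: config N}|)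
  (kt : config N -> 'cV[R[i]]_#|{: config N}|)
  (hSoV : SoV_bases eta xi br kt)
  (kappa : R[i]) (hkappa : kappa != 0)
  (eps : R[i]) (heps : eps = 1 \/ eps = -1)
  (n : 'I_N)
  (p q : 'I_N -> R[i]) (tauP tauQ : R[i] -> R[i])
  (hP : forall m, tpoly p (xi m - eta) != 0)
  (hQ : forall m, tpoly q (xi m - eta) != 0)
  (hleft : left_eigenstate eta xi br kappa eps p tauP)
  (hright : right_eigenstate eta xi kt kappa eps q tauQ) :
  let braP := separate_bra eta xi br (tpoly p) kappa eps in
  let ketQ := separate_ket eta xi kt (tpoly q) kappa eps in
  let ff_minus := matrix_element braP (sigma_minus n) ketQ in
  let ff_plus := matrix_element braP (sigma_plus n) ketQ in
  (* The two form factors agree only up to this factor, and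
     (kappa ^+ 2 * rho) ^+ 2 = 1: see FIDELITY in the notes. *)
  let rho := kappa ^- 2 * cexp (\sum_j (p j - q j)) in
  [/\ ff_plus = rho * ff_minus,
      roots_regular eta xi p q tauQ n ->
        [/\ ff_minus = form_factor_roots eta xi kappa eps p q tauP tauQ n,
            ff_plus = rho * form_factor_roots eta xi kappa eps p q tauP tauQ n &
            \rank (P_matrix eta xi q p (xi n)) = 1%N] &
      forall z : 'I_N -> R[i], tau_regular eta xi z p tauQ n ->
        [/\ ff_minus = form_factor_tau eta xi kappa eps z p tauP tauQ n,
            ff_plus = rho * form_factor_tau eta xi kappa eps z p tauP tauQ n &
            \rank (P_tau_matrix eta xi tauQ z p (xi n)) = 1%N]].
Proof.
have xs := csinh_xi_sub hXi; have xse := csinh_xi_sub_eta heta hXi.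
have ee : eps * eps = 1 by case: heps => ->; rewrite ?mulrNN mulr1.
case: hleft => hTP _ hb; case: hright => hTQ v0 hv; move=> braP ketQ ffm ffp rho.
have hpm : ffp = rho * ffm by apply: (matrix_element_sigma_ratio hN xs xse hTP hTQ hP hQ hkappa ee hb hv v0).
have hm : ffm = eps * kappa * tau_ratio xi tauP tauQ n * matrix_element braP (opD eta xi (xi n)) ketQ.
  exact: (matrix_element_sigma_minus xse hTQ hQ ee hb hv).
split=> // [hr | z hz].
  have hF : ffm = form_factor_roots eta xi kappa eps p q tauP tauQ n.
    rewrite hm; apply: (form_factor_roots_det hN xs xse hTP hTQ hP hQ hr).
    have /andP[_ c0] := det_bracket_cauchy_neq0 hN xs xse hTP hTQ hQ hr.
    exact: (separate_opD hN xs xse hSoV hkappa ee hTP hTQ hP hQ (xi_p_roots hTP hr)).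
  by split=> //; [rewrite hpm hF | apply: (rank_P_matrix hN xs xse hTP hTQ hQ hr)].
have xi_p k j : csinh (xi k - p j) != 0.
  have /prodf_neq0 /(_ k isT) := tr_d_p hz j.
  by rewrite -(opprB (xi k)) csinhN oppr_eq0.
have hF : ffm = form_factor_tau eta xi kappa eps z p tauP tauQ n.
  rewrite hm; apply: (form_factor_tau_det hN xs xse kappa eps hTP hTQ hP hQ hz) => c0.
  exact: (separate_opD hN xs xse hSoV hkappa ee hTP hTQ hP hQ xi_p).
split=> //; first by rewrite hpm hF.
apply: (@rank_outer _ _ _ _ (fun i => (csinh (z i - xi n))^-1)
  (fun k => cexp (p k) * (a eta xi (xi n) * tauQ (xi n) / \prod_l csinh (xi n - p l))) n n).
- move=> i j; rewrite mxE; move: (csinh (z i - _)) (cexp _) => s x.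
  by rewrite invfM; ring.
- by rewrite invr_eq0 (tr_z_xi hz).
rewrite mulf_neq0 ?cexp_neq0 // mulf_neq0 ?invr_eq0 //.
  by rewrite mulf_neq0 ?(tr_tauQ hz) ?a_xi_neq0.
by apply/prodf_neq0 => l _; apply: (tr_xi_p hz).
Qed.
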